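(* Let $d\ge1$ and $\alpha\in\mathbb R$. Then: (1) Weak homogeneity of degree $\alpha$ in $\mathcal G(\mathbb R^d)$ does not imply homogeneity of degree $\alpha$ in $\mathcal G(\mathbb R^d)$. Moreover, there exists $w\in\mathcal D'(\mathbb R^d)$ homogeneous of degree $\alpha$ such that $\iota(w)$ is not homogeneous in $\mathcal G(\mathbb R^d)$ (of degree $\alpha$). (2) There exist $u\in\mathcal G(\mathbb R^d)$ which are weakly homogeneous of degree $\alpha$ but are not associated to any distribution.
   Context: For $\Omega\subseteq\mathbb R^d$ open, the special Colombeau algebra is $\mathcal G(\Omega):=\mathcal E_M(\Omega)/\mathcal N(\Omega)$, where $\mathcal E_M(\Omega)$ is the set of nets $(u_\varepsilon)_{\varepsilon\in(0,1]}$ of (complex-valued) functions in $C^\infty(\Omega)$ such that for every compact $K\subset\Omega$ and every $\beta\in\mathbb N_0^d$ there is $N\ge 0$ with $\sup_{x\in K}|\partial^\beta u_\varepsilon(x)|=O(\varepsilon^{-N})$ as $\varepsilon\to 0$, and $\mathcal N(\Omega)$ is the set of nets such that for every compact $K\subset \Omega$, every $\beta\in\mathbb N_0^d$ and every $m\ge 0$, $\sup_{x\in K}|\partial^\beta u_\varepsilon(x)|=O(\varepsilon^{m})$ as $\varepsilon\to 0$. Operations and restrictions are componentwise on representatives; $u(\lambda x)$ is the class of $(x\mapsto u_\varepsilon(\lambda x))_\varepsilon$; $\mathbb R^+=(0,\infty)$. The ring of generalized numbers $\widetilde{\mathbb C}$ is the set of nets $(c_\varepsilon)_{\varepsilon\in(0,1]}$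 in $\mathbb C$ with $|c_\varepsilon|=O(\varepsilon^{-N})$ for some $N$, modulo nets with $|c_\varepsilon|=O(\varepsilon^p)$ for all $p\ge0$. For $u=[(u_\varepsilon)_\varepsilon]\in\mathcal G(\mathbb R^d)$ and $\phi\in\mathcal D(\mathbb R^d)$, $\int u\phi\,dx:=[(\int u_\varepsilon\phi\,dx)_\varepsilon]\in\widetilde{\mathbb C}$. Embedding: fix a mollifier $\rho\in\mathcal S(\mathbb R^d)$ with $\int\rho=1$ and $\int x^\beta\rho(x)\,dx=0$ for all $|\beta|\ge1$, and put $\rho_\varepsilon(x)=\varepsilon^{-d}\rho(x/\varepsilon)$. The linear embedding $\iota:\mathcal D'(\mathbb R^d)\to\mathcal G(\mathbb R^d)$ is defined by: $\iota(w)$ is the unique element of $\mathcal G(\mathbb R^d)$ such that for every relatively compact open $V\subset\mathbb R^d$ and every $\psi\in\mathcal D(\mathbb R^d)$ equal to $1$ on a neighbourhood of $\overline V$, $\iota(w)|_V$ is the class of $\big(((\psi w)*\rho_\varepsilon)|_V\big)_\varepsilon$. $u\in\mathcal G(\mathbb R^d)$ is homogeneous of degree $\alpha$ if $u(\lambda x)=\lambda^\alpha u(x)$ in $\mathcal G(\mathbb R^d)$ for every $\lambda\in\mathbb R^+$. It is weakly homogeneous of degree $\alpha$ if for each $\lambda\in\mathbb R^+$ and each $\phi\in\mathcal D(\mathbb R^d)$, $\int u(\lambda x)\phi(x)\,dx=\int\lambda^\alpha u(x)\phi(x)\,dx$ in $\widetilde{\mathbb C}$. A distribution $w\in\mathcal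 D'(\mathbb R^d)$ is homogeneous of degree $\alpha$ if $\langle w(x),\lambda^{-d}\phi(x/\lambda)\rangle=\lambda^\alpha\langle w,\phi\rangle$ for all $\lambda\in\mathbb R^+$, $\phi\in\mathcal D(\mathbb R^d)$. $u\in\mathcal G(\mathbb R^d)$ is associated to $w\in\mathcal D'(\mathbb R^d)$ if $\int u_\varepsilon\phi\,dx\to\langle w,\phi\rangle$ as $\varepsilon\to0$ for every $\phi\in\mathcal D(\mathbb R^d)$. *)

(* Defs.v *)
From HB Require Import structures.
From mathcomp Require Import all_boot all_order all_algebra.
From mathcomp Require Import all_classical all_reals all_analysis.
From mathcomp Require Import complex lra.
Set Implicit Arguments. Unset Strict Implicit. Unset Printing Implicit Defensive.
Import Order.TTheory GRing.Theory Num.Theory.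
Import numFieldNormedType.Exports.
Local Open Scope classical_set_scope.
Local Open Scope ring_scope.
Local Open Scope complex_scope.

(* R : realType stands for the real numbers, 'rV[R]_d for R^d and
   R[i] for C; [modc] is the modulus, with values in R. *)
Local Notation modc := Normc.normc.

Section tuple_product.
Context {disp : measure_display} {T : measurableType disp} {R : realType}.
Variable mu : {sigma_finite_measure set T -> \bar R}.

Definition cons_pair n (p : T * n.-tuple T) : n.+1.-tuple T := [tuple of p.1 :: p.2].

Lemma measurable_cons_pair n : measurable_fun [set: T * n.-tuple T] (@cons_pair n).
Proof. exact: measurable_cons. Qed.

Section step.
Variables (n : nat) (nu : {sigma_finite_measure set (n.-tuple T) -> \bar R}).

Definition tuple_step : set (n.+1.-tuple T) -> \bar R :=
  pushforward (mu \x nu)%E (@cons_pair n).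

Let mcp A : measurable A -> measurable (@cons_pair n @^-1` A).
Proof. by move=> mA; rewrite -[X in measurable X]setTI; exact: measurable_cons_pair. Qed.

Let step0 : tuple_step set0 = 0%E.
Proof. by rewrite /tuple_step /pushforward preimage_set0 measure0. Qed.

Let step_ge0 A : (0 <= tuple_step A)%E.
Proof. rewrite /tuple_step /pushforward; exact: measure_ge0. Qed.

Let step_sigma_additive : semi_sigma_additive tuple_step.
Proof.
move=> F mF tF mUF; rewrite /tuple_step /pushforward preimage_bigcup.
apply: measure_semi_sigma_additive.
- by move=> k; exact: mcp.
- apply/trivIsetP => /= i j _ _ ij; rewrite -preimage_setI.
  by move/trivIsetP : tF => /(_ _ _ _ _ ij) ->//; rewrite preimage_set0.
- by rewrite -preimage_bigcup; exact: mcp.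
Qed.

HB.instance Definition _ := isMeasure.Build _ _ _ tuple_step
  step0 step_ge0 step_sigma_additive.

Let step_sigma_finite : sigma_finite setT tuple_step.
Proof.
have /sigma_finiteP[F [TF ndF Foo]] := sigma_finiteT mu.
have /sigma_finiteP[G [TG ndG Goo]] := sigma_finiteT nu.
exists (fun k => (fun t : n.+1.-tuple T => tnth t ord0) @^-1` (F k) `&`
                 (fun t : n.+1.-tuple T => [tuple of behead t]) @^-1` (G k)).
  apply/esym/seteqP; split=> // t _.
  have [i _ Fi] : (\bigcup_i F i) (tnth t ord0) by rewrite -TF.
  have [j _ Gj] : (\bigcup_i G i) [tuple of behead t] by rewrite -TG.
  exists (maxn i j) => //; split => /=.
  - by move: Fi; exact/subsetPset/ndF/leq_maxl.
  - by move: Gj; exact/subsetPset/ndG/leq_maxr.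
move=> k; have [mF Fk] := Foo k; have [mG Gk] := Goo k; split.
  apply: measurableI.
    by rewrite -[X in measurable X]setTI; exact: measurable_tnth.
  by rewrite -[X in measurable X]setTI; exact: measurable_behead.
rewrite /tuple_step /pushforward.
rewrite [X in (_ \x _)%E X](_ : _ = F k `*` G k); last first.
  have bE x (t : n.-tuple T) : [tuple of behead (cons_pair (x, t))] = t.
    exact/val_inj.
  apply/seteqP; split=> -[x t] [/=].
    by rewrite (_ : tnth _ _ = x) // bE.
  by move=> Fx Gt; split; rewrite /= ?bE// (_ : tnth _ _ = x).
by rewrite product_measure1E// lte_mul_pinfty// ge0_fin_numE.
Qed.

HB.instance Definition _ := Measure_isSigmaFinite.Build _ _ _ tuple_step
  step_sigma_finite.
End step.

(* The n-fold product measure mu x ... x mu on n.-tuple T, built by pushing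
   mu \x (tuple_measure n) forward along (x, t) |-> x :: t. *)
Fixpoint tuple_measure n : {sigma_finite_measure set (n.-tuple T) -> \bar R} :=
  if n is n'.+1 then [the {sigma_finite_measure set _ -> \bar R} of tuple_step (tuple_measure n')]
  else [the {sigma_finite_measure set _ -> \bar R} of \d_([tuple] : 0.-tuple T)].

End tuple_product.

Section smooth.
Context {R : realType} {d : nat}.
Local Notation E := 'rV[R]_d.
Implicit Types (f g : E -> R) (s : seq 'I_d) (U : set E).

Definition partial (i : 'I_d) f : E -> R := fun x => 'D_(delta_mx 0 i) f x.

Definition partials s f : E -> R := foldl (fun g i => partial i g) f s.

Definition C1_at f x :=
  {for x, continuous f} /\ forall i : 'I_d, derivable f x (delta_mx 0 i).

Definition Ck_on n U f := forall s x, (size s <= n)%N -> U x -> C1_at (partials s f) x.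

(* C^infinity on U: every iterated partial derivative (along an arbitrary word of
   directions) is continuous at the points of U and can be differentiated again.
   Meaningful for open U; f is a total function whose values off U are irrelevant. *)
Definition smooth_on U f := forall s x, U x -> C1_at (partials s f) x.

Lemma smoothP U f : smooth_on U f <-> forall n, Ck_on n U f.
Proof. by split=> [H n s x _|H s x]; [exact: H|exact: (H (size s))]. Qed.

Lemma C1_near f g x : {near x, f =1 g} -> C1_at f x -> C1_at g x.
Proof.
move=> fg [cf df]; split; last by move=> i; exact: near_eq_derivable (df i).
rewrite /prop_for/continuous_at in cf *.
have -> : g x = f x by apply/esym; exact: (nbhs_singleton fg).
exact: cvg_trans (near_eq_cvg fg) cf.
Qed.

Lemma C1_cst (c : R) x : C1_at (fun=> c) x.
Proof. by split=> [|i]; [exact: cst_continuous|exact: derivable_cst]. Qed.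

Lemma C1_lin (a b : R) f g x : C1_at f x -> C1_at g x ->
  C1_at (fun y => a * f y + b * g y) x.
Proof.
move=> [cf df] [cg dg]; split=> [|i].
  apply: (@continuousD _ _ _ (fun y => a * f y) (fun y => b * g y)).
    by apply: continuousM => //; exact: cst_continuous.
  by apply: continuousM => //; exact: cst_continuous.
exact: (@derivableD _ _ _ (a \*: f) (b \*: g) _ _
         (derivableZ (df i)) (derivableZ (dg i))).
Qed.

Lemma partial_lin (a b : R) f g x i : C1_at f x -> C1_at g x ->
  partial i (fun y => a * f y + b * g y) x = a * partial i f x + b * partial i g x.
Proof.
move=> [_ df] [_ dg]; rewrite /partial.
rewrite (@deriveD _ _ _ (a \*: f) (b \*: g) _ _
         (derivableZ (df i)) (derivableZ (dg i))).
by rewrite deriveZ// deriveZ.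
Qed.

Lemma C1_mul f g x : C1_at f x -> C1_at g x -> C1_at (fun y => f y * g y) x.
Proof.
move=> [cf df] [cg dg]; split=> [|i]; first exact: continuousM.
exact: (derivableM (df i) (dg i)).
Qed.

Lemma partial_mul f g x i : C1_at f x -> C1_at g x ->
  partial i (fun y => f y * g y) x = f x * partial i g x + g x * partial i f x.
Proof. by move=> [_ df] [_ dg]; exact: (deriveM (df i) (dg i)). Qed.

Lemma C1_affine (a : R) (b : E) f x : C1_at f (a *: x + b) ->
  C1_at (fun y => f (a *: y + b)) x /\
  forall i, partial i (fun y => f (a *: y + b)) x = a * partial i f (a *: x + b).
Proof.
move=> [cf df].
have key i : is_derive x (delta_mx 0 i) (fun y => f (a *: y + b))
    (a * 'D_(delta_mx 0 i) f (a *: x + b)).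
  set v := delta_mx 0 i.
  pose phi h := f (h *: v + (a *: x + b)).
  have line0 (g : E -> R) y : derive (fun h : R => g (h *: v + y)) 0 1 = 'D_v g y.
    rewrite /derive; congr (lim _); apply: f_equal2 => //; apply/funext => h /=.
    by rewrite /shift/= !addr0 [h *: 1]mulr1 scale0r add0r.
  have dphi0 : derivable phi 0 1 := (derivable1P f (a *: x + b) v).1 (df i).
  have dphi : is_derive (a * 0 : R) 1 phi ('D_v f (a *: x + b)).
    rewrite [a * 0]mulr0; exact: (DeriveDef dphi0 (line0 f _)).
  have dmul : is_derive (0 : R) 1 (fun h : R => a * h) a.
    have dl : is_derive (0 : R) 1 (a \*: (id : R -> R)) (a *: (1 : R)).
      exact: is_deriveZ.
    by rewrite [a *: 1]mulr1 in dl.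
  have H := is_derive1_comp dphi dmul.
  have E1 : phi \o (fun h : R => a * h) =
      (fun h : R => f (a *: (h *: v + x) + b)).
    by apply/funext => h /=; rewrite /phi scalerDr scalerA addrA.
  rewrite E1 mulrC in H.
  have dd : derivable (fun y => f (a *: y + b)) x v by apply/derivable1P; case: H.
  apply: (DeriveDef dd); case: H => _ <-.
  exact/esym/(line0 (fun y => f (a *: y + b))).
split; last by move=> i; case: (key i).
split; last by move=> i; case: (key i).
have ca : {for x, continuous (fun y : E => a *: y + b)}.
  apply: (@continuousD _ _ _ (fun y : E => a *: y) (fun=> b)).
    by apply: continuousZ; [exact: cst_continuous|exact: cvg_id].
  exact: cst_continuous.
exact: (@continuous_comp _ _ _ (fun y : E => a *: y + b) f x ca cf).
Qed.

Lemma CkS n U f : Ck_on n.+1 U f <->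
  (forall x, U x -> C1_at f x) /\ forall i, Ck_on n U (partial i f).
Proof.
split=> [H|[H1 H2] [|i s] x sn Ux]; last 2 first.
- exact: H1.
- exact: (H2 i s).
by split=> [x|i s x sn]; [exact: (H [::])|exact: (H (i :: s))].
Qed.

Lemma Ck0 U f : Ck_on 0 U f <-> forall x, U x -> C1_at f x.
Proof. by split=> [H x|H [|//] x _]; [exact: (H [::])|exact: H]. Qed.

Lemma CkW n U f : Ck_on n.+1 U f -> Ck_on n U f.
Proof. by move=> H s x sn; apply: H; exact: leq_trans sn _. Qed.

Lemma near_open U f g x : open U -> (forall y, U y -> f y = g y) -> U x ->
  {near x, f =1 g}.
Proof.
move=> oU fg Ux; near=> y; apply: fg; near: y.
exact: open_nbhs_nbhs.
Unshelve. all: by end_near. Qed.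

Lemma partial_ext U f g i : open U -> (forall y, U y -> f y = g y) ->
  forall y, U y -> partial i f y = partial i g y.
Proof. by move=> oU fg y Uy; apply: near_eq_derive; exact: (near_open oU fg Uy). Qed.

Lemma partials_ext U s f g : open U -> (forall y, U y -> f y = g y) ->
  forall y, U y -> partials s f y = partials s g y.
Proof.
move=> oU; elim: s f g => [|i s IH] f g fg y Uy /=; first exact: fg.
exact: (IH _ _ (fun z Uz => partial_ext i oU fg Uz) y Uy).
Qed.

Lemma Ck_ext n U f g : open U -> (forall y, U y -> f y = g y) ->
  Ck_on n U f -> Ck_on n U g.
Proof.
move=> oU fg H s x sn Ux; apply: C1_near (H s x sn Ux).
by apply: (near_open oU _ Ux) => y Uy; exact: (partials_ext s oU fg Uy).
Qed.

Lemma Ck_cst n U (c : R) : Ck_on n U (fun=> c).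
Proof.
elim: n c => [|n IH] c; first by apply/Ck0 => x _; exact: C1_cst.
apply/CkS; split=> [x _|i]; first exact: C1_cst.
rewrite (_ : partial i _ = fun=> 0) //.
by apply/funext => x; rewrite /partial (@derive_cst R _ _ c).
Qed.

Lemma partials_lin U (a b : R) s f g : open U ->
  Ck_on (size s) U f -> Ck_on (size s) U g -> forall x, U x ->
  C1_at (partials s (fun y => a * f y + b * g y)) x /\
  partials s (fun y => a * f y + b * g y) x = a * partials s f x + b * partials s g x.
Proof.
move=> oU; elim: s f g => [|i s IH] f g /= kf kg x Ux.
  by split=> //; apply: C1_lin; [exact: (Ck0 _ _).1 kf _ _|exact: (Ck0 _ _).1 kg _ _].
have [f1 fS] := (CkS _ _ _).1 kf; have [g1 gS] := (CkS _ _ _).1 kg.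
have [H1 H2] := IH _ _ (fS i) (gS i) x Ux.
have e y : U y -> a * partial i f y + b * partial i g y =
    partial i (fun y => a * f y + b * g y) y.
  by move=> Uy; rewrite partial_lin//; [exact: f1|exact: g1].
split; last by rewrite -(partials_ext s oU e Ux).
apply: C1_near H1; apply: (near_open oU _ Ux) => y Uy.
exact: (partials_ext s oU e Uy).
Qed.

Lemma Ck_le m n U f : (m <= n)%N -> Ck_on n U f -> Ck_on m U f.
Proof. by move=> mn H s x sm; apply: H; exact: leq_trans mn. Qed.

Lemma Ck_lin n U (a b : R) f g : open U -> Ck_on n U f -> Ck_on n U g ->
  Ck_on n U (fun y => a * f y + b * g y).
Proof.
move=> oU kf kg s x sn Ux.
have [] // := @partials_lin U a b s f g oU (Ck_le sn kf) (Ck_le sn kg) x Ux.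
Qed.

Lemma Ck_mul n U f g : open U -> Ck_on n U f -> Ck_on n U g ->
  Ck_on n U (fun y => f y * g y).
Proof.
move=> oU; elim: n f g => [|n IH] f g kf kg.
  by apply/Ck0 => x Ux; apply: C1_mul; [exact: (Ck0 _ _).1 kf _ _|exact: (Ck0 _ _).1 kg _ _].
have [f1 fS] := (CkS _ _ _).1 kf; have [g1 gS] := (CkS _ _ _).1 kg.
apply/CkS; split=> [x Ux|i]; first by apply: C1_mul; [exact: f1|exact: g1].
apply: (@Ck_ext _ _ (fun y => 1 * (f y * partial i g y) + 1 * (g y * partial i f y))) => //.
  by move=> y Uy; rewrite !mul1r partial_mul//; [exact: f1|exact: g1].
by apply: Ck_lin => //; apply: IH => //; exact: CkW.
Qed.

Lemma Ck_affine n (a : R) (b : E) f : Ck_on n setT f ->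
  Ck_on n setT (fun y => f (a *: y + b)).
Proof.
elim: n f => [|n IH] f kf.
  by apply/Ck0 => x _; apply: (C1_affine _).1; exact: (Ck0 _ _).1 kf _ _.
have [f1 fS] := (CkS _ _ _).1 kf.
apply/CkS; split=> [x _|i]; first by apply: (C1_affine _).1; exact: f1.
apply: (@Ck_ext _ _ (fun y => a * partial i f (a *: y + b) + 0 * (fun=> 0) y)).
- exact: openT.
- by move=> y _; rewrite mul0r addr0; apply/esym/(C1_affine _).2; exact: f1.
- by apply: Ck_lin; [exact: openT|exact: IH|exact: Ck_cst].
Qed.

Lemma partials_affine (a : R) (b : E) s f : Ck_on (size s) setT f -> forall x,
  partials s (fun y => f (a *: y + b)) x = a ^+ size s * partials s f (a *: x + b).
Proof.
elim: s f => [|i s IH] f /= kf x; first by rewrite expr0 mul1r.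
have [f1 fS] := (CkS _ _ _).1 kf.
have -> : partial i (fun y => f (a *: y + b)) =
    (fun y => a * partial i f (a *: y + b) + 0 * (fun=> 0) y).
  by apply/funext => y; rewrite mul0r addr0; apply: (C1_affine _).2; exact: f1.
have kc := Ck_affine a b (fS i).
have [_ ->] := @partials_lin setT a 0 s _ _ openT kc (@Ck_cst _ setT 0) x I.
by rewrite mul0r addr0 (IH _ (fS i)) mulrA -exprS.
Qed.
End smooth.

Section complexlemmas.
Context {R : realType}.
Implicit Types z w : R[i].
Lemma modcE z : (modc z)%:C = `|z|.
Proof. by case: z => a b; rewrite normc_def. Qed.
Lemma modc_ge0 z : 0 <= modc z.
Proof. by case: z => a b /=; exact: sqrtr_ge0. Qed.
Lemma modcD z w : modc (z + w) <= modc z + modc w.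
Proof. by rewrite -lecR rmorphD /= !modcE ler_normD. Qed.
Lemma modcN z : modc (- z) = modc z.
Proof. by case: z => a b /=; rewrite !sqrrN. Qed.
Lemma modcB z w : modc (z - w) <= modc z + modc w.
Proof. by rewrite (le_trans (modcD _ _))// modcN. Qed.
Lemma modcR (r : R) : modc r%:C = `|r|.
Proof. by rewrite /= expr0n addr0 sqrtr_sqr. Qed.
Lemma Re_le_modc z : `|complex.Re z| <= modc z.
Proof. by case: z => a b /=; rewrite -sqrtr_sqr ler_wsqrtr// lerDl sqr_ge0. Qed.
Lemma Im_le_modc z : `|complex.Im z| <= modc z.
Proof. by case: z => a b /=; rewrite -[X in X <= _]sqrtr_sqr ler_wsqrtr// lerDr sqr_ge0. Qed.
Lemma modc_le z : modc z <= `|complex.Re z| + `|complex.Im z|.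
Proof.
case: z => a b /=; rewrite -[leRHS]ger0_norm ?addr_ge0// -sqrtr_sqr ler_wsqrtr//.
rewrite sqrrD !real_normK ?num_real// -addrA lerD2l lerDr.
by rewrite mulrn_wge0// mulr_ge0.
Qed.
Lemma ReBc z w : complex.Re (z - w) = 1 * complex.Re z + (-1) * complex.Re w.
Proof. by case: z w => [a b] [c e] /=; rewrite mul1r mulN1r. Qed.
Lemma ImBc z w : complex.Im (z - w) = 1 * complex.Im z + (-1) * complex.Im w.
Proof. by case: z w => [a b] [c e] /=; rewrite mul1r mulN1r. Qed.
Lemma ReMc z w : complex.Re (z * w) =
  complex.Re z * complex.Re w + (- complex.Im z) * complex.Im w.
Proof. by case: z w => [a b] [c e] /=; rewrite mulNr. Qed.
Lemma ImMc z w : complex.Im (z * w) =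
  complex.Re z * complex.Im w + complex.Im z * complex.Re w.
Proof. by case: z w => [a b] [c e] /=. Qed.
End complexlemmas.

Section csmooth.
Context {R : realType} {d : nat}.
Local Notation E := 'rV[R]_d.
Implicit Types (u v : E -> R[i]) (s : seq 'I_d) (U : set E).

(* A complex-valued function is differentiated componentwise. *)
Definition csmooth_on U u :=
  smooth_on U (fun x => complex.Re (u x)) /\ smooth_on U (fun x => complex.Im (u x)).

Definition cpartials s u : E -> R[i] := fun x =>
  partials s (fun y => complex.Re (u y)) x +i* partials s (fun y => complex.Im (u y)) x.

Lemma smooth_lin U (a b : R) (f g : E -> R) : open U -> smooth_on U f ->
  smooth_on U g -> smooth_on U (fun x => a * f x + b * g x).
Proof.
move=> oU /smoothP sf /smoothP sg; apply/smoothP => n.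
exact: (Ck_lin a b oU (sf n) (sg n)).
Qed.
Lemma smooth_mul U (f g : E -> R) : open U -> smooth_on U f ->
  smooth_on U g -> smooth_on U (fun x => f x * g x).
Proof.
move=> oU /smoothP sf /smoothP sg; apply/smoothP => n.
exact: (Ck_mul oU (sf n) (sg n)).
Qed.

Lemma smooth_cst U (c : R) : smooth_on U (fun _ : E => c).
Proof. by apply/smoothP => n; exact: Ck_cst. Qed.

Lemma smooth_affine (f : E -> R) a b : smooth_on setT f ->
  smooth_on setT (fun x => f (a *: x + b)).
Proof. by move=> /smoothP sf; apply/smoothP => n; exact: Ck_affine. Qed.

Lemma sub_smooth U V (f : E -> R) : V `<=` U -> smooth_on U f -> smooth_on V f.
Proof. by move=> VU sf s x Vx; apply: sf; exact: VU. Qed.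

Lemma sub_csmooth U V u : V `<=` U -> csmooth_on U u -> csmooth_on V u.
Proof. by move=> VU [? ?]; split; exact: sub_smooth VU _. Qed.

Lemma csmooth_cst U (c : R[i]) : csmooth_on U (fun=> c).
Proof. by split; exact: smooth_cst. Qed.

Lemma csmoothM U u v : open U -> csmooth_on U u -> csmooth_on U v ->
  csmooth_on U (fun x => u x * v x).
Proof.
move=> oU [ur ui] [vr vi]; split.
  under [X in smooth_on _ X]eq_fun do rewrite ReMc mulNr -mulN1r -[X in X + _]mul1r.
  by apply: smooth_lin => //; exact: smooth_mul.
under [X in smooth_on _ X]eq_fun do
  rewrite ImMc -[X in X + _]mul1r -[X in _ + X]mul1r.
by apply: smooth_lin => //; exact: smooth_mul.
Qed.

Lemma csmoothB U u v : open U -> csmooth_on U u -> csmooth_on U v ->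
  csmooth_on U (fun x => u x - v x).
Proof.
move=> oU [ur ui] [vr vi]; split.
  by under [X in smooth_on _ X]eq_fun do rewrite ReBc; exact: smooth_lin.
by under [X in smooth_on _ X]eq_fun do rewrite ImBc; exact: smooth_lin.
Qed.

Lemma cpartialsB U s u v : open U -> csmooth_on U u -> csmooth_on U v ->
  forall x, U x -> cpartials s (fun x => u x - v x) x = cpartials s u x - cpartials s v x.
Proof.
move=> oU [/smoothP ur /smoothP ui] [/smoothP vr /smoothP vi] x Ux.
rewrite /cpartials.
under [X in partials _ X]eq_fun do rewrite ReBc.
under [X in _ +i* partials _ X _]eq_fun do rewrite ImBc.
have [_ ->] := partials_lin 1 (-1) oU (ur (size s)) (vr (size s)) Ux.
have [_ ->] := partials_lin 1 (-1) oU (ui (size s)) (vi (size s)) Ux.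
by rewrite !mul1r !mulN1r.
Qed.

Lemma cpartialsZ U s (c : R[i]) u : open U -> csmooth_on U u ->
  forall x, U x -> cpartials s (fun x => c * u x) x = c * cpartials s u x.
Proof.
move=> oU [/smoothP ur /smoothP ui] x Ux.
rewrite /cpartials.
under [X in partials _ X]eq_fun do rewrite ReMc.
under [X in _ +i* partials _ X _]eq_fun do rewrite ImMc.
have [_ ->] := partials_lin (complex.Re c) (- complex.Im c) oU (ur (size s)) (ui (size s)) Ux.
have [_ ->] := partials_lin (complex.Re c) (complex.Im c) oU (ui (size s)) (ur (size s)) Ux.
by case: c => a b /=; rewrite mulNr.
Qed.

Lemma csmooth_affine u a b : csmooth_on setT u ->
  csmooth_on setT (fun x => u (a *: x + b)).
Proof.
by move=> [/(smooth_affine a b) ur /(smooth_affine a b) ui]; split.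
Qed.

Lemma cpartials_affine s u a b x : csmooth_on setT u ->
  cpartials s (fun x => u (a *: x + b)) x = (a ^+ size s)%:C * cpartials s u (a *: x + b).
Proof.
move=> [/smoothP ur /smoothP ui]; rewrite /cpartials.
rewrite (partials_affine a b (ur (size s)) x) (partials_affine a b (ui (size s)) x).
by rewrite /GRing.mul/= !mul0r subr0 addr0.
Qed.

Lemma csmooth_continuous u : csmooth_on setT u ->
  continuous (fun x => complex.Re (u x)) /\ continuous (fun x => complex.Im (u x)).
Proof.
by move=> [ur ui]; split=> x; [have [] := ur [::] x I|have [] := ui [::] x I].
Qed.

Lemma csmooth_bounded u K : compact K -> csmooth_on setT u ->
  exists2 M : R, 0 <= M & forall x, K x -> modc (u x) <= M.
Proof.
move=> cK /csmooth_continuous[cr ci].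
have aux (f : E -> R) : continuous f -> exists M : R, forall x, K x -> `|f x| <= M.
  move=> cf; have cfK : compact (f @` K).
    by apply: continuous_compact => //; exact: continuous_subspaceT.
  have [M [_ HM]] := compact_bounded cfK.
  exists (M + 1) => x Kx; apply: (HM (M + 1)); first by rewrite ltrDl.
  by exists x.
have [M1 H1] := aux _ cr; have [M2 H2] := aux _ ci.
exists (`|M1| + `|M2|); first exact: addr_ge0.
move=> x Kx; rewrite (le_trans (modc_le _))// lerD//.
  by rewrite (le_trans (H1 _ Kx))// ler_norm.
by rewrite (le_trans (H2 _ Kx))// ler_norm.
Qed.
End csmooth.

Section nets.
Context {R : realType} {d : nat}.
Local Notation E := 'rV[R]_d.

Definition mindex := {ffun 'I_d -> nat}.
Implicit Types (beta : mindex).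

(* d^beta is the iterated partial derivative along the word 0^(beta 0) 1^(beta 1) ... *)
Definition mi_word beta : seq 'I_d := flatten [seq nseq (beta i) i | i <- enum 'I_d].

Definition mderiv beta (u : E -> R[i]) : E -> R[i] := cpartials (mi_word beta) u.

Record openset := OpenSet { oset :> set E ; oset_open : open oset }.
Arguments oset_open : clear implicits.

Definition Rd : openset := OpenSet openT.

(* A net (u_eps)_(0 < eps <= 1) of functions on U is represented by a total function
   of eps and x: nothing is required of it for eps outside ]0, 1] or x outside U, and
   the quotient below identifies nets that agree on ]0, 1] x U. *)
Definition net := R -> E -> R[i].

Definition smooth_net (U : set E) (u : net) :=
  forall e : R, 0 < e <= 1 -> csmooth_on U (u e).

(* sup_(x in K) |u_eps(x)| = O(g(eps)) as eps -> 0. *)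
Definition sup_bigO (K : set E) (u : net) (g : R -> R) :=
  exists M : R, \forall e \near 0^'+, forall x, K x -> modc (u e x) <= M * g e.

Definition moderate (U : set E) (u : net) := smooth_net U u /\
  forall K, compact K -> K `<=` U -> forall beta, exists N : nat,
    sup_bigO K (fun e => mderiv beta (u e)) (fun e => e ^- N).

Definition negligible_net (U : set E) (u : net) := smooth_net U u /\
  forall K, compact K -> K `<=` U -> forall beta, forall m : nat,
    sup_bigO K (fun e => mderiv beta (u e)) (fun e => e ^+ m).

Lemma near01 : \forall e \near (0 : R)^'+, 0 < e <= 1.
Proof.
near=> e; apply/andP; split; first by near: e; exact: nbhs_right_gt.
by near: e; exact: nbhs_right_le.
Unshelve. all: by end_near. Qed.

Lemma csmooth0 (U : set E) : csmooth_on U (0 : E -> R[i]).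
Proof. exact: csmooth_cst. Qed.

Lemma mderiv0 beta : mderiv beta (0 : E -> R[i]) = 0.
Proof.
apply/funext => x; rewrite /mderiv.
have := cpartialsB (mi_word beta) (@openT E) (csmooth0 _) (csmooth0 _) (I : setT x).
rewrite subrr => H; rewrite -[RHS]H; congr (cpartials _ _ _).
by apply/funext => y; rewrite subrr.
Qed.

Lemma sup_bigO_sub K u v g (r s : R -> R) : sup_bigO K u r -> sup_bigO K v s ->
  (\forall e \near 0^'+, 0 <= r e <= g e) -> (\forall e \near 0^'+, 0 <= s e <= g e) ->
  sup_bigO K (fun e x => u e x - v e x) g.
Proof.
move=> [M HM] [N HN] Hr Hs; exists (`|M| + `|N|); near=> e => x Kx.
have /andP[r0 rg] : 0 <= r e <= g e by near: e.
have /andP[s0 sg] : 0 <= s e <= g e by near: e.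
rewrite (le_trans (modcB _ _))// mulrDl lerD//.
  have -> // : modc (u e x) <= `|M| * g e.
  apply: le_trans (_ : M * r e <= _).
    by move: x Kx; near: e.
  by rewrite (le_trans (ler_wpM2r r0 (ler_norm M)))// ler_wpM2l.
have -> // : modc (v e x) <= `|N| * g e.
apply: le_trans (_ : N * s e <= _).
  by move: x Kx; near: e.
by rewrite (le_trans (ler_wpM2r s0 (ler_norm N)))// ler_wpM2l.
Unshelve. all: by end_near. Qed.

Lemma ler_expN (e : R) m n : 0 < e <= 1 -> (m <= n)%N -> e ^- m <= e ^- n.
Proof.
move=> /andP[e0 e1] mn; rewrite lef_pV2 ?posrE ?exprn_gt0//.
by rewrite ler_wiXn2l// ltW.
Qed.

Lemma sup_bigO_ext K u v g :
  (\forall e \near 0^'+, forall x, K x -> u e x = v e x) ->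
  sup_bigO K u g -> sup_bigO K v g.
Proof.
move=> uv [M HM]; exists M; near=> e => x Kx.
have <- : u e x = v e x by move: x Kx; near: e.
by move: x Kx; near: e.
Unshelve. all: by end_near. Qed.

Lemma mderivB_near (U : openset) K beta (u v : net) : K `<=` U -> smooth_net U u ->
  smooth_net U v -> \forall e \near 0^'+, forall x, K x ->
  mderiv beta (u e) x - mderiv beta (v e) x = mderiv beta ((u - v) e) x.
Proof.
move=> KU su sv; near=> e => x Kx.
have e01 : 0 < e <= 1 by near: e; exact: near01.
by rewrite /mderiv (cpartialsB _ (oset_open U) (su e e01) (sv e e01) (KU _ Kx)).
Unshelve. all: by end_near. Qed.

Lemma smooth_netB (U : openset) (u v : net) : smooth_net U u -> smooth_net U v ->
  smooth_net U (u - v).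
Proof. by move=> su sv e e01; exact: (csmoothB (oset_open U) (su e e01) (sv e e01)). Qed.

Lemma moderateB (U : openset) u v : moderate U u -> moderate U v -> moderate U (u - v).
Proof.
move=> [su mu] [sv mv]; split; first exact: smooth_netB.
move=> K cK KU beta.
have [N1 H1] := mu K cK KU beta; have [N2 H2] := mv K cK KU beta.
exists (N1 + N2)%N; apply: (sup_bigO_ext (mderivB_near beta KU su sv)).
apply: (sup_bigO_sub H1 H2); apply: filterS near01 => e e01.
  rewrite (ler_expN e01 (leq_addr _ _)) andbT invr_ge0 exprn_ge0//.
  by case/andP: e01 => /ltW.
rewrite (ler_expN e01 (leq_addl _ _)) andbT invr_ge0 exprn_ge0//.
by case/andP: e01 => /ltW.
Qed.

Lemma negligibleB (U : openset) u v : negligible_net U u -> negligible_net U v -> negligible_net U (u - v).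
Proof.
move=> [su mu] [sv mv]; split; first exact: smooth_netB.
move=> K cK KU beta m.
apply: (sup_bigO_ext (mderivB_near beta KU su sv)).
apply: (sup_bigO_sub (mu K cK KU beta m) (mv K cK KU beta m));
  by apply: filterS near01 => e /andP[e0 _]; rewrite lexx andbT exprn_ge0// ltW.
Qed.

Lemma negligible0 (U : openset) : negligible_net U 0.
Proof.
split=> [e _|K cK KU beta m]; first exact: csmooth0.
exists 0; apply: nearW => e x _.
have -> : mderiv beta ((0 : net) e) x = 0 by rewrite (_ : (0 : net) e = 0)// mderiv0.
by rewrite Normc.normc0 mul0r.
Qed.

Lemma moderate0 (U : openset) : moderate U 0.
Proof.
have [s H] := negligible0 U; split=> // K cK KU beta.
by exists 0%N; have [M HM] := H K cK KU beta 0%N; exists M;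
  apply: filterS HM => e He x Kx; rewrite (le_trans (He x Kx))// !expr0 invr1.
Qed.

Definition moderate_pred (U : openset) : {pred net} := fun u => `[< moderate U u >].

Lemma moderate_zmod_closed U : zmod_closed (moderate_pred U).
Proof.
split; first exact/asboolP/moderate0.
by move=> u v /asboolP mu /asboolP mv; apply/asboolP/moderateB.
Qed.

HB.instance Definition _ U := GRing.isZmodClosed.Build net (moderate_pred U) (moderate_zmod_closed U).

Record moderate_net (U : openset) := ModerateNet { net_of :> net ; net_ofP : net_of \in moderate_pred U }.

HB.instance Definition _ U := [isSub for @net_of U].
HB.instance Definition _ U := [Choice of moderate_net U by <:].
HB.instance Definition _ U := [SubChoice_isSubZmodule of moderate_net U by <:].

Definition to_moderate (U : openset) u (mu : moderate U u) : moderate_net U := ModerateNet (asboolT mu).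

Lemma moderate_netP U (u : moderate_net U) : moderate U u.
Proof. exact/asboolP/net_ofP. Qed.

Definition negligible_pred (U : openset) : {pred moderate_net U} := fun u => `[< negligible_net U u >].

Lemma negligible_zmod_closed U : zmod_closed (@negligible_pred U).
Proof.
split; first exact/asboolP/negligible0.
by move=> u v /asboolP mu /asboolP mv; apply/asboolP/negligibleB.
Qed.

HB.instance Definition _ U :=
  GRing.isZmodClosed.Build (moderate_net U) (@negligible_pred U) (negligible_zmod_closed U).

(* G(U) = E_M(U) / N(U). *)
Definition colombeau (U : openset) := Quotient.quot (@negligible_pred U).

Definition colombeau_class U (u : moderate_net U) : colombeau U := \pi_(colombeau U)%qT u.

Lemma colombeau_eqP U (u v : moderate_net U) :
  colombeau_class u = colombeau_class v <-> negligible_net U (net_of u - net_of v).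
Proof.
have E2 : negligible_net U (net_of u - net_of v) <-> u - v \in @negligible_pred U.
  by split=> [H|/asboolP//]; apply/asboolP.
rewrite E2 Quotient.idealrBE; split=> [/eqP//|/eqP//].
Qed.
End nets.
Arguments mindex : clear implicits.
Arguments openset : clear implicits.
Arguments Rd : clear implicits.
Arguments oset_open {R d} _.

Section gnumbers.
Context {R : realType}.

Definition gnum_moderate (c : R -> R[i]) :=
  exists (N : nat) (M : R), \forall e \near 0^'+, modc (c e) <= M * e ^- N.

Definition gnum_negligible (c : R -> R[i]) :=
  forall p : nat, exists M : R, \forall e \near 0^'+, modc (c e) <= M * e ^+ p.

Definition gnum_moderate_pred : {pred R -> R[i]} := fun c => `[< gnum_moderate c >].

Lemma gnum_moderate_zmod_closed : zmod_closed gnum_moderate_pred.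
Proof.
split; first apply/asboolP.
  by exists 0%N, 0; apply: nearW => e; rewrite Normc.normc0 mul0r.
move=> a b /asboolP[N1 [M1 H1]] /asboolP[N2 [M2 H2]]; apply/asboolP.
exists (N1 + N2)%N, (`|M1| + `|M2|); near=> e.
have e01 : 0 < e <= 1 by near: e; exact: near01.
have e0 : 0 <= e by case/andP: e01 => /ltW.
rewrite (le_trans (modcB _ _))// mulrDl lerD//.
  apply: le_trans (_ : M1 * e ^- N1 <= _); first by near: e.
  apply: le_trans (ler_wpM2r _ (ler_norm M1)) _.
    by rewrite invr_ge0 exprn_ge0.
  by rewrite ler_wpM2l// ler_expN// leq_addr.
apply: le_trans (_ : M2 * e ^- N2 <= _); first by near: e.
apply: le_trans (ler_wpM2r _ (ler_norm M2)) _.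
  by rewrite invr_ge0 exprn_ge0.
by rewrite ler_wpM2l// ler_expN// leq_addl.
Unshelve. all: by end_near. Qed.

HB.instance Definition _ :=
  GRing.isZmodClosed.Build (R -> R[i]) gnum_moderate_pred gnum_moderate_zmod_closed.

Record gnum_net := GnumNet { gnum_val :> R -> R[i] ; gnum_in : gnum_val \in gnum_moderate_pred }.
HB.instance Definition _ := [isSub for gnum_val].
HB.instance Definition _ := [Choice of gnum_net by <:].
HB.instance Definition _ := [SubChoice_isSubZmodule of gnum_net by <:].

Definition gnum_negligible_pred : {pred gnum_net} := fun c => `[< gnum_negligible c >].

Lemma gnum_negligible_zmod_closed : zmod_closed gnum_negligible_pred.
Proof.
split; first apply/asboolP => p.
  by exists 0; apply: nearW => e; rewrite Normc.normc0 mul0r.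
move=> a b /asboolP Ha /asboolP Hb; apply/asboolP => p.
have [M1 H1] := Ha p; have [M2 H2] := Hb p; exists (M1 + M2); near=> e.
rewrite (le_trans (modcB _ _))// mulrDl lerD//; by near: e.
Unshelve. all: by end_near. Qed.

HB.instance Definition _ :=
  GRing.isZmodClosed.Build gnum_net gnum_negligible_pred gnum_negligible_zmod_closed.

(* The generalized numbers (C-tilde). *)
Definition gnum := Quotient.quot gnum_negligible_pred.

Definition gnum_class (c : R -> R[i]) (mc : gnum_moderate c) : gnum :=
  \pi_gnum%qT (GnumNet (asboolT mc)).
End gnumbers.
Arguments gnum : clear implicits.

Section ops.
Context {R : realType} {d : nat}.
Local Notation E := 'rV[R]_d.
Local Notation net := (@net R d).
Local Notation openset := (openset R d).
Local Notation Rd := (Rd R d).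

Lemma dilate_moderate (l : R) (u : net) : moderate setT u ->
  moderate setT (fun e x => u e (l *: x)).
Proof.
move=> [su mu]; have E1 e : (fun x => u e (l *: x)) = (fun x => u e (l *: x + 0)).
  by apply/funext => x; rewrite addr0.
split=> [e e01|K cK _ beta].
  by rewrite E1; exact: (csmooth_affine l 0 (su e e01)).
have cK' : compact ((fun x : E => l *: x) @` K).
  apply: continuous_compact => //; apply: continuous_subspaceT => x.
  by apply: continuousZ; [exact: cst_continuous|exact: cvg_id].
have [N [M HM]] := mu _ cK' (@subsetT _ _) beta.
exists N, (`|l ^+ size (mi_word beta)| * M); near=> e => x Kx.
have e01 : 0 < e <= 1 by near: e; exact: near01.
rewrite E1 /mderiv (cpartials_affine _ _ _ _ (su e e01)) Normc.normcM modcR.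
rewrite -mulrA ler_wpM2l// addr0.
have : forall y, ((fun x : E => l *: x) @` K) y -> modc (mderiv beta (u e) y) <= M * e ^- N.
  by near: e.
by apply; exists x.
Unshelve. all: by end_near. Qed.

Lemma scale_moderate (U : openset) (c : R[i]) (u : net) : moderate U u ->
  moderate U (fun e x => c * u e x).
Proof.
move=> [su mu]; split=> [e e01|K cK KU beta].
  by apply: csmoothM; [exact: oset_open|exact: csmooth_cst|exact: su].
have [N [M HM]] := mu _ cK KU beta.
exists N, (modc c * M); near=> e => x Kx.
have e01 : 0 < e <= 1 by near: e; exact: near01.
rewrite /mderiv (cpartialsZ _ _ (oset_open U) (su e e01) (KU _ Kx)) Normc.normcM.
rewrite -mulrA ler_wpM2l ?modc_ge0//; move: x Kx; near: e; exact: HM.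
Unshelve. all: by end_near. Qed.

Lemma restrict_moderate (U V : set E) (u : net) : V `<=` U -> moderate U u -> moderate V u.
Proof.
move=> VU [su mu]; split=> [e e01|K cK KV beta]; first exact: (sub_csmooth VU (su e e01)).
by apply: mu => //; exact: subset_trans VU.
Qed.

(* u(l x), c u(x) and the restriction of u to V, componentwise on representatives. *)
Definition gdilate (l : R) (u : colombeau Rd) : colombeau Rd :=
  colombeau_class (to_moderate (U := Rd) (dilate_moderate l (moderate_netP (repr u)))).

Definition gscale (U : openset) (c : R[i]) (u : colombeau U) : colombeau U :=
  colombeau_class (to_moderate (scale_moderate c (moderate_netP (repr u)))).

Definition grestrict (V : openset) (u : colombeau Rd) : colombeau V :=
  colombeau_class (to_moderate (restrict_moderate (@subsetT _ V) (moderate_netP (repr u)))).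

Definition homogeneous (alpha : R) (u : colombeau Rd) :=
  forall l : R, 0 < l -> gdilate l u = gscale (l `^ alpha)%:C u.
End ops.

Section integral.
Context {R : realType}.

(* Lebesgue measure on R^d, carried by d-tuples of reals; [row_of] turns them into
   row vectors. *)
Definition lebesgueN d := tuple_measure (@lebesgue_measure R) d.

Definition row_of d (t : d.-tuple (measurableTypeR R)) : 'rV[R]_d := \row_i tnth t i.

Definition cintegral d (f : 'rV[R]_d -> R[i]) : R[i] :=
  (\int[lebesgueN d]_t complex.Re (f (row_of t))) +i*
  (\int[lebesgueN d]_t complex.Im (f (row_of t))).

Definition tuple_box d (r : R) : set (d.-tuple (measurableTypeR R)) :=
  [set t | forall i, `|tnth t i| <= r].

Lemma measurable_tuple_box d r : measurable (@tuple_box d r).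
Proof.
rewrite (_ : tuple_box r = \bigcap_(i in [set: 'I_d])
   ((fun t : d.-tuple (measurableTypeR R) => tnth t i) @^-1` `[-r, r]%classic)); last first.
  apply/seteqP; split=> t H i.
    by move=> _ /=; rewrite in_itv/= -ler_norml; exact: H.
  by have := H i I; rewrite /= in_itv/= -ler_norml.
apply: fin_bigcap_measurable; first exact: finite_finset.
move=> i _; rewrite -[X in measurable X]setTI; exact: measurable_tnth.
Qed.

Lemma lebesgueN_box d r : (lebesgueN d (@tuple_box d r) < +oo)%E.
Proof.
elim: d => [|d IH]; first by rewrite /= /dirac/= ltry.
rewrite /lebesgueN /= /tuple_step /pushforward.
rewrite [X in (_ \x _)%E X](_ : _ = `[-r, r]%classic `*` @tuple_box d r); last first.
  apply/seteqP; split=> -[x t] /=.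
    move=> H; split; first by have := H ord0; rewrite /= in_itv/= -ler_norml.
    by move=> i; have := H (lift ord0 i); rewrite tnthS.
  move=> [xr tb] i; have [->|] := eqVneq i ord0.
    by rewrite /= -[_ <= _]/(`|x| <= r) ler_norml; move: xr; rewrite /= in_itv.
  case: (unliftP ord0 i) => [j ->|->]; last by rewrite eqxx.
  by move=> _; rewrite tnthS; exact: tb.
rewrite product_measure1E; [|exact: measurable_itv|exact: measurable_tuple_box].
have Ffin : (@lebesgue_measure R ([set` `[- r, r]%R] : set R) < +oo)%E.
  by rewrite lebesgue_measure_itv/=; case: ifP => // _; rewrite -EFinD ltry.
by apply: lte_mul_pinfty => //; rewrite ge0_fin_numE.
Qed.

Lemma Rintegral_bound d (g : d.-tuple (measurableTypeR R) -> R) (A : set _) (B : R) :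
  measurable A -> (lebesgueN d A < +oo)%E -> 0 <= B ->
  (forall t, A t -> `|g t| <= B) -> (forall t, ~ A t -> g t = 0) ->
  `|\int[lebesgueN d]_t g t| <= B * fine (lebesgueN d A).
Proof.
move=> mA Afin B0 gA gN; set mu := lebesgueN d.
have key (h : d.-tuple (measurableTypeR R) -> \bar R) :
    (forall t, 0 <= h t)%E -> (forall t, h t <= (B * \1_A t)%:E)%E ->
    (0 <= \int[mu]_t h t <= (B * fine (mu A))%:E)%E.
  move=> h0 hB; rewrite integral_ge0//=.
  have -> : (B * fine (mu A))%:E = (\int[mu]_t (B * \1_A t)%:E)%E.
    under eq_integral do rewrite EFinM.
    rewrite ge0_integralZl//; last first.
      by apply/measurable_realfun.measurable_EFinP; exact: measurable_realfun.measurable_indic.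
    by rewrite integral_indic// setIT EFinM fineK// ge0_fin_numE.
  rewrite ge0_integralTE// ge0_integralTE; last first.
    by move=> t; rewrite lee_fin mulr_ge0.
  apply: ge_ereal_sup => _ [k /= kh <-]; apply: ereal_sup_ubound; exists k => //=.
  by move=> t; exact: le_trans (kh t) (hB t).
have gB t : `|g t| <= B * \1_A t.
  rewrite indicE; case: (boolP (t \in A)) => [/set_mem /gA|/negP H].
    by rewrite mulr1.
  by rewrite gN ?normr0 ?mulr0// => At; apply: H; exact: mem_set.
rewrite /Rintegral integralE.
have pos : (0 <= \int[mu]_t (EFin \o g)^\+ t <= (B * fine (mu A))%:E)%E.
  apply: key => t; first exact: funepos_ge0.
  by rewrite funeposE/= -EFin_max lee_fin ge_max (le_trans (ler_norm _) (gB t)) mulr_ge0.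
have neg : (0 <= \int[mu]_t (EFin \o g)^\- t <= (B * fine (mu A))%:E)%E.
  apply: key => t; first exact: funeneg_ge0.
  rewrite funenegE/= -EFin_max lee_fin ge_max mulr_ge0// andbT.
  by rewrite (le_trans _ (gB t))// -normrN ler_norm.
move: pos neg.
case: (\int[mu]_t (EFin \o g)^\+ t)%E => [p| |] /andP[]// p0 pB.
case: (\int[mu]_t (EFin \o g)^\- t)%E => [n| |] /andP[]// n0 nB.
rewrite /= ler_norml; rewrite !lee_fin in p0 pB n0 nB.
apply/andP; split; lra.
Qed.
End integral.

Section pairing.
Context {R : realType} {d : nat}.
Local Notation E := 'rV[R]_d.
Local Notation openset := (openset R d).
Local Notation Rd := (Rd R d).

Record test_function := TestFunction {
  test_fun :> E -> R[i] ;
  test_smooth : csmooth_on setT test_fun ;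
  test_supp : exists2 K : set E, compact K & forall x, ~ K x -> test_fun x = 0 }.

Lemma mderiv_order0 (u : E -> R[i]) : mderiv [ffun=> 0%N] u = u.
Proof.
apply/funext => x; rewrite /mderiv /mi_word.
have -> : flatten [seq nseq ([ffun=> 0%N] i) i | i <- enum 'I_d] = [::].
  by elim: (enum _) => //= i s ->; rewrite ffunE.
by rewrite /cpartials /=; case: (u x).
Qed.

Lemma cintegral_bound (K : set E) : compact K -> exists2 A : R, 0 <= A &
  forall (f : E -> R[i]) (B : R), 0 <= B -> (forall x, K x -> modc (f x) <= B) ->
  (forall x, ~ K x -> f x = 0) -> modc (cintegral f) <= A * B.
Proof.
move=> cK; have [M [_ HM]] := compact_bounded cK.
pose r := M + 1.
have Kr x : K x -> forall i, `|x ord0 i| <= r.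
  move=> Kx i; have : `|x| <= r by apply: HM Kx; rewrite ltrDl.
  have -> : `|x| = mx_norm x by [].
  apply: le_trans; rewrite mx_normrE.
  exact: (@le_bigmax _ _ _ 0 (fun ij : 'I_1 * 'I_d => `|x ij.1 ij.2|) (ord0, i)).
pose m := fine (lebesgueN d (@tuple_box R d r)).
have m0 : 0 <= m by rewrite fine_ge0.
exists (m + m); first exact: addr_ge0.
move=> f B B0 fK fN.
have boxK t : ~ @tuple_box R d r t -> ~ K (row_of t).
  by apply: contra_not => Kt i; have := Kr _ Kt i; rewrite mxE.
have fB x : modc (f x) <= B.
  by have [/fK//|/fN ->] := pselect (K x); rewrite Normc.normc0.
rewrite (le_trans (modc_le _))// mulrDl [m * B]mulrC lerD//.
  apply: Rintegral_bound => //; [exact: measurable_tuple_box|exact: lebesgueN_box| |].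
    by move=> t _; rewrite (le_trans (Re_le_modc _))// fB.
  by move=> t /boxK/fN ->.
apply: Rintegral_bound => //; [exact: measurable_tuple_box|exact: lebesgueN_box| |].
  by move=> t _; rewrite (le_trans (Im_le_modc _))// fB.
by move=> t /boxK/fN ->.
Qed.

Lemma pairing_moderate (u : net) (phi : test_function) : moderate setT u ->
  gnum_moderate (fun e => cintegral (fun x => u e x * phi x)).
Proof.
move=> [su mu]; have [K cK phiN] := test_supp phi.
have [A A0 HA] := cintegral_bound cK.
have [P P0 HP] := csmooth_bounded cK (test_smooth phi).
have [N [M HM]] := mu K cK (@subsetT _ _) [ffun=> 0%N].
exists N, (A * (`|M| * P)); near=> e.
have e01 : 0 < e <= 1 by near: e; exact: near01.
have eN : 0 <= e ^- N by rewrite invr_ge0 exprn_ge0//; case/andP: e01 => /ltW.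
rewrite -mulrA; apply: HA.
- by rewrite mulr_ge0// mulr_ge0.
- move=> x Kx; rewrite Normc.normcM mulrAC ler_pM ?modc_ge0//; last exact: HP.
  apply: le_trans (ler_wpM2r eN (ler_norm M)).
  rewrite -[X in modc (X x)]mderiv_order0.
  by move: x Kx; near: e; exact: HM.
- by move=> x /phiN ->; rewrite mulr0.
Unshelve. all: by end_near. Qed.

Definition gpairing (u : colombeau Rd) (phi : test_function) : gnum R :=
  gnum_class (pairing_moderate phi (moderate_netP (repr u))).

Definition weakly_homogeneous (alpha : R) (u : colombeau Rd) :=
  forall (l : R) (phi : test_function), 0 < l ->
  gpairing (gdilate l u) phi = gpairing (gscale (l `^ alpha)%:C u) phi.

Lemma test_mul_subproof (psi : test_function) (f : E -> R[i]) :
  exists2 K : set E, compact K & forall x, ~ K x -> psi x * f x = 0.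
Proof.
by have [K cK H] := test_supp psi; exists K => // x /H ->; rewrite mul0r.
Qed.

Definition test_mul (psi : test_function) (f : E -> R[i]) (sf : csmooth_on setT f) :=
  TestFunction (csmoothM openT (test_smooth psi) sf) (test_mul_subproof psi f).

Lemma rescale_smooth (f : E -> R[i]) (e : R) : csmooth_on setT f ->
  csmooth_on setT (fun x => (e ^- d)%:C * f (e^-1 *: x)).
Proof.
move=> sf; apply: csmoothM; [exact: openT|exact: csmooth_cst|].
have := csmooth_affine (e^-1) 0 sf.
by under [X in csmooth_on _ X]eq_fun do rewrite addr0.
Qed.

Lemma reflect_smooth (f : E -> R[i]) (x : E) : csmooth_on setT f ->
  csmooth_on setT (fun y => f (x - y)).
Proof.
move=> sf; have := csmooth_affine (-1) x sf.
by under [X in csmooth_on _ X]eq_fun do rewrite scaleN1r addrC.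
Qed.

Lemma test_dilate_subproof (l : R) (phi : test_function) : 0 < l ->
  exists2 K : set E, compact K & forall x, ~ K x -> (l ^- d)%:C * phi (l^-1 *: x) = 0.
Proof.
move=> l0; have [K cK H] := test_supp phi.
exists ((fun x : E => l *: x) @` K).
  apply: continuous_compact => //; apply: continuous_subspaceT => x.
  by apply: continuousZ; [exact: cst_continuous|exact: cvg_id].
move=> x Kx; rewrite H ?mulr0// => Kx'; apply: Kx; exists (l^-1 *: x) => //.
by rewrite scalerA divff ?scale1r// gt_eqF.
Qed.

(* The test function x |-> l^(-d) phi(x / l). *)
Definition test_dilate (l : R) (l0 : 0 < l) (phi : test_function) : test_function :=
  TestFunction (rescale_smooth l (test_smooth phi)) (test_dilate_subproof phi l0).

Definition mdeg (beta : mindex d) : nat := \sum_i beta i.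

(* D'(R^d): linear functionals on D(R^d) which, for each compact K, are bounded on
   the test functions supported in K by a finite-order seminorm
   max_(|beta| <= k) sup |d^beta phi|; M stands for an upper bound of the seminorm.
   Linearity is phrased for any chi pointwise equal to c phi + psi. *)
Record schwartz_distribution := SchwartzDistribution {
  distr_fun :> test_function -> R[i] ;
  distr_linear : forall (c : R[i]) (phi psi chi : test_function),
    (forall x, chi x = c * phi x + psi x) ->
    distr_fun chi = c * distr_fun phi + distr_fun psi ;
  distr_continuous : forall K : set E, compact K -> exists (k : nat) (C : R),
    forall phi : test_function, (forall x, ~ K x -> phi x = 0) ->
    forall M : R,
      (forall beta, (mdeg beta <= k)%N -> forall x, modc (mderiv beta phi x) <= M) ->
      modc (distr_fun phi) <= C * M }.

Definition distr_homogeneous (alpha : R) (w : schwartz_distribution) :=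
  forall (l : R) (l0 : 0 < l) (phi : test_function),
    w (test_dilate l0 phi) = (l `^ alpha)%:C * w phi.

(* Does not depend on the chosen representative. *)
Definition associated (u : colombeau Rd) (w : schwartz_distribution) :=
  forall phi : test_function,
    modc (cintegral (fun x => net_of (repr u) e x * phi x) - w phi) @[e --> 0^'+] --> (0 : R).

Definition monomial (beta : mindex d) (x : E) : R := \prod_i x ord0 i ^+ beta i.

Definition schwartz (f : E -> R[i]) := csmooth_on setT f /\
  forall beta gamma : mindex d, exists M : R,
    forall x, modc ((monomial gamma x)%:C * mderiv beta f x) <= M.

Record mollifier := Mollifier {
  moll_fun :> E -> R[i] ;
  moll_schwartz : schwartz moll_fun ;
  moll_int1 : cintegral moll_fun = 1 ;
  moll_moment : forall beta, (1 <= mdeg beta)%N ->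
    cintegral (fun x => (monomial beta x)%:C * moll_fun x) = 0 }.

(* ((psi w) * f)(x) = <psi w, f(x - .)> = <w, psi f(x - .)>. *)
Definition convolve (psi : test_function) (w : schwartz_distribution) (f : E -> R[i])
    (sf : csmooth_on setT f) (x : E) : R[i] :=
  w (test_mul psi (reflect_smooth x sf)).

(* The net ((psi w) * rho_eps)_eps with rho_eps(x) = eps^(-d) rho(x / eps). *)
Definition mollify (rho : mollifier) (psi : test_function) (w : schwartz_distribution) : net :=
  fun e => convolve psi w (rescale_smooth e (moll_schwartz rho).1).

(* u restricted to V is the class in G(V) of ((psi w) * rho_eps)_eps, for all V
   relatively compact open and psi equal to 1 near the closure of V; in particular
   that net is required to be moderate on V. *)
Definition is_embedding (rho : mollifier) (w : schwartz_distribution) (u : colombeau Rd) :=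
  forall V : openset, compact (closure V) ->
  forall psi : test_function, set_nbhs (closure V) [set x | psi x = 1] ->
  exists2 v : moderate_net V, net_of v = mollify rho psi w & grestrict V u = colombeau_class v.

(* iota(w) is defined by description. The default value 0 is homogeneous of every
   degree, so [~ homogeneous alpha (colombeau_iota rho w)] entails that iota(w) satisfies
   [is_embedding]. *)
Definition colombeau_iota (rho : mollifier) (w : schwartz_distribution) : colombeau Rd :=
  xget 0 [set u | is_embedding rho w u].

End pairing.
Arguments mollifier : clear implicits.
Arguments schwartz_distribution : clear implicits.

(* Main.v *)
Require Import Defs.
From mathcomp Require Import all_boot all_order all_algebra.
From mathcomp Require Import all_classical all_reals all_analysis.
From mathcomp Require Import measurable_realfun complex ring lra.

(* The class of cos(x_0 / eps) is weakly zero, hence weakly homogeneous of every degree, by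
   repeated integration by parts, but at the points eps y it is visibly not homogeneous.

   With b = 1 / eps, consider b x_0^m \int_0^b mu^s cos(mu x_0 + theta) dmu, where
   alpha = m - s - 1. Rescaling x_0 amounts to rescaling b, which only changes the high
   frequencies in the integral, so this net is weakly homogeneous of degree alpha; for a suitable
   theta, its pairing with some test function is unbounded, and no distribution is associated.

   In dimension d + 1, let w(phi) = \int_0^oo t^s (d_0^k phi)(t e_0) dt with s = alpha + d + k > 0.
   Suppose that iota(w) is homogeneous. Blowing it up at the scale eps around the origin, the
   profile y |-> \int_0^oo t^s (d_0^(k+n) Re rho)(y - t e_0) dt is homogeneous of degree alpha - n
   and locally bounded, so it vanishes for n > alpha. These profiles tend to 0 as y_0 -> -oo, so
   integrating k + n times in y_0 gives \int_0^oo t^s Re rho(y - t e_0) dt = 0 for all y.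
   Dividing by y_0^s and letting y_0 -> oo, the integrals of Re rho over all lines directed by
   e_0 vanish, which contradicts \int rho = 1. *)

Set Implicit Arguments. Unset Strict Implicit. Unset Printing Implicit Defensive.
Import Order.TTheory GRing.Theory Num.Theory.
Import numFieldNormedType.Exports.
Local Open Scope classical_set_scope.
Local Open Scope ring_scope.
Local Open Scope complex_scope.
Local Notation modc := Normc.normc.

(** * Integrals over segments *)

(** Two choices of exponent shape both constructions. For the element without associated
    distribution, m > alpha + 1 makes s positive, and s is then split as sigma + j with 0 < sigma <=
    1. One integration by parts in mu trades a factor x_0 for a unit of s and a phase pi/2, so theta
    = j pi/2 is the phase that arrives at exponent sigma and phase 0. Only there, because sigma <=
    1, is an explicit one-sided bound available; integrated against an even power of x_0 it prevents
    cancellation.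

    For iota(w), the k derivatives make the ray weight t^s continuous at 0 even for very negative
    alpha, so that every integral is one of a continuous function. Homogeneity of the profile is no
    contradiction by itself when alpha >= 0: the n further derivatives bring the degree below 0,
    where boundedness near 0 forces the value 0. Recovering the profile from its derivatives then
    needs a point where it is known, and it is small far on the side opposite to the ray. The
    half-line integrals are handled through their truncations at T, with rates in T that survive the
    integrations. *)

Lemma continuous_comp_pair (S T U V : topologicalType) (F : T -> U -> V) (g : S -> T) (h : S -> U) :
  continuous (fun p : T * U => F p.1 p.2) -> continuous g -> continuous h ->
  continuous (fun s => F (g s) (h s)).
Proof.
move=> cF cg ch s.
apply: (@continuous_comp _ _ _ (fun s => (g s, h s)) (fun p => F p.1 p.2)); last exact: cF.
rewrite /prop_for /continuous_at; apply: cvg_pair; [exact: cg|exact: ch].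
Qed.

Lemma continuousMf (R : realType) (T : topologicalType) (f g : T -> R) :
  continuous f -> continuous g -> continuous (fun x => f x * g x).
Proof. by move=> cf cg x; exact: (continuousM (cf x) (cg x)). Qed.

Lemma continuousDf (R : realType) (T : topologicalType) (f g : T -> R) :
  continuous f -> continuous g -> continuous (fun x => f x + g x).
Proof. by move=> cf cg x; exact: (continuousD (cf x) (cg x)). Qed.

Lemma continuousDv (R : realType) (V : normedModType R) (T : topologicalType) (f g : T -> V) :
  continuous f -> continuous g -> continuous (fun x => f x + g x).
Proof. by move=> cf cg x; exact: (continuousD (cf x) (cg x)). Qed.

Lemma continuousBv (R : realType) (V : normedModType R) (T : topologicalType) (f g : T -> V) :
  continuous f -> continuous g -> continuous (fun x => f x - g x).
Proof. by move=> cf cg x; exact: (continuousB (cf x) (cg x)). Qed.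

Lemma continuousZv (R : realType) (V : normedModType R) (T : topologicalType) (k : T -> R) (f : T -> V) :
  continuous k -> continuous f -> continuous (fun x => k x *: f x).
Proof. by move=> cf cg x; exact: (continuousZ (cf x) (cg x)). Qed.

Lemma continuous_compf (S T U : topologicalType) (f : T -> U) (g : S -> T) :
  continuous f -> continuous g -> continuous (fun x => f (g x)).
Proof. by move=> cf cg x; apply: continuous_comp; [exact: cg|exact: cf]. Qed.

Section segment_integral.
Context {R : realType}.
Implicit Types (f g : R -> R) (a b c : R).

(** The segment is empty when b < a: the value is then 0, not the opposite of the reversed integral,
    whence the order hypotheses in the lemmas below. *)
Definition iint a b f : R := \int[@lebesgue_measure R]_(t in `[a, b]) f t.

Lemma continuous_integrable a b f : continuous f ->
  (@lebesgue_measure R).-integrable `[a, b] (EFin \o f).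
Proof.
move=> cf; apply: continuous_compact_integrable; first exact: segment_compact.
exact: continuous_subspaceT.
Qed.

Lemma iintD a b f g : continuous f -> continuous g ->
  iint a b (fun t => f t + g t) = iint a b f + iint a b g.
Proof. by move=> cf cg; rewrite /iint RintegralD//; exact: continuous_integrable. Qed.

Lemma iintZ a b c f : continuous f -> iint a b (fun t => c * f t) = c * iint a b f.
Proof. by move=> cf; rewrite /iint RintegralZl//; exact: continuous_integrable. Qed.

Lemma eq_iint a b f g : (forall t, a <= t <= b -> f t = g t) -> iint a b f = iint a b g.
Proof.
by move=> fg; apply: eq_Rintegral => t; rewrite inE/= in_itv/= => /fg.
Qed.

Lemma iint_cst a b c : a <= b -> iint a b (fun=> c) = c * (b - a).
Proof.
move=> ab; rewrite /iint Rintegral_cst//= lebesgue_measure_itv/= lte_fin.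
move: ab; rewrite le_eqVlt => /predU1P[->|ab]; first by rewrite ltxx subrr.
by rewrite ab.
Qed.

Lemma ler_iint a b f g : continuous f -> continuous g ->
  (forall t, a <= t <= b -> f t <= g t) -> iint a b f <= iint a b g.
Proof.
move=> cf cg fg; apply: le_Rintegral => //; try exact: continuous_integrable.
Qed.

Lemma iint_bound a b f M : a <= b -> continuous f ->
  (forall t, a <= t <= b -> `|f t| <= M) -> `|iint a b f| <= M * (b - a).
Proof.
move=> ab cf fM; rewrite ler_norml -mulNr -!iint_cst//; apply/andP; split.
  apply: ler_iint => // [|t /fM]; first exact: cst_continuous.
  by rewrite ler_norml => /andP[].
apply: ler_iint => // [|t /fM]; first exact: cst_continuous.
by rewrite ler_norml => /andP[].
Qed.

Lemma iintN a b f : continuous f -> iint a b (fun t => - f t) = - iint a b f.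
Proof.
move=> cf; rewrite -mulN1r -iintZ//; apply: eq_iint => t _.
by rewrite mulN1r.
Qed.

Lemma iintB a b f g : continuous f -> continuous g ->
  iint a b (fun t => f t - g t) = iint a b f - iint a b g.
Proof. by move=> cf cg; rewrite /iint RintegralB//; exact: continuous_integrable. Qed.

Lemma iint_chasles a b c f : continuous f -> a <= b -> b <= c ->
  iint a c f = iint a b f + iint b c f.
Proof.
move=> cf ab bc; apply/eqP; rewrite addrC -subr_eq; apply/eqP.
rewrite /iint Rintegral_itvB ?bnd_simp//; last exact: continuous_integrable.
rewrite Rintegral_itv_obnd_cbnd//; apply: integrableS (continuous_integrable b c cf) => //.
exact: subset_itv_oc_cc.
Qed.

Lemma iint_point a f : iint a a f = 0.
Proof. by rewrite /iint set_itv1 Rintegral_set1. Qed.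

Lemma iint_derive_upper a f (x : R) : continuous f -> a < x ->
  is_derive x 1 (fun y => iint a y f) (f x).
Proof.
move=> cf ax; have xu : x < x + 1 by rewrite ltrDl.
have [d1 d2] := @continuous_FTC1_closed R f a x (x + 1) xu
  (continuous_integrable a (x + 1) cf) ax (cf x).
by apply: DeriveDef d1 _; rewrite -derive1E.
Qed.

Lemma compact_prod_bounded (T U : topologicalType) (K : set T) (L : set U) (G : T * U -> R) :
  compact K -> compact L -> continuous G ->
  exists2 M : R, 0 <= M & forall (t : T) u, K t -> L u -> `|G (t, u)| <= M.
Proof.
move=> cK cL cG; have cKL := compact_setX cK cL.
have : compact (G @` (K `*` L)) by apply: continuous_compact => //; exact: continuous_subspaceT.
move=> /compact_bounded[M [_ HM]]; exists (`|M| + 1); first by rewrite addr_ge0.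
move=> t u Kt Lu; apply: (HM (`|M| + 1)); first by rewrite (le_lt_trans (ler_norm M))// ltrDl.
by exists (t, u).
Qed.

(** Differentiation under the integral sign: F' is bounded on the compact rectangle [a, b] x
    [x - 1, x + 1], and this constant is the dominating function. *)
Lemma iint_derive (F F' : R -> R -> R) a b (x : R) :
  (forall t y : R, is_derive y 1 (F t) (F' t y)) ->
  (forall y, continuous (F ^~ y)) ->
  continuous (fun p : R * R => F' p.1 p.2) ->
  is_derive x 1 (fun y => iint a b (F ^~ y)) (iint a b (F' ^~ x)).
Proof.
move=> dF cF cF'.
have [M M0 HM] := compact_prod_bounded (@segment_compact R a b)
  (@segment_compact R (x - 1) (x + 1)) cF'.
have Ix : `]x - 1, x + 1[%classic x by rewrite /= in_itv/= ltrBlDr ltrDl ltr01.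
have intF (y : R) : `]x - 1, x + 1[%classic y ->
    (@lebesgue_measure R).-integrable `[a, b] (EFin \o (F^~ y)).
  by move=> _; exact: continuous_integrable.
have derF (y t : R) : `]x - 1, x + 1[%classic y -> `[a, b]%classic t -> derivable (F t) y 1.
  by move=> _ _; case: (dF t y).
have intG : (@lebesgue_measure R).-integrable `[a, b] (EFin \o (fun=> M)).
  by apply: continuous_integrable; exact: cst_continuous.
have G_ub (y t : R) : `]x - 1, x + 1[%classic y -> `[a, b]%classic t ->
   `|partial1of2 (fun u v => F v u) y t| <= M.
  move=> Iy abt; rewrite partial1of2E; case: (dF t y) => _ ->.
  by apply: HM => //; exact: subset_itv_oo_cc Iy.
have mab : measurable (`[a, b]%classic : set (measurableTypeR R)) by exact: measurable_itv.
have := @derivable_under_integral R _ (measurableTypeR R) (@lebesgue_measure R)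
  (fun y t => F t y) `[a, b]%classic mab x (x - 1) (x + 1) Ix intF derF (fun=> M) (fun=> M0) intG G_ub.
have := @differentiation_under_integral R _ (measurableTypeR R) (@lebesgue_measure R)
  (fun y t => F t y) `[a, b]%classic mab x (x - 1) (x + 1) Ix intF derF (fun=> M) (fun=> M0) intG G_ub.
move=> H1 H2; apply: DeriveDef H2 _.
rewrite -derive1E H1; apply: eq_Rintegral => t _.
by rewrite partial1of2E; case: (dF t x).
Qed.

(** The parameter lives in an arbitrary topological space, so no sequential argument is possible.
    Compactness of [a, b], in its near-covering form, makes the continuity in the parameter uniform
    in t. *)
Lemma iint_continuous (T : topologicalType) (F : R -> T -> R) a b :
  continuous (fun p : R * T => F p.1 p.2) ->
  continuous (fun y => iint a b (F ^~ y)).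
Proof.
move=> cF x; have [ab|ba] := leP a b; last first.
  rewrite (_ : (fun y => _) = fun=> 0); first exact: cst_continuous.
  apply/funext => y; rewrite /iint set_itv_ge ?Rintegral_set0//.
  by rewrite bnd_simp -ltNge.
have cFy (y : T) : continuous (F ^~ y).
  apply: (continuous_comp_pair cF) => [t|]; [exact: cvg_id|exact: cst_continuous].
apply/cvgrPdist_le => e e0.
pose e' := e / (b - a + 1).
have ba0 : 0 < b - a + 1 by rewrite ltr_wpDl// subr_ge0.
have e'0 : 0 < e' by rewrite divr_gt0.
have near_unif : \forall y \near x, `[a, b]%classic `<=` (fun t => `|F t x - F t y| <= e').
  have cov : near_covering (`[a, b]%classic : set R).
    by apply/compact_near_coveringP; exact: segment_compact.
  apply: (cov _ (nbhs x) (fun y t => `|F t x - F t y| <= e')) => t _.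
  have h : 0 < e' / 2 by rewrite divr_gt0.
  have /cvgrPdist_le/(_ _ h) := cF (t, x).
  rewrite -[nbhs (t, x)]/(filter_prod (nbhs t) (nbhs x)).
  move=> [[A B] [At Bx] AB]; exists (A, B) => //= -[t' y] [/= At' By].
  have x1 : `|F t x - F t' y| <= e' / 2 by exact: (AB (t', y)).
  have x2 : `|F t x - F t' x| <= e' / 2.
    apply: (AB (t', x)); split => //=; exact: nbhs_singleton.
  have -> : F t' x - F t' y = (F t x - F t' y) - (F t x - F t' x) by ring.
  rewrite (le_trans (ler_normB _ _))//; lra.
near=> y.
rewrite -iintB//.
have H : `|iint a b (fun t => F t x - F t y)| <= e' * (b - a).
  apply: iint_bound => // [t|]; first by apply: continuousB; exact: cFy.
  by move=> t abt; have : `[a, b]%classic `<=` (fun t => `|F t x - F t y| <= e');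
    [near: y|apply; rewrite /= in_itv].
apply: (le_trans H); rewrite /e' mulrAC ler_pdivrMr// ler_pM2l// lerDl//.
Unshelve. all: by end_near. Qed.
End segment_integral.

(** * Smooth functions and cutoffs *)

Section real_derivatives.
Context {R : realType}.
Implicit Types (f g : R -> R) (x a b c : R).

Lemma is_derive_addf f g x a b : is_derive x 1 f a -> is_derive x 1 g b ->
  is_derive x 1 (fun y => f y + g y) (a + b).
Proof. by move=> df dg; exact: is_deriveD. Qed.

Lemma is_derive_mulf f g x a b : is_derive x 1 f a -> is_derive x 1 g b ->
  is_derive x 1 (fun y => f y * g y) (f x * b + g x * a).
Proof. by move=> df dg; exact: (is_deriveM df dg). Qed.

Lemma is_derive_scalef c f x a : is_derive x 1 f a -> is_derive x 1 (fun y => c * f y) (c * a).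
Proof. by move=> df; exact: (is_deriveZ c df). Qed.

Lemma is_derive_compf f g x a b : is_derive (g x) 1 f a -> is_derive x 1 g b ->
  is_derive x 1 (fun y => f (g y)) (a * b).
Proof. by move=> df dg; have := is_derive1_comp df dg. Qed.

Lemma is_derive_ext f g x a b : is_derive x 1 f a -> (forall y, f y = g y) -> a = b ->
  is_derive x 1 g b.
Proof. by move=> df /funext <- <-. Qed.

Lemma is_derive_affine a b x : is_derive x 1 (fun y => a * y + b) a.
Proof.
have := is_derive_addf (is_derive_scalef a (is_derive_id x 1)) (is_derive_cst b x 1).
by rewrite mulr1 addr0.
Qed.

Lemma is_derive_comp_affine f a b x c : is_derive (a * x + b) 1 f c ->
  is_derive x 1 (fun y => f (a * y + b)) (c * a).
Proof.
by move=> df; exact: (@is_derive_compf f (fun y => a * y + b) x c a df (is_derive_affine a b x)).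
Qed.

Lemma derive_continuous f x a : is_derive x 1 f a -> {for x, continuous f}.
Proof.
by move=> [df _]; apply: differentiable_continuous; exact/derivable1_diffP.
Qed.

(** A smooth function of one variable is carried together with all its derivatives. Composition with
    coordinates and repeated integration by parts then need no iterated derivative operator, and a
    p-fold primitive is given just by an explicit chain. *)
Definition derivative_chain (H : nat -> R -> R) :=
  forall n x, is_derive x 1 (H n) (H n.+1 x).

Lemma chain_continuous H n : derivative_chain H -> continuous (H n).
Proof. by move=> dH x; exact: derive_continuous (dH n x). Qed.

(* The function exp(-1/x), extended by 0 to the left of 0: its n-th derivative is
   P_n(1/x) exp(-1/x) with P_(n+1) = X^2 (P_n - P_n'). *)
Fixpoint flat_poly n : {poly R} :=
  if n is m.+1 then 'X^2 * (flat_poly m - (flat_poly m)^`()) else 1.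

Definition flat_der n x := if 0 < x then (flat_poly n).[x^-1] * expR (- x^-1) else 0.

(** Each monomial of positive degree is handled by z^(n+1) <= (n+1)! exp z, read off the exponential
    series; the constant term is bounded apart. *)
Lemma poly_expR_bounded (p : {poly R}) : exists C : R, forall z : R, 0 <= z -> `|p.[z] * expR (- z)| <= C.
Proof.
elim/poly_ind: p => [|p c [C HC]]; first by exists 0 => z _; rewrite horner0 mul0r normr0.
have bnd : exists C : R, forall z : R, 0 <= z -> `|p.[z] * z * expR (- z)| <= C.
  clear C HC; have Hn n : exists C : R, forall z : R, 0 <= z -> z ^+ n.+1 * expR (- z) <= C.
    exists (n.+1`!%:R) => z z0; rewrite expRN ler_pdivrMr ?expR_gt0//.
    have := expR_ge1Dxn n z0.
    rewrite -[X in _ + X]mulr1 => H.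
    have f0 : (0 : R) < n.+1`!%:R by rewrite ltr0n fact_gt0.
    rewrite mulrC -ler_pdivrMr// (le_trans _ H)// mulr1 lerDr//.
  have : exists C : R, forall z : R, 0 <= z -> `|\sum_(i < size p) p`_i * z ^+ i * z * expR (- z)| <= C.
    elim: (size p) => [|n [C HC]]; first by exists 0 => z _; rewrite big_ord0 normr0.
    have [C' HC'] := Hn n.
    exists (C + `|p`_n| * C') => z z0; rewrite big_ord_recr/=.
    rewrite (le_trans (ler_normD _ _))// lerD ?HC//.
    rewrite -!mulrA normrM ler_wpM2l// mulrA -exprSr ger0_norm ?HC'//.
    by rewrite mulr_ge0 ?exprn_ge0// expR_ge0.
  move=> [C HC]; exists C => z z0; rewrite horner_coef.
  by have := HC z z0; rewrite -!big_distrl.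
have [C' HC'] := bnd; exists (C' + `|c|) => z z0.
rewrite hornerMXaddC mulrDl (le_trans (ler_normD _ _))// lerD ?HC'//.
rewrite normrM -[leRHS]mulr1 ler_wpM2l// ger0_norm ?expR_ge0//.
by rewrite -expR0 ler_expR oppr_le0.
Qed.

(** The delicate point is 0. Boundedness of z^2 P_n(z) exp(-z) at z = 1/y gives |[flat_der n y]| <=
    C y^2, so that the difference quotient at 0 is O(h). *)
Lemma flat_der_chain : derivative_chain flat_der.
Proof.
move=> n x; have [x0|x0|->] := ltgtP x 0.
- have -> : flat_der n.+1 x = 0 by rewrite /flat_der ltNge ltW.
  apply: (@near_eq_is_derive _ _ _ (fun=> 0)).
  near=> y; rewrite /flat_der ltNge ltW//=.
  by near: y; exact: lt_nbhsl.
- have nx : x != 0 by rewrite gt_eqF.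
  have dV : is_derive x 1 (fun y : R => y^-1) (- x^-2).
    have := @is_deriveV R id x 1 1 nx (is_derive_id _ _).
    by rewrite [_ *: 1]mulr1.
  have dp := is_derive_compf (is_derive_poly (flat_poly n) x^-1) dV.
  have de : is_derive x 1 (fun y : R => expR (- y^-1)) (expR (- x^-1) * x^-2).
    have dN := is_derive_scalef (-1) dV.
    rewrite (_ : (fun y => -1 * y^-1) = (fun y => - y^-1)) in dN.
      by have := @is_derive_compf expR (fun y => - y^-1) x _ _ (is_derive_expR (- x^-1)) dN; rewrite mulN1r opprK.
    by apply/funext => y; rewrite mulN1r.
  have D : is_derive x 1 (fun y => (flat_poly n).[y^-1] * expR (- y^-1)) (flat_der n.+1 x).
    apply: is_derive_eq (is_derive_mulf dp de) _.
    rewrite /flat_der x0 /= hornerM hornerXn hornerD hornerN exprVn; ring.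
  refine (near_eq_is_derive _ D); near=> y; rewrite /flat_der.
  have -> // : 0 < y by near: y; exact: lt_nbhsr.
- have -> : flat_der n.+1 0 = 0 by rewrite /flat_der ltxx.
  have [C HC] := poly_expR_bounded ('X^2 * flat_poly n).
  have bnd y : `|flat_der n y| <= C * y ^+ 2.
    rewrite /flat_der; case: ifPn => [y0|_]; last first.
      rewrite normr0 mulr_ge0 ?sqr_ge0// (le_trans _ (HC 0 (lexx _)))//.
    have := HC y^-1; rewrite invr_ge0 ltW// => /(_ isT).
    rewrite hornerM hornerXn -mulrA normrM ger0_norm ?sqr_ge0// exprVn mulrC ler_pdivrMr//.
    by rewrite exprn_gt0.
  have f0 : flat_der n 0 = 0 by rewrite /flat_der ltxx.
  have cv : (fun h : R => h^-1 *: (flat_der n (h *: (1:R) + 0) - flat_der n 0)) @ 0^' --> (0 : R).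
    apply/cvgrPdist_le => e e0.
    have C0 : 0 <= C by have := bnd 1; rewrite expr1n mulr1; exact: le_trans.
    have eC : 0 < e / (C + 1) by rewrite divr_gt0// ltr_wpDl.
    near=> h; have hn0 : h != 0 by near: h; exact: nbhs_dnbhs_neq.
    rewrite sub0r normrN f0 subr0 addr0 [h *: 1]mulr1 normrM normfV.
    rewrite mulrC ler_pdivrMr ?normr_gt0//.
    apply: (le_trans (bnd h)).
    rewrite -real_normK ?num_real// expr2 mulrA ler_wpM2r//.
    have : `|h| <= e / (C + 1) by near: h; apply: dnbhs0_le.
    rewrite ler_pdivlMr ?ltr_wpDl// => H; apply: le_trans H.
    by rewrite mulrC ler_wpM2l// lerDl.
  apply: DeriveDef; first by apply/cvg_ex; exists 0; exact: cv.
  by apply/cvg_lim; first exact: norm_hausdorff.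
Unshelve. all: by end_near. Qed.

Lemma flat_der_le0 n x : x <= 0 -> flat_der n x = 0.
Proof. by rewrite /flat_der ltNge => ->. Qed.

Lemma flat0E x : 0 < x -> flat_der 0 x = expR (- x^-1).
Proof. by rewrite /flat_der => -> /=; rewrite hornerC mul1r. Qed.

Lemma flat0_ge0 x : 0 <= flat_der 0 x.
Proof.
have [/flat_der_le0 ->//|/flat0E ->] := leP x 0; exact: expR_ge0.
Qed.

(** A composition replaces the usual quotient of flat functions, so that smoothness follows from the
    chain rule and linear combinations alone. The factors e normalize the value exp(-1) of the flat
    function at 1. *)
Definition smooth_step x := expR 1 * flat_der 0 (1 - expR 1 * flat_der 0 (1 - x)).

Lemma smooth_step_ge0 x : 0 <= smooth_step x.
Proof. by rewrite mulr_ge0 ?expR_ge0// flat0_ge0. Qed.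

Lemma smooth_step1 x : 1 <= x -> smooth_step x = 1.
Proof.
move=> x1; rewrite /smooth_step (flat_der_le0 0 (_ : 1 - x <= 0)) ?subr_le0//.
by rewrite mulr0 subr0 flat0E// invr1 expRxMexpNx_1.
Qed.

Lemma smooth_step0 x : x <= 0 -> smooth_step x = 0.
Proof.
move=> x0; rewrite /smooth_step flat_der_le0 ?mulr0// subr_le0.
rewrite -[leLHS](expRxMexpNx_1 1) ler_pM2l ?expR_gt0// flat0E; last lra.
rewrite ler_expR lerN2 invf_le1; lra.
Qed.
End real_derivatives.

Section smooth_functions.
Context {R : realType} {d : nat}.
Local Notation E := 'rV[R]_d.
Implicit Types (f g : E -> R) (s : seq 'I_d) (U : set E).

Lemma C1_comp (h h' : R -> R) f x : C1_at f x -> is_derive (f x) 1 h (h' (f x)) ->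
  C1_at (fun y => h (f y)) x /\
  forall i, partial i (fun y => h (f y)) x = h' (f x) * partial i f x.
Proof.
move=> [cf df] dh.
have key i : is_derive x (delta_mx 0 i) (fun y => h (f y)) (h' (f x) * partial i f x).
  set v := delta_mx 0 i.
  pose phi t := f (t *: v + x).
  have line0 (g : E -> R) y : derive (fun h : R => g (h *: v + y)) 0 1 = 'D_v g y.
    rewrite /derive; congr (lim _); apply: f_equal2 => //; apply/funext => t /=.
    by rewrite /shift/= !addr0 [t *: 1]mulr1 scale0r add0r.
  have dphi : is_derive (0 : R) 1 phi ('D_v f x).
    exact: DeriveDef ((derivable1P f x v).1 (df i)) (line0 f x).
  have dh' : is_derive (phi 0) 1 h (h' (f x)) by rewrite /phi scale0r add0r.
  have H := is_derive_compf dh' dphi.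
  apply: DeriveDef; first by apply/derivable1P; case: H.
  by rewrite -line0; case: H => _ <-.
split; last by move=> i; case: (key i).
split; last by move=> i; case: (key i).
by apply: continuous_comp => //; exact: derive_continuous dh.
Qed.

Lemma Ck_comp n U (H : nat -> R -> R) m f : open U -> derivative_chain H -> Ck_on n U f ->
  Ck_on n U (fun y => H m (f y)).
Proof.
move=> oU dH; elim: n m f => [|n IH] m f kf.
  apply/Ck0 => x Ux; apply: (C1_comp (h' := H m.+1) _ (dH m (f x))).1.
  exact: (Ck0 _ _).1 kf _ Ux.
have [f1 fS] := (CkS _ _ _).1 kf.
apply/CkS; split=> [x Ux|i].
  by apply: (C1_comp (h' := H m.+1) _ (dH m (f x))).1; exact: f1.
apply: (@Ck_ext _ _ _ _ (fun y => H m.+1 (f y) * partial i f y)) => //.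
  by move=> y Uy; rewrite (C1_comp (h' := H m.+1) (f1 y Uy) (dH m (f y))).2.
by apply: Ck_mul => //; apply: IH; exact: CkW.
Qed.

Lemma smooth_comp U (H : nat -> R -> R) m f : open U -> derivative_chain H ->
  smooth_on U f -> smooth_on U (fun y => H m (f y)).
Proof. by move=> oU dH /smoothP sf; apply/smoothP => n; exact: Ck_comp. Qed.

Lemma smooth_ext U f g : open U -> (forall y, U y -> f y = g y) -> smooth_on U f -> smooth_on U g.
Proof. by move=> oU fg /smoothP sf; apply/smoothP => n; exact: Ck_ext (sf n). Qed.

Lemma smooth_partial U i f : smooth_on U f -> smooth_on U (partial i f).
Proof. by move=> sf s; exact: (sf (i :: s)). Qed.

Lemma smooth_partials U s f : smooth_on U f -> smooth_on U (partials s f).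
Proof. by elim: s f => [|i s IH] f sf; [exact: sf|exact: (IH _ (smooth_partial i sf))]. Qed.

Lemma smooth_C1 U f x : smooth_on U f -> U x -> C1_at f x.
Proof. by move=> sf; exact: (sf [::]). Qed.

Lemma smooth_continuous f : smooth_on setT f -> continuous f.
Proof. by move=> sf x; have [] := smooth_C1 sf (I : setT x). Qed.

Definition coord (i : 'I_d) (x : E) : R := x ord0 i.

Lemma coord_is_derive (i j : 'I_d) x : is_derive x (delta_mx 0 j) (coord i) (j == i)%:R.
Proof.
have E1 h : coord i (h *: delta_mx 0 j + x) = (j == i)%:R * h + coord i x.
  by rewrite /coord !mxE eqxx/= mulrC eq_sym.
have D := is_derive_affine ((j == i)%:R : R) (coord i x) 0.
have E2 : (fun h => coord i (h *: delta_mx 0 j + x)) = (fun h => (j == i)%:R * h + coord i x).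
  by apply/funext.
apply: DeriveDef; first by apply/derivable1P; rewrite E2; case: D.
rewrite -[RHS](@derive_val _ _ _ _ _ _ _ D) -E2 /derive.
congr (lim _); apply: f_equal2 => //; apply/funext => h /=.
by rewrite /shift/= !addr0 [h *: 1]mulr1 scale0r add0r.
Qed.

Lemma coord_continuous i : continuous (coord i).
Proof. by move=> x; exact: coord_continuous. Qed.

Lemma C1_coord i x : C1_at (coord i) x.
Proof.
split; first exact: coord_continuous.
by move=> j; case: (coord_is_derive i j x).
Qed.

Lemma partial_coord i j : partial j (coord i) = fun=> (j == i)%:R.
Proof. by apply/funext => x; case: (coord_is_derive i j x). Qed.

Lemma smooth_coord U i : smooth_on U (coord i).
Proof.
apply/smoothP => -[|n]; first by apply/Ck0 => x _; exact: C1_coord.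
apply/CkS; split=> [x _|j]; first exact: C1_coord.
by rewrite partial_coord; exact: Ck_cst.
Qed.

Lemma smooth_prod (T : Type) (r : seq T) U (F : T -> E -> R) : open U ->
  (forall i, smooth_on U (F i)) -> smooth_on U (fun x => \prod_(i <- r) F i x).
Proof.
move=> oU sF; elim: r => [|i r IH].
  by apply: (@smooth_ext _ (fun=> 1) _ oU _ (smooth_cst _)) => x _; rewrite big_nil.
apply: (@smooth_ext _ (fun x => F i x * \prod_(j <- r) F j x) _ oU _ (smooth_mul oU (sF i) IH)) => x _.
by rewrite big_cons.
Qed.

Lemma smooth_smooth_step U f : open U -> smooth_on U f -> smooth_on U (fun x => smooth_step (f x)).
Proof.
move=> oU sf; have s1 : smooth_on U (fun x => 1 + (-1) * f x).
  apply: (@smooth_ext _ (fun x => 1 * 1 + (-1) * f x) _ oU _ (smooth_lin _ _ oU (smooth_cst _) sf)) => x _.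
  by rewrite mul1r.
have s2 := smooth_comp 0 oU flat_der_chain s1.
have s3 := smooth_lin 1 (- expR 1) oU (@smooth_cst _ _ U 1) s2.
have s4 := smooth_comp 0 oU flat_der_chain s3.
have s5 := smooth_lin (expR 1) 0 oU s4 (@smooth_cst _ _ U 1).
apply: smooth_ext s5 => // x _.
by rewrite /smooth_step !mul1r mul0r addr0 !mulNr mul1r.
Qed.

Definition cube_bump (x : E) : R :=
  \prod_(i <- enum 'I_d) (smooth_step (2 - coord i x) * smooth_step (2 + coord i x)).

Lemma smooth_cube_bump : smooth_on setT cube_bump.
Proof.
have oT := @openT E.
apply: smooth_prod => // i; apply: smooth_mul => //; apply: smooth_smooth_step => //.
  apply: (smooth_ext oT _ (smooth_lin 1 (-1) oT (@smooth_cst _ _ setT 2) (@smooth_coord setT i))) => x _.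
  by rewrite mul1r mulN1r.
apply: (smooth_ext oT _ (smooth_lin 1 1 oT (@smooth_cst _ _ setT 2) (@smooth_coord setT i))) => x _.
by rewrite !mul1r.
Qed.

Lemma cube_bump_ge0 x : 0 <= cube_bump x.
Proof. by apply: prodr_ge0 => i _; rewrite mulr_ge0// smooth_step_ge0. Qed.

Lemma cube_bump1 x : (forall i, `|coord i x| <= 1) -> cube_bump x = 1.
Proof.
move=> x1; apply: big1 => i _; have := x1 i; rewrite ler_norml => /andP[? ?].
by rewrite !smooth_step1 ?mulr1//; lra.
Qed.

Lemma cube_bump0 x i : 2 <= `|coord i x| -> cube_bump x = 0.
Proof.
move=> x2; rewrite /cube_bump (bigD1_seq i) ?mem_enum ?enum_uniq//=.
move: x2; rewrite ler_normr => /orP[] x2.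
  by rewrite smooth_step0 ?mul0r//; lra.
by rewrite [smooth_step (2 + _)]smooth_step0 ?mulr0 ?mul0r//; lra.
Qed.

End smooth_functions.

(** * Integration over R^d *)

(** Differentiability is asked in the open interval only, so that primitives built from [tpow],
    whose derivative is computed at positive points, qualify. *)
Lemma iint_FTC2 (R : realType) (F f : R -> R) (a b : R) : a <= b -> continuous f ->
  (forall x, a <= x <= b -> {for x, continuous F}) ->
  (forall x : R, a < x < b -> is_derive x 1 F (f x)) -> iint a b f = F b - F a.
Proof.
rewrite le_eqVlt => /predU1P[->|ab] cf cF dF; first by rewrite iint_point subrr.
rewrite /iint /Rintegral (@continuous_FTC2 R f F)//; first exact: continuous_subspaceT.
  split=> [x| |]; first by rewrite in_itv/= => /dF[].
    by apply: cvg_at_right_filter; apply: cF; rewrite lexx ltW.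
  by apply: cvg_at_left_filter; apply: cF; rewrite lexx ltW.
by move=> x; rewrite in_itv/= derive1E => /dF[].
Qed.

Section measurability.
Context {R : realType}.

Lemma bigcup_countType_measurable disp (T : measurableType disp) (I : countType) (P : I -> set T) :
  (forall i, measurable (P i)) -> measurable (\bigcup_i P i).
Proof.
move=> mP; rewrite (_ : \bigcup_i P i =
    \bigcup_n (if @unpickle I n is Some i then P i else set0)).
  by apply: bigcupT_measurable => n; case: (unpickle n).
apply/seteqP; split=> x [i _ Hx].
  by exists (pickle i) => //; rewrite pickleK.
by move: Hx; case: (unpickle i) => // j Pj; exists j.
Qed.

(** The measure lives on tuples and the topology on row vectors. They are linked by writing an open
    set as the countable union of the cubes contained in it that have a rational center and radius
    1/(n+1). *)
Lemma open_row_measurable d (U : set 'rV[R]_d) : open U -> measurable (@row_of R d @^-1` U).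
Proof.
move=> oU.
pose cube (p : {ffun 'I_d -> rat} * nat) : set (d.-tuple (measurableTypeR R)) :=
  [set t | forall i, `|tnth t i - ratr (p.1 i)| < p.2.+1%:R^-1].
pose P p := if pselect (cube p `<=` @row_of R d @^-1` U) then cube p else set0.
rewrite (_ : _ @^-1` _ = \bigcup_p P p).
  apply: bigcup_countType_measurable => p; rewrite /P; case: pselect => //= _.
  rewrite (_ : cube p = \bigcap_(i in [set: 'I_d])
    ((fun t : d.-tuple (measurableTypeR R) => tnth t i) @^-1`
      `](ratr (p.1 i) - p.2.+1%:R^-1), (ratr (p.1 i) + p.2.+1%:R^-1)[%classic)).
    apply: fin_bigcap_measurable; first exact: finite_finset.
    move=> i _; rewrite -[X in measurable X]setTI; exact: measurable_tnth.
  apply/seteqP; split=> t H i.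
    by move=> _ /=; rewrite in_itv/= -ltr_distl; exact: H.
  by have := H i I; rewrite /= in_itv/= -ltr_distl.
apply/seteqP; split=> t; last first.
  by move=> [p _]; rewrite /P; case: pselect => // sU; exact: sU.
move=> Ut; have [e /= e0 be] : nbhs_ball (row_of t) U.
  by apply/nbhs_ballP; apply: open_nbhs_nbhs; split.
(* Two points of one cube of radius 1/(n+1) differ by less than 2/(n+1) in each coordinate, which
   must be below e. *)
pose n := Num.truncn (2 / e).
have n0 : (0 : R) < n.+1%:R by [].
have ne : 2 * n.+1%:R^-1 < e.
  by rewrite ltr_pdivrMr// mulrC -ltr_pdivrMr//; exact: truncnS_gt.
have /choice[q Hq] : forall i : 'I_d, exists q : rat, `|tnth t i - ratr q| < n.+1%:R^-1.
  move=> i; have /rat_in_itvoo[q /itvP qre] : tnth t i - n.+1%:R^-1 < tnth t i + n.+1%:R^-1 :> R.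
    by rewrite ltrBlDr -addrA ltrDl addr_gt0// invr_gt0.
  by exists q; rewrite distrC ltr_distl !qre.
exists ([ffun i => q i], n) => //; rewrite /P; case: pselect => [sub|nsub].
  by move=> i; rewrite /= ffunE.
exfalso; apply: nsub => s Hs; apply: be; split => // j i; rewrite /row_of !mxE.
rewrite -ball_normE /=.
have -> : tnth t i - tnth s i = (tnth t i - ratr (q i)) - (tnth s i - ratr (q i)) by ring.
rewrite (le_lt_trans (ler_normB _ _))// (le_lt_trans _ ne)// [2 * _]mulr_natl mulr2n.
by rewrite lerD// ltW//; have := Hs i; rewrite /= ffunE.
Qed.

Lemma measurable_row d (f : 'rV[R]_d -> R) : continuous f ->
  measurable_fun setT (fun t : d.-tuple (measurableTypeR R) => f (row_of t)).
Proof.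
move=> /continuousP cf; apply: (measurability _ (RGenOpens.measurableE R)).
move=> _ [_ [a [b ->] <-]]; rewrite setTI.
apply: (@open_row_measurable d (f @^-1` `]a, b[%classic)).
by apply: cf; exact: interval_open.
Qed.

Definition rowcons d (x : R) (y : 'rV[R]_d) : 'rV[R]_d.+1 :=
  \row_i (if unlift ord0 i is Some j then y ord0 j else x).

Lemma row_of_cons d (x : R) (t : d.-tuple (measurableTypeR R)) :
  row_of (cons_pair (x, t)) = rowcons x (row_of t).
Proof.
apply/rowP => i; rewrite !mxE; case: unliftP => [j ->|->]; last by rewrite tnth0.
by rewrite tnthS mxE.
Qed.

Lemma rowconsE d (x : R) (y : 'rV[R]_d) :
  rowcons x y = x *: delta_mx 0 ord0 + rowcons 0 y.
Proof.
apply/rowP => i; rewrite !mxE; case: unliftP => [j ->|->]; rewrite ?eqxx /=.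
  by rewrite mulr0 add0r.
by rewrite mulr1 addr0.
Qed.

Lemma lebesgueN_fubini d (f : d.+1.-tuple (measurableTypeR R) -> \bar R) :
  measurable_fun [set: d.+1.-tuple (measurableTypeR R)] f ->
  (lebesgueN d.+1).-integrable setT f ->
  (\int[lebesgueN d.+1]_t f t =
   \int[lebesgueN d]_t \int[@lebesgue_measure R]_x f (cons_pair (x, t)))%E.
Proof.
move=> mf intf.
have mc := @measurable_cons_pair _ (measurableTypeR R) d.
have intc : (@lebesgue_measure R \x lebesgueN d)%E.-integrable setT (f \o @cons_pair _ _ d).
  apply/integrableP; split; first exact: measurableT_comp.
  move/integrableP : intf => [_]; rewrite ge0_integral_pushforward//.
  by apply: measurableT_comp.
rewrite [LHS](integral_pushforward mc mf)//.
rewrite preimage_setT -integral21_prod_meas1//.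
Qed.
End measurability.

Section row_integral.
Context {R : realType} {d : nat}.
Local Notation E := 'rV[R]_d.
Implicit Types (f g : E -> R).

Definition rint f : R := \int[lebesgueN d]_t f (row_of t).

Definition compactly_supported f := exists2 K : set E, compact K & forall x, ~ K x -> f x = 0.

Lemma coord_le_norm i (x : E) : `|coord i x| <= `|x|.
Proof.
have -> : `|x| = mx_norm x by [].
rewrite mx_normrE; exact: (@le_bigmax _ _ _ 0 (fun ij : 'I_1 * 'I_d => `|x ij.1 ij.2|) (ord0, i)).
Qed.

Lemma compact_coord_bounded (K : set E) : compact K ->
  exists2 r : R, 0 < r & forall x i, K x -> `|coord i x| <= r.
Proof.
move=> cK; have [M [_ HM]] := compact_bounded cK.
exists (`|M| + 1); first by rewrite ltr_wpDl.
move=> x i Kx; apply: (le_trans (coord_le_norm i x)).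
by apply: HM Kx; rewrite (le_lt_trans (ler_norm M))// ltrDl.
Qed.

Lemma compact_supp_bounded f : continuous f -> compactly_supported f ->
  exists2 M, 0 <= M & forall x, `|f x| <= M.
Proof.
move=> cf [K cK f0].
have : compact (f @` K) by apply: continuous_compact => //; exact: continuous_subspaceT.
move=> /compact_bounded[M [_ HM]]; exists (`|M| + 1); first by rewrite addr_ge0.
move=> x; have [Kx|/f0 ->] := pselect (K x); last by rewrite normr0 addr_ge0.
apply: (HM (`|M| + 1)); first by rewrite (le_lt_trans (ler_norm M))// ltrDl.
by exists x.
Qed.

Lemma integrable_row f : continuous f -> compactly_supported f ->
  (lebesgueN d).-integrable setT (fun t => (f (row_of t))%:E).
Proof.
move=> cf sf; have [M M0 HM] := compact_supp_bounded cf sf.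
have [K cK f0] := sf; have [r r0 Hr] := compact_coord_bounded cK.
have mb := @measurable_tuple_box R d r.
have ib : (lebesgueN d).-integrable (@tuple_box R d r) (EFin \o (fun t => f (row_of t))).
  apply: measurable_bounded_integrable => //; first exact: lebesgueN_box.
    by apply: measurable_funTS; exact: measurable_row.
  exists M; split; first exact: num_real.
  by move=> x Mx t _; exact: le_trans (HM _) (ltW Mx).
have := (integrable_mkcond (EFin \o (fun t => f (row_of t))) mb).1 ib.
congr (integrable _ _ _); apply/funext => t; rewrite patchE.
case: ifPn => // /negP nb; rewrite /= f0// => Kt; apply: nb; apply: mem_set => i.
by have := Hr _ i Kt; rewrite /coord mxE.
Qed.

Lemma rintD f g : continuous f -> continuous g -> compactly_supported f -> compactly_supported g ->
  rint (fun x => f x + g x) = rint f + rint g.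
Proof. by move=> cf cg sf sg; rewrite /rint RintegralD//; exact: integrable_row. Qed.

Lemma rintZ c f : continuous f -> compactly_supported f ->
  rint (fun x => c * f x) = c * rint f.
Proof. by move=> cf sf; rewrite /rint RintegralZl//; exact: integrable_row. Qed.

Lemma ler_rint f g : continuous f -> continuous g -> compactly_supported f -> compactly_supported g ->
  (forall x, f x <= g x) -> rint f <= rint g.
Proof. by move=> cf cg sf sg fg; apply: le_Rintegral => //; exact: integrable_row. Qed.

Lemma rint_bound (K : set E) : compact K -> exists2 A : R, 0 <= A &
  forall f B, 0 <= B -> (forall x, K x -> `|f x| <= B) -> (forall x, ~ K x -> f x = 0) ->
  `|rint f| <= A * B.
Proof.
move=> cK; have [r r0 Hr] := compact_coord_bounded cK.
exists (fine (lebesgueN d (@tuple_box R d r))); first by rewrite fine_ge0.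
move=> f B B0 fK f0; rewrite mulrC.
apply: Rintegral_bound => //; [exact: measurable_tuple_box|exact: lebesgueN_box| |].
  by move=> t _; have [/fK//|/f0 ->] := pselect (K (row_of t)); rewrite normr0.
move=> t nb; apply: f0 => Kt; apply: nb => i.
by have := Hr _ i Kt; rewrite /coord mxE.
Qed.

Lemma compactly_supportedMr f g : compactly_supported g -> compactly_supported (fun x => f x * g x).
Proof. by move=> [K cK f0]; exists K => // x /f0 ->; rewrite mulr0. Qed.

Lemma compactly_supportedD f g : compactly_supported f -> compactly_supported g ->
  compactly_supported (fun x => f x + g x).
Proof.
move=> [K cK f0] [L cL g0]; exists (K `|` L); first exact: compactU.
by move=> x /not_orP[/f0 -> /g0 ->]; rewrite addr0.
Qed.

Lemma partial_outside (K : set E) i f : compact K -> (forall x, ~ K x -> f x = 0) ->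
  forall x, ~ K x -> partial i f x = 0.
Proof.
move=> cK f0 x nK.
have oK : open (~` K) by apply: closed_openC; apply: compact_closed cK; exact: norm_hausdorff.
rewrite (@partial_ext _ _ (~` K) f (fun=> 0) i oK _ x nK); last by move=> y /f0.
by rewrite /partial (@derive_cst R _ _ (0 : R)).
Qed.

Lemma partials_outside (K : set E) s f : compact K -> (forall x, ~ K x -> f x = 0) ->
  forall x, ~ K x -> partials s f x = 0.
Proof.
move=> cK; elim: s f => [|i s IH] f f0 //=; apply: IH.
exact: partial_outside.
Qed.

Lemma compactly_supported_partial i f : compactly_supported f -> compactly_supported (partial i f).
Proof. by move=> [K cK f0]; exists K => //; exact: partial_outside. Qed.

Lemma line_is_derive f i (x : R) (y : E) : C1_at f (x *: delta_mx 0 i + y) ->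
  is_derive x 1 (fun h => f (h *: delta_mx 0 i + y)) (partial i f (x *: delta_mx 0 i + y)).
Proof.
move=> [_ df]; set v := delta_mx 0 i.
pose g h := f (h *: v + (x *: v + y)).
have line0 (k : E -> R) z : derive (fun h : R => k (h *: v + z)) 0 1 = 'D_v k z.
  rewrite /derive; congr (lim _); apply: f_equal2 => //; apply/funext => t /=.
  by rewrite /shift/= !addr0 [t *: 1]mulr1 scale0r add0r.
have dg : is_derive (0 : R) 1 g (partial i f (x *: v + y)).
  exact: DeriveDef ((derivable1P f (x *: v + y) v).1 (df i)) (line0 f _).
have da := is_derive_affine 1 (- x) x.
have dg' : is_derive (1 * x + - x) 1 g (partial i f (x *: v + y)) by rewrite mul1r subrr.
have := @is_derive_compf _ g (fun h => 1 * h + - x) _ _ _ dg' da; rewrite mulr1 /g.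
congr (is_derive _ _ _ _); apply/funext => h.
by rewrite mul1r addrA -scalerDl subrK.
Qed.
End row_integral.

Section integration_by_parts.
Context {R : realType} {d : nat}.
Local Notation E := 'rV[R]_d.+1.
Implicit Types (f g : E -> R).

(** With the first coordinate as the innermost variable in Fubini's theorem, each inner integral is
    a difference of two values of f at x_0 = r + 1 and x_0 = -(r + 1), both off the support. *)
Lemma rint_partial0 f : smooth_on setT f -> compactly_supported f -> rint (partial ord0 f) = 0.
Proof.
move=> sf cf; have [K cK f0] := cf; have [r r0 Hr] := compact_coord_bounded cK.
have cpf : continuous (partial ord0 f) by apply: smooth_continuous; exact: smooth_partial.
have scpf := compactly_supported_partial ord0 cf.
have mpf := measurable_row cpf.
rewrite /rint /Rintegral (lebesgueN_fubini _ (integrable_row cpf scpf)); last first.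
  exact/measurable_EFinP.
rewrite (@eq_integral _ _ _ _ _ (fun=> 0%E)) ?integral0// => t _.
pose G x := f (x *: delta_mx 0 ord0 + rowcons 0 (row_of t)).
pose g x := partial ord0 f (x *: delta_mx 0 ord0 + rowcons 0 (row_of t)).
have dG (x : R) : is_derive x 1 G (g x).
  by apply: line_is_derive; exact: smooth_C1 sf _.
have cl : continuous (fun x : R => x *: delta_mx 0 ord0 + rowcons 0 (row_of t) : E).
  move=> x; apply: (@continuousD _ _ _ (fun x : R => x *: delta_mx 0 ord0)); last exact: cst_continuous.
  by apply: continuousZ; [exact: cvg_id|exact: cst_continuous].
have cg : continuous g.
  by move=> x; apply: continuous_comp; [exact: cl|exact: cpf].
have notK (x : R) : r < `|x| -> ~ K (x *: delta_mx 0 ord0 + rowcons 0 (row_of t)).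
  move=> rx Kx; have := Hr _ ord0 Kx; rewrite leNgt /coord !mxE eqxx /= mulr1.
  by rewrite unlift_none addr0 rx.
have := iint_FTC2 (_ : - (r + 1) <= r + 1) cg
  (fun x _ => derive_continuous (dG x)) (fun x _ => dG x).
have -> : G (r + 1) = 0 by apply: f0; apply: notK; rewrite gtr0_norm ?ltrDl// addr_gt0.
have -> : G (- (r + 1)) = 0.
  by apply: f0; apply: notK; rewrite normrN gtr0_norm ?ltrDl// addr_gt0.
rewrite subr0 => H; have {H}ig : iint (- (r + 1)) (r + 1) g = 0 by apply: H; lra.
have := continuous_integrable (- (r + 1)) (r + 1) cg.
move=> ii; have := integrable_fin_num _ ii => fin.
transitivity (\int[@lebesgue_measure R]_(x in `[(- (r + 1))%R, (r + 1)%R]) (g x)%:E)%E.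
  rewrite [RHS]integral_mkcond; apply: eq_integral => x _; rewrite patchE row_of_cons rowconsE.
  case: ifPn => // /negP nx; congr EFin; apply: partial_outside cK f0 _ _.
  apply: notK; rewrite ltNge; apply/negP => xr; apply: nx; apply: mem_set => /=.
  by rewrite in_itv/= -ler_norml (le_trans xr)// lerDl.
by rewrite -[LHS]fineK ?fin// -[fine _]/(iint _ _ g) ig.
Qed.

Lemma rint_parts0 f g : smooth_on setT f -> smooth_on setT g -> compactly_supported g ->
  rint (fun x => partial ord0 f x * g x) = - rint (fun x => f x * partial ord0 g x).
Proof.
move=> sf sg cg.
have oT := @openT E.
have sfg := smooth_mul oT sf sg.
have := rint_partial0 sfg (compactly_supportedMr f cg).
have -> : partial ord0 (fun x => f x * g x) =
    (fun x => f x * partial ord0 g x + partial ord0 f x * g x).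
  apply/funext => x; rewrite (partial_mul _ (smooth_C1 sf (I : setT x)) (smooth_C1 sg (I : setT x))).
  by rewrite [g x * _]mulrC.
have s0f := smooth_partial ord0 sf; have s0g := smooth_partial ord0 sg.
rewrite rintD; last 4 first.
- by apply: smooth_continuous; exact: smooth_mul.
- by apply: smooth_continuous; exact: smooth_mul.
- by apply: compactly_supportedMr; exact: compactly_supported_partial.
- exact: compactly_supportedMr.
by move/eqP; rewrite addrC addr_eq0 => /eqP.
Qed.

Lemma partial_chain_coord (H : nat -> R -> R) n i j : derivative_chain H ->
  partial j (fun x : E => H n (coord i x)) = fun x => (j == i)%:R * H n.+1 (coord i x).
Proof.
move=> dH; apply/funext => x.
rewrite (C1_comp (h' := H n.+1) (C1_coord i x) (dH n _)).2 partial_coord.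
by rewrite mulrC.
Qed.

Lemma smooth_chain_coord U (H : nat -> R -> R) n i : open U -> derivative_chain H ->
  smooth_on U (fun x : E => H n (coord i x)).
Proof. by move=> oU dH; apply: smooth_comp => //; exact: smooth_coord. Qed.

Lemma rint_chain_parts (H : nat -> R -> R) p f : derivative_chain H -> smooth_on setT f ->
  compactly_supported f ->
  rint (fun x => H p (coord ord0 x) * f x) =
  (-1) ^+ p * rint (fun x => H 0 (coord ord0 x) * partials (nseq p ord0) f x).
Proof.
move=> dH; elim: p f => [|p IH] f sf cf; first by rewrite expr0 mul1r.
rewrite /= exprS -mulrA -IH; [|exact: smooth_partial|exact: compactly_supported_partial].
rewrite mulN1r -rint_parts0//; last exact: smooth_chain_coord (@openT E) dH.
congr rint; apply/funext => x.
by rewrite partial_chain_coord// eqxx mul1r.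
Qed.

(** The p derivatives move from H to f, so that only the size of [H 0] on [-r, r] matters. The
    constants depend on f and p alone: the lemma is applied to whole families of chains whose p-th
    member is the function of interest and whose member of index 0 is a small p-fold primitive of
    it. *)
Lemma rint_chain_bound p f : smooth_on setT f -> compactly_supported f ->
  exists2 A : R, 0 <= A & exists2 r : R, 0 < r & forall (H : nat -> R -> R) B, derivative_chain H -> 0 <= B ->
  (forall y, `|y| <= r -> `|H 0 y| <= B) ->
  `|rint (fun x => H p (coord ord0 x) * f x)| <= A * B.
Proof.
move=> sf cf; have [K cK f0] := cf; have [r r0 Hr] := compact_coord_bounded cK.
have sp := smooth_partials (nseq p ord0) sf.
have zp := partials_outside (nseq p ord0) cK f0.
have [M M0 HM] := compact_supp_bounded (smooth_continuous sp) (ex_intro2 _ _ K cK zp).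
have [A A0 HA] := rint_bound cK.
exists (A * M); first exact: mulr_ge0.
exists r => // H B dH B0 HB; rewrite rint_chain_parts//.
rewrite normrM normrX normrN1 expr1n mul1r -mulrA; apply: HA; first exact: mulr_ge0.
  by move=> x Kx; rewrite normrM mulrC ler_pM// HB// Hr.
by move=> x /zp ->; rewrite mulr0.
Qed.
End integration_by_parts.

(** * Truncated powers and oscillatory integrals *)

Section substitution.
Context {R : realType}.
Implicit Types (f : R -> R) (a b c d : R).

Lemma iint_scale a b c d f : 0 < c -> a <= b -> continuous f ->
  iint a b (fun t => f (c * t + d)) = c^-1 * iint (c * a + d) (c * b + d) f.
Proof.
move=> c0 ab cf; have cd : continuous (fun t => f (c * t + d)).
  move=> t; apply: (@continuous_comp _ _ _ (fun t => c * t + d) f); last exact: cf.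
  exact: derive_continuous (is_derive_affine c d t).
(* The base point of the primitive lies strictly below the whole range of c t + d, so that the
   primitive is differentiable at the left end too. *)
pose L := c * a + d - 1.
have Lt t : a <= t -> L < c * t + d.
  by move=> at_; rewrite /L ltrBlDr ltr_pwDr// lerD2r ler_pM2l.
have dF (t : R) : a <= t ->
    is_derive t 1 (fun t => c^-1 * iint L (c * t + d) f) (f (c * t + d)).
  move=> at_; have := is_derive_scalef c^-1 (is_derive_comp_affine
    (iint_derive_upper cf (Lt t at_))).
  by rewrite [_ * c]mulrC mulKf// gt_eqF.
rewrite (iint_FTC2 ab cd (fun t H => derive_continuous (dF t (andP H).1))
  (fun t H => dF t (ltW (andP H).1))).
rewrite -mulrBr (iint_chasles (a := L) (b := c * a + d) cf).
- by rewrite addrAC subrr add0r.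
- by rewrite ltW// Lt.
- by rewrite lerD2r ler_pM2l.
Qed.

Lemma iint_reflect a b d f : a <= b -> continuous f ->
  iint a b (fun t => f (d - t)) = iint (d - b) (d - a) f.
Proof.
move=> ab cf; have aff (t : R) : is_derive t 1 (fun t => d - t) (-1).
  have := is_derive_affine (-1) d t.
  by congr (is_derive _ _ _ _); apply/funext => u; rewrite mulN1r addrC.
have cd : continuous (fun t => f (d - t)).
  move=> t; apply: (@continuous_comp _ _ _ (fun t => d - t) f); last exact: cf.
  exact: derive_continuous (aff t).
pose L := d - b - 1.
have Lt t : t <= b -> L < d - t by move=> tb; rewrite /L; lra.
have dF (t : R) : t <= b -> is_derive t 1 (fun t => - iint L (d - t) f) (f (d - t)).
  move=> tb; have D := is_derive_scalef (-1) (@is_derive_compf _ (fun u => iint L u f) (fun t => d - t) t _ _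
    (iint_derive_upper cf (Lt t tb)) (aff t)).
  by apply: (is_derive_ext D) => [u|]; rewrite ?mulrN1 mulN1r ?opprK.
rewrite (iint_FTC2 ab cd (fun t H => derive_continuous (dF t (andP H).2))
  (fun t H => dF t (ltW (andP H).2))).
rewrite (iint_chasles (a := L) (b := d - b) (c := d - a) cf); first ring.
- by rewrite /L; lra.
- by lra.
Qed.
End substitution.

Section truncated_power.
Context {R : realType}.
Implicit Types (s t x y b theta : R).

(** Truncation at 0 makes the power continuous on all of R for s > 0, as the lemmas on segments ask
    for globally continuous integrands. *)
Definition tpow s t : R := Num.max 0 t `^ s.

Lemma tpow_ge0 s t : 0 <= tpow s t. Proof. exact: powR_ge0. Qed.

Lemma tpowE s t : 0 <= t -> tpow s t = t `^ s.
Proof. by move=> t0; rewrite /tpow max_r. Qed.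

Lemma tpow0 s t : s != 0 -> t <= 0 -> tpow s t = 0.
Proof. by move=> s0 t0; rewrite /tpow max_l// powR0. Qed.

Lemma tpow_continuous s : 0 < s -> continuous (tpow s).
Proof.
move=> s0 t; have sn0 : s != 0 by rewrite gt_eqF.
have [t0|t0|->] := ltgtP t 0.
- apply: (@cvg_trans _ ((fun=> 0 : R) @ t)).
    apply: near_eq_cvg; near=> u; rewrite tpow0// ltW//.
    by near: u; exact: lt_nbhsl.
  by rewrite tpow0// ?ltW//; exact: (@cst_continuous _ _ (0 : R) t).
- apply: (@cvg_trans _ ((fun u => u `^ s) @ t)).
    apply: near_eq_cvg; near=> u; rewrite tpowE// ltW//.
    by near: u; exact: lt_nbhsr.
  rewrite /continuous_at tpowE ?ltW//; exact: derive_continuous (is_derive1_powR s t0).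
- rewrite /continuous_at tpow0//; apply/cvgrPdist_le => e e0.
  have : \forall u \near 0^'+, `|0 - u `^ s| <= e.
    by have /cvgrPdist_le := powR_cvg0 s0; apply.
  move=> [r /= r0 Hr]; exists r => //= u ur.
  have [u0|u0] := leP u 0; first by rewrite tpow0// subrr normr0 ltW.
  by rewrite (tpowE s (ltW u0)); exact: Hr.
Unshelve. all: by end_near. Qed.

Lemma tpow_le s x y : 0 <= s -> x <= y -> tpow s x <= tpow s y.
Proof.
move=> s0 xy; apply: ge0_ler_powR => //; rewrite ?nnegrE ?[0 <= _]le_max ?lexx//.
by rewrite ge_max !le_max lexx xy orbT.
Qed.

Lemma tpowM s x y : 0 <= x -> tpow s (x * y) = x `^ s * tpow s y.
Proof.
move=> x0; rewrite /tpow -[in LHS](mulr0 x) -maxr_pMr// powRM// le_max lexx//.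
Qed.

Lemma tpow_is_derive s t : 0 < t -> is_derive t 1 (tpow s) (s * t `^ (s - 1)).
Proof.
move=> t0; have D := is_derive1_powR s t0; refine (near_eq_is_derive _ D).
near=> u; rewrite tpowE// ltW//; near: u; exact: lt_nbhsr.
Unshelve. all: by end_near. Qed.

Lemma tpow_leX s : exists N, forall x, 1 <= x -> tpow s x <= x ^+ N.
Proof.
exists (Num.truncn s).+1 => x x1; have x0 : 0 <= x by exact: le_trans x1.
by rewrite tpowE// -powR_mulrn// ler_powR// ltW// truncnS_gt.
Qed.

Lemma is_derive_cosf a c y : is_derive y 1 (fun y => cos (a * y + c)) (a * cos (a * y + c + pi / 2)).
Proof.
have := is_derive_comp_affine (is_derive_cos (a * y + c)).
by rewrite cosDpihalf mulrC.
Qed.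

(** Differentiating is multiplying by a and shifting the phase by pi/2; the converse shift yields
    p-fold primitives of size a^(-p). *)
Lemma cos_chain a c k : derivative_chain (fun n y => k * (a ^+ n * cos (a * y + c + n%:R * (pi / 2)))).
Proof.
move=> n y; have D := is_derive_scalef (k * a ^+ n) (is_derive_cosf a (c + n%:R * (pi / 2)) y).
apply: (is_derive_ext D) => [u|]; first by rewrite addrA -mulrA.
have -> : a * y + c + n.+1%:R * (pi / 2) = a * y + (c + n%:R * (pi / 2)) + pi / 2.
  by rewrite -natr1; ring.
by rewrite exprSr; ring.
Qed.

(** This is the n-th derivative in y of the integral over [a, b] of kappa(m) cos(m y + theta) dm. *)
Definition osc (kappa : R -> R) theta a b n y :=
  iint a b (fun m => kappa m * (m ^+ n * cos (m * y + theta + n%:R * (pi / 2)))).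

Lemma osc_continuous (kappa : R -> R) theta (n : nat) : continuous kappa ->
  continuous (fun p : R * R => kappa p.1 * (p.1 ^+ n * cos (p.1 * p.2 + theta + n%:R * (pi / 2)))).
Proof.
move=> ck; apply: continuousMf.
  by apply: continuous_compf => // p; exact: cvg_fst.
apply: continuousMf.
  by apply: (@continuous_compf _ _ _ (fun m : R => m ^+ n)) => p; [exact: exprn_continuous|exact: cvg_fst].
apply: (@continuous_compf _ _ _ cos); first exact: continuous_cos.
apply: continuousDf; last exact: cst_continuous.
apply: continuousDf; last exact: cst_continuous.
by apply: continuousMf => p; [exact: cvg_fst|exact: cvg_snd].
Qed.

Lemma osc_continuous1 (kappa : R -> R) theta (n : nat) y : continuous kappa ->
  continuous (fun m => kappa m * (m ^+ n * cos (m * y + theta + n%:R * (pi / 2)))).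
Proof.
move=> ck; apply: continuousMf => //; apply: continuousMf; first exact: exprn_continuous.
move=> m; have := derive_continuous (is_derive_cosf y (theta + n%:R * (pi / 2)) m).
by under [X in {for _, continuous X}]eq_fun do rewrite addrA [y * _]mulrC.
Qed.

Lemma osc_chain (kappa : R -> R) theta a b : continuous kappa -> derivative_chain (osc kappa theta a b).
Proof.
move=> ck n x.
apply: (@iint_derive _ (fun m y => kappa m * (m ^+ n * cos (m * y + theta + n%:R * (pi / 2))))
  (fun m y => kappa m * (m ^+ n.+1 * cos (m * y + theta + n.+1%:R * (pi / 2))))).
- move=> m y; have := cos_chain m theta (kappa m) n y.
  by [].
- by move=> y; exact: osc_continuous1.
- exact: osc_continuous.
Qed.

Lemma osc_bound (kappa : R -> R) theta a b n y B : a <= b -> continuous kappa ->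
  (forall m, a <= m <= b -> `|kappa m * m ^+ n| <= B) -> `|osc kappa theta a b n y| <= B * (b - a).
Proof.
move=> ab ck HB; apply: iint_bound => //; first exact: osc_continuous1.
move=> m /HB HBm; rewrite mulrA normrM (le_trans _ HBm)//.
by rewrite ler_piMr// cos_max.
Qed.

(** The truncation at frequency b of a divergent integral that is formally homogeneous of degree -(s
    + 1) in y. *)
Definition kfun s theta b y := osc (tpow s) theta 0 b 0 y.

Lemma kfunE s theta b y : kfun s theta b y = iint 0 b (fun m => tpow s m * cos (m * y + theta)).
Proof. by apply: eq_iint => m _; rewrite expr0 mul1r mul0r addr0. Qed.

Lemma kfun_integrand s theta y : 0 < s -> continuous (fun m => tpow s m * cos (m * y + theta)).
Proof.
move=> s0; have := @osc_continuous1 (tpow s) theta 0 y (tpow_continuous s0).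
by under eq_fun do rewrite expr0 mul1r mul0r addr0.
Qed.

Lemma kfun_scale s theta b l y : 0 < s -> 0 <= b -> 0 < l ->
  kfun s theta b (l * y) = l `^ (- (s + 1)) * kfun s theta (l * b) y.
Proof.
move=> s0 b0 l0; rewrite !kfunE.
have c := kfun_integrand (theta := theta) (y := y) s0.
have := @iint_scale R 0 b l 0 _ l0 b0 c.
rewrite mulr0 !addr0 => E.
rewrite powRN powRD ?(gt_eqF l0) ?implybT// powRr1 ?(ltW l0)// invfM -mulrA -E -iintZ//; last first.
  move=> m; apply: (@continuous_comp _ _ _ (fun t => l * t + 0) (fun m => tpow s m * cos (m * y + theta))).
    exact: derive_continuous (is_derive_affine l 0 m).
  exact: c.
apply: eq_iint => m /andP[m0 _]; rewrite addr0 tpowM ?(ltW l0)//.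
rewrite !mulrA mulVf ?mul1r; first by congr (_ * cos (_ + _)); ring.
by rewrite gt_eqF// powR_gt0.
Qed.

(** Integration by parts in m, as y cos(m y + theta) is the derivative in m of cos(m y + theta -
    pi/2). A factor y is thus exchanged for a unit of the exponent, up to a boundary term that
    oscillates at the single frequency b. *)
Lemma kfunM s theta b y : 0 < s -> 0 <= b ->
  y * kfun (s + 1) theta b y =
  tpow (s + 1) b * cos (b * y + theta - pi / 2) - (s + 1) * kfun s (theta - pi / 2) b y.
Proof.
move=> s0 b0; have s10 : 0 < s + 1 by rewrite addr_gt0.
rewrite !kfunE -!iintZ; try exact: kfun_integrand.
apply/eqP; rewrite eq_sym subr_eq eq_sym -iintD; last 2 first.
- by apply: continuousMf; [exact: cst_continuous|exact: kfun_integrand].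
- by apply: continuousMf; [exact: cst_continuous|exact: kfun_integrand].
pose F m := tpow (s + 1) m * cos (m * y + theta - pi / 2).
have cc : continuous (fun m : R => cos (m * y + theta - pi / 2)).
  move=> m; have := derive_continuous (is_derive_cosf y (theta - pi / 2) m).
  by under [X in {for _, continuous X}]eq_fun do rewrite addrA [y * _]mulrC.
have dF (m : R) : 0 < m -> is_derive m 1 F
    (y * (tpow (s + 1) m * cos (m * y + theta)) + (s + 1) * (tpow s m * cos (m * y + (theta - pi / 2)))).
  move=> m0; have dc : is_derive m 1 (fun m => cos (m * y + theta - pi / 2)) (y * cos (m * y + theta)).
    apply: (is_derive_ext (is_derive_cosf y (theta - pi / 2) m)) => [u|].
      by rewrite [y * u]mulrC addrA.
    by congr (_ * cos _); ring.
  apply: (is_derive_ext (is_derive_mulf (tpow_is_derive (s + 1) m0) dc)) => //.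
  by rewrite addrK -(tpowE s (ltW m0)) addrA; ring.
have cF : continuous F by apply: continuousMf; [exact: tpow_continuous|exact: cc].
have ci : continuous (fun m => y * (tpow (s + 1) m * cos (m * y + theta)) +
    (s + 1) * (tpow s m * cos (m * y + (theta - pi / 2)))).
  by apply: continuousDf; apply: continuousMf; try exact: cst_continuous; exact: kfun_integrand.
rewrite (iint_FTC2 b0 ci (fun m _ => cF m) (fun m H => dF m (andP H).1)).
by rewrite /F [tpow _ 0]tpow0 ?mul0r ?subr0// gt_eqF.
Qed.

Lemma normr_sin_le x : `|sin x| <= `|x|.
Proof.
wlog x0 : x / 0 <= x => [H|].
  have [/H//|/ltW x0] := leP 0 x.
  by rewrite -normrN -sinN -[leRHS]normrN; apply: H; rewrite oppr_ge0.
have [c _] := @MVT_segment R sin cos 0 x x0 (fun y _ => is_derive_sin y)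
   (continuous_subspaceT (@continuous_sin R)).
by rewrite sin0 !subr0 => ->; rewrite normrM ler_piMl// cos_max.
Qed.

Lemma one_minus_cos_le x : 1 - cos x <= x ^+ 2.
Proof.
have -> : 1 - cos x = 2 * sin (x / 2) ^+ 2.
  have {1}-> : x = x / 2 + x / 2 by rewrite -splitr.
  by rewrite cosD; have := cos2Dsin2 (x / 2); rewrite !expr2; lra.
have := normr_sin_le (x / 2); rewrite -ler_sqr ?nnegrE// !real_normK ?num_real//.
rewrite exprMn; have := sqr_ge0 x; lra.
Qed.

(* The difference of both sides is nondecreasing in [b] and tends to 0 with [b]. *)
Lemma kfun_le s b y : 0 < s <= 1 -> 0 < b ->
  y ^+ 2 * kfun s 0 b y <= y * b `^ s * sin (b * y) - s * b `^ (s - 1) * (1 - cos (b * y)).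
Proof.
move=> /andP[s0 s1] b0.
pose T b := y * b `^ s * sin (b * y) - s * b `^ (s - 1) * (1 - cos (b * y)) - y ^+ 2 * kfun s 0 b y.
suff : 0 <= T b by rewrite /T subr_ge0.
have dsin (u : R) : is_derive u 1 (fun u => sin (u * y)) (y * cos (u * y)).
  apply: (is_derive_ext (is_derive_comp_affine (is_derive_sin (y * u + 0)))) => [v|].
    by rewrite addr0 mulrC.
  by rewrite addr0 [y * u]mulrC; ring.
have dcos (u : R) : is_derive u 1 (fun u => 1 - cos (u * y)) (y * sin (u * y)).
  apply: (is_derive_ext (is_derive_addf (is_derive_cst (1 : R) u 1) (is_derive_scalef (-1)
     (is_derive_comp_affine (is_derive_cos (y * u + 0)))))) => [v|].
    by rewrite addr0 [y * v]mulrC mulN1r.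
  by rewrite addr0 [y * u]mulrC; ring.
(* The contribution of [kfun] and those of the sine cancel out. What remains is nonnegative because
   s <= 1. *)
have dT (u : R) : 0 < u -> is_derive u 1 T (s * (1 - s) * u `^ (s - 2) * (1 - cos (u * y))).
  move=> u0; have ck := @kfun_integrand s 0 y s0.
  have d1 := is_derive_mulf (is_derive_scalef y (is_derive1_powR s u0)) (dsin u).
  have d2 := is_derive_mulf (is_derive_scalef s (is_derive1_powR (s - 1) u0)) (dcos u).
  have d3 := is_derive_scalef (y ^+ 2) (iint_derive_upper ck u0).
  have := is_derive_addf d1 (is_derive_addf (is_derive_scalef (-1) d2) (is_derive_scalef (-1) d3)).
  have -> : s - 1 - 1 = s - 2 by ring.
  rewrite (tpowE s (ltW u0)) [u * y + 0]addr0 => D.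
  apply: (is_derive_ext D) => [v|]; last ring.
  by rewrite /T kfunE; ring.
(* Each of the three terms of T lowers [T d] by at most y^2 d^(s+1), which tends to 0 with d. *)
have T0 d : 0 < d -> d < b -> - (3 * y ^+ 2 * (d * d `^ s)) <= T b.
  move=> d0 db; apply: (@le_trans _ _ (T d)); last first.
    have cT u : `[d, b]%classic u -> {for u, continuous T}.
      rewrite /= in_itv/= => /andP[du _]; exact: derive_continuous (dT u (lt_le_trans d0 du)).
    have := @ger0_derive1_le_cc R T d b.
    move=> H; apply: H; rewrite ?in_itv/= ?lexx ?ltW//.
    - move=> u; rewrite in_itv/= => /andP[du _].
      by case: (dT u (lt_trans d0 du)).
    - move=> u; rewrite in_itv/= => /andP[du _]; rewrite derive1E.
      case: (dT u (lt_trans d0 du)) => _ ->.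
      by rewrite !mulr_ge0 ?powR_ge0 ?subr_ge0 ?cos_le1// ltW.
    - by apply: continuous_in_subspaceT => u; rewrite inE; exact: cT.
  have ds : d * d `^ (s - 1) = d `^ s by rewrite mulr_powRB1// ltW.
  have k1 : `|kfun s 0 d y| <= d `^ s * (d - 0).
    apply: osc_bound; rewrite ?(ltW d0)//; first exact: tpow_continuous.
    move=> m /andP[m0 md]; rewrite expr0 mulr1 ger0_norm ?tpow_ge0//.
    by rewrite -(tpowE s (ltW d0)) tpow_le// ltW.
  have h1 : `|y * d `^ s * sin (d * y)| <= y ^+ 2 * (d * d `^ s).
    rewrite normrM normrM (ger0_norm (powR_ge0 _ _)).
    have -> : y ^+ 2 * (d * d `^ s) = `|y| * d `^ s * `|d * y|.
      rewrite normrM (gtr0_norm d0) -[y ^+ 2]real_normK ?num_real//; ring.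
    by rewrite ler_wpM2l ?normr_sin_le// mulr_ge0// powR_ge0.
  have h2 : s * d `^ (s - 1) * (1 - cos (d * y)) <= y ^+ 2 * (d * d `^ s).
    apply: (@le_trans _ _ (1 * d `^ (s - 1) * (d * y) ^+ 2)).
      apply: ler_pM.
      - by rewrite mulr_ge0 ?powR_ge0// ltW.
      - by rewrite subr_ge0 cos_le1.
      - by rewrite ler_wpM2r ?powR_ge0.
      - exact: one_minus_cos_le.
    by rewrite -ds exprMn le_eqVlt; apply/orP; left; apply/eqP; ring.
  have h3 : y ^+ 2 * kfun s 0 d y <= y ^+ 2 * (d * d `^ s).
    rewrite ler_wpM2l ?sqr_ge0//; move: k1; rewrite subr0 ler_norml => /andP[_].
    by rewrite [d * _]mulrC.
  move: h1; rewrite ler_norml => /andP[h1 _]; rewrite /T; lra.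
apply/ler_addgt0Pr => e e0.
have cv : (fun d => 3 * y ^+ 2 * (d * tpow s d)) @ (0 : R) --> 3 * y ^+ 2 * (0 * tpow s 0).
  have : continuous (fun d : R => 3 * y ^+ 2 * (d * tpow s d)); last by apply.
  apply: continuousMf; first exact: cst_continuous.
  by apply: continuousMf; [move=> ?; exact: cvg_id|exact: tpow_continuous].
move/cvgrPdist_le : cv => /(_ _ e0)[r /= r0 Hr].
pose d := Num.min (r / 2) (b / 2).
have d0 : 0 < d by rewrite lt_min !divr_gt0.
have dr : d < r by rewrite gt_min ltr_pdivrMr// ltr_pMr// ltr1n.
have db : d < b by rewrite gt_min [b / 2 < b]ltr_pdivrMr// ltr_pMr// ltr1n orbT.
have := T0 d d0 db.
have := Hr d; rewrite /= sub0r normrN gtr0_norm// => /(_ dr).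
rewrite mul0r mulr0 sub0r normrN tpowE ?(ltW d0)// ler_norml => /andP[_]; lra.
Qed.
End truncated_power.

(** * Representatives and pairings *)

Section representatives.
Context {R : realType} {d : nat}.
Local Notation E := 'rV[R]_d.
Local Notation Rd := (Rd R d).
Local Notation net := (@net R d).
Implicit Types (u v : net).

Lemma gnum_class_eqP (c c' : R -> R[i]) (mc : gnum_moderate c) (mc' : gnum_moderate c') :
  gnum_class mc = gnum_class mc' <-> gnum_negligible (fun e => c e - c' e).
Proof.
rewrite /gnum_class; set x := GnumNet _; set y := GnumNet _.
have E2 : gnum_negligible (fun e => c e - c' e) <-> x - y \in @gnum_negligible_pred R.
  by split=> [H|/asboolP//]; apply/asboolP.
rewrite E2 Quotient.idealrBE; split=> [/eqP//|/eqP//].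
Qed.

Lemma gnum_negligible_ext (c c' : R -> R[i]) : (\forall e \near 0^'+, c e = c' e) ->
  gnum_negligible c -> gnum_negligible c'.
Proof.
move=> cc H p; have [M HM] := H p; exists M; near=> e.
have <- : c e = c' e by near: e.
by near: e.
Unshelve. all: by end_near. Qed.

Lemma repr_class_negligible (U : openset R d) (u : moderate_net U) :
  negligible_net U (net_of (repr (colombeau_class u)) - net_of u).
Proof. by apply/colombeau_eqP; rewrite /colombeau_class reprK. Qed.

Lemma negligible_dilate (l : R) u : negligible_net setT u ->
  negligible_net setT (fun e x => u e (l *: x)).
Proof.
move=> [su mu]; have E1 e : (fun x => u e (l *: x)) = (fun x => u e (l *: x + 0)).
  by apply/funext => x; rewrite addr0.
split=> [e e01|K cK _ beta m].
  by rewrite E1; exact: (csmooth_affine l 0 (su e e01)).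
have cK' : compact ((fun x : E => l *: x) @` K).
  apply: continuous_compact => //; apply: continuous_subspaceT => x.
  by apply: continuousZ; [exact: cst_continuous|exact: cvg_id].
have [M HM] := mu _ cK' (@subsetT _ _) beta m.
exists (`|l ^+ size (mi_word beta)| * M); near=> e => x Kx.
have e01 : 0 < e <= 1 by near: e; exact: near01.
rewrite E1 /mderiv (cpartials_affine _ _ _ _ (su e e01)) Normc.normcM modcR.
rewrite -mulrA ler_wpM2l// addr0.
have : forall y, ((fun x : E => l *: x) @` K) y -> modc (mderiv beta (u e) y) <= M * e ^+ m.
  by near: e.
by apply; exists x.
Unshelve. all: by end_near. Qed.

Lemma negligible_scale (U : openset R d) (c : R[i]) u : negligible_net U u ->
  negligible_net U (fun e x => c * u e x).
Proof.
move=> [su mu]; split=> [e e01|K cK KU beta m].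
  by apply: csmoothM; [exact: oset_open|exact: csmooth_cst|exact: su].
have [M HM] := mu _ cK KU beta m.
exists (modc c * M); near=> e => x Kx.
have e01 : 0 < e <= 1 by near: e; exact: near01.
rewrite /mderiv (cpartialsZ _ _ (oset_open U) (su e e01) (KU _ Kx)) Normc.normcM.
rewrite -mulrA ler_wpM2l ?modc_ge0//; move: x Kx; near: e; exact: HM.
Unshelve. all: by end_near. Qed.

Lemma negligible_restrict (U V : set E) u : V `<=` U -> negligible_net U u -> negligible_net V u.
Proof.
move=> VU [su mu]; split=> [e e01|K cK KV beta]; first exact: (sub_csmooth VU (su e e01)).
by apply: mu => //; exact: subset_trans VU.
Qed.

(** The operations on classes are defined through the representative chosen by [repr]; this lemma
    and its analogues for [gscale], [grestrict] and [gpairing] allow an explicit one. *)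
Lemma gdilate_class (l : R) (u : moderate_net Rd) :
  gdilate l (colombeau_class u) =
  colombeau_class (to_moderate (U := Rd) (dilate_moderate l (moderate_netP u))).
Proof.
apply/colombeau_eqP; have H := repr_class_negligible u.
exact: (negligible_dilate l H).
Qed.

Lemma gscale_class (U : openset R d) (c : R[i]) (u : moderate_net U) :
  gscale c (colombeau_class u) = colombeau_class (to_moderate (scale_moderate c (moderate_netP u))).
Proof.
apply/colombeau_eqP; have H := repr_class_negligible u.
have := negligible_scale c H; congr (negligible_net _ _).
by apply/funext => e; apply/funext => x; rewrite /= mulrBr.
Qed.

Lemma grestrict_class (V : openset R d) (u : moderate_net Rd) :
  grestrict V (colombeau_class u) =
  colombeau_class (to_moderate (restrict_moderate (@subsetT _ V) (moderate_netP u))).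
Proof.
apply/colombeau_eqP; have H := repr_class_negligible u.
exact: (negligible_restrict (@subsetT _ V) H).
Qed.

Lemma homogeneous_classP (alpha : R) (u : moderate_net Rd) :
  homogeneous alpha (colombeau_class u) <->
  forall l : R, 0 < l ->
    negligible_net Rd (fun e x => net_of u e (l *: x) - (l `^ alpha)%:C * net_of u e x).
Proof.
split=> H l l0.
  by have := H l l0; rewrite gdilate_class gscale_class => /colombeau_eqP.
by rewrite gdilate_class gscale_class; apply/colombeau_eqP; exact: H.
Qed.

Lemma cintegralE (f : E -> R[i]) :
  cintegral f = rint (fun x => complex.Re (f x)) +i* rint (fun x => complex.Im (f x)).
Proof. by []. Qed.

Definition ccompact (f : E -> R[i]) :=
  [/\ continuous (fun x => complex.Re (f x)), continuous (fun x => complex.Im (f x)),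
      compactly_supported (fun x => complex.Re (f x)) &
      compactly_supported (fun x => complex.Im (f x))].

Lemma cintegralB (f g : E -> R[i]) : ccompact f -> ccompact g ->
  cintegral (fun x => f x - g x) = cintegral f - cintegral g.
Proof.
move=> [f1 f2 f3 f4] [g1 g2 g3 g4]; rewrite !cintegralE.
have sN (h : E -> R) : compactly_supported h -> compactly_supported (fun x => -1 * h x).
  exact: (@compactly_supportedMr _ _ (fun=> -1)).
have cN (h : E -> R) : continuous h -> continuous (fun x => -1 * h x).
  by apply: continuousMf; exact: cst_continuous.
have aux (p q : E -> R) : continuous p -> compactly_supported p ->
    continuous q -> compactly_supported q -> rint (fun x => 1 * p x + -1 * q x) = rint p - rint q.
  move=> cp sp cq sq; under [X in rint X]eq_fun do rewrite mul1r.
  by rewrite rintD//; [rewrite rintZ// mulN1r|exact: cN|exact: sN].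
under [X in rint X]eq_fun do rewrite ReBc.
under [X in _ +i* rint X]eq_fun do rewrite ImBc.
by rewrite !aux.
Qed.

Lemma csmooth_pairing_ccompact (f : E -> R[i]) (phi : test_function) :
  csmooth_on setT f -> ccompact (fun x => f x * phi x).
Proof.
move=> sf; have [K cK phi0] := test_supp phi.
have [c1 c2] := csmooth_continuous (csmoothM (@openT _) sf (test_smooth phi)).
by split=> //; exists K => // x /phi0 ->; rewrite mulr0.
Qed.

Lemma pairing_negligible u (phi : test_function) : negligible_net setT u ->
  gnum_negligible (fun e => cintegral (fun x => u e x * phi x)).
Proof.
move=> [su mu] m; have [K cK phiN] := test_supp phi.
have [A A0 HA] := cintegral_bound cK.
have [P P0 HP] := csmooth_bounded cK (test_smooth phi).
have [M HM] := mu K cK (@subsetT _ _) [ffun=> 0%N] m.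
exists (A * (`|M| * P)); near=> e.
have e01 : 0 < e <= 1 by near: e; exact: near01.
have eN : 0 <= e ^+ m by rewrite exprn_ge0//; case/andP: e01 => /ltW.
rewrite -mulrA; apply: HA.
- by rewrite mulr_ge0// mulr_ge0.
- move=> x Kx; rewrite Normc.normcM mulrAC ler_pM ?modc_ge0//; last exact: HP.
  apply: le_trans (ler_wpM2r eN (ler_norm M)).
  rewrite -[X in modc (X x)]mderiv_order0.
  by move: x Kx; near: e; exact: HM.
- by move=> x /phiN ->; rewrite mulr0.
Unshelve. all: by end_near. Qed.

Lemma pairing_congr u v (phi : test_function) : smooth_net setT u -> smooth_net setT v ->
  negligible_net setT (u - v) ->
  gnum_negligible (fun e => cintegral (fun x => u e x * phi x) - cintegral (fun x => v e x * phi x)).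
Proof.
move=> su sv /(pairing_negligible phi); apply: gnum_negligible_ext; near=> e.
have e01 : 0 < e <= 1 by near: e; exact: near01.
rewrite -cintegralB; [|exact: csmooth_pairing_ccompact (su e e01)|exact: csmooth_pairing_ccompact (sv e e01)].
by congr cintegral; apply/funext => x; rewrite -mulrBl.
Unshelve. all: by end_near. Qed.

Lemma gpairing_class (u : moderate_net Rd) (phi : test_function) :
  gpairing (colombeau_class u) phi = gnum_class (pairing_moderate phi (moderate_netP u)).
Proof.
apply/gnum_class_eqP.
have [s1 _] := moderate_netP (repr (colombeau_class u)); have [s2 _] := moderate_netP u.
exact: (pairing_congr phi s1 s2 (repr_class_negligible u)).
Qed.

Lemma weakly_homogeneous_class (alpha : R) (u : moderate_net Rd) :
  (forall (l : R) (phi : test_function), 0 < l ->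
    gnum_negligible (fun e => cintegral (fun x => (net_of u e (l *: x) - (l `^ alpha)%:C * net_of u e x) * phi x))) ->
  weakly_homogeneous alpha (colombeau_class u).
Proof.
move=> H l phi l0; rewrite gdilate_class gscale_class !gpairing_class.
apply/gnum_class_eqP; apply: gnum_negligible_ext (H l phi l0); near=> e.
have e01 : 0 < e <= 1 by near: e; exact: near01.
have [su _] := moderate_netP u.
have sl : csmooth_on setT (fun x => net_of u e (l *: x)).
  by have := csmooth_affine l 0 (su e e01); under [X in csmooth_on _ X]eq_fun do rewrite addr0.
have sc : csmooth_on setT (fun x => (l `^ alpha)%:C * net_of u e x).
  by apply: csmoothM; [exact: openT|exact: csmooth_cst|exact: su].
rewrite /= -cintegralB; [|exact: csmooth_pairing_ccompact sl|exact: csmooth_pairing_ccompact sc].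
by congr cintegral; apply/funext => x; rewrite -mulrBl.
Unshelve. all: by end_near. Qed.

Lemma real_pairing (f : E -> R) (phi : E -> R[i]) :
  cintegral (fun x => (f x)%:C * phi x) =
  rint (fun x => f x * complex.Re (phi x)) +i* rint (fun x => f x * complex.Im (phi x)).
Proof.
rewrite cintegralE; apply: f_equal2; congr rint; apply/funext => x.
  by rewrite ReMc /= oppr0 mul0r addr0.
by rewrite ImMc /= mul0r addr0.
Qed.

Lemma test_Re (phi : @test_function R d) : smooth_on setT (fun x => complex.Re (phi x)) /\
  compactly_supported (fun x => complex.Re (phi x)).
Proof.
split; first by have [] := test_smooth phi.
by have [K cK H] := test_supp phi; exists K => // x /H ->.
Qed.

Lemma test_Im (phi : @test_function R d) : smooth_on setT (fun x => complex.Im (phi x)) /\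
  compactly_supported (fun x => complex.Im (phi x)).
Proof.
split; first by have [] := test_smooth phi.
by have [K cK H] := test_supp phi; exists K => // x /H ->.
Qed.

Lemma weakly_homogeneous_real (alpha : R) (u : moderate_net Rd) (v : R -> E -> R) :
  (forall e x, net_of u e x = (v e x)%:C) ->
  (forall (l : R) (f : E -> R) (p : nat), 0 < l -> smooth_on setT f -> compactly_supported f ->
    exists M : R, \forall e \near 0^'+,
      `|rint (fun x => (v e (l *: x) - l `^ alpha * v e x) * f x)| <= M * e ^+ p) ->
  weakly_homogeneous alpha (colombeau_class u).
Proof.
move=> uv H; apply: weakly_homogeneous_class => l phi l0 p.
have [s1 c1] := test_Re phi; have [s2 c2] := test_Im phi.
have [M1 H1] := H l _ p l0 s1 c1; have [M2 H2] := H l _ p l0 s2 c2.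
exists (M1 + M2); near=> e.
have -> : (fun x => (net_of u e (l *: x) - (l `^ alpha)%:C * net_of u e x) * phi x) =
    (fun x => (v e (l *: x) - l `^ alpha * v e x)%:C * phi x).
  by apply/funext => x; rewrite !uv rmorphB rmorphM.
rewrite real_pairing (le_trans (modc_le _))// mulrDl lerD//; by near: e.
Unshelve. all: by end_near. Qed.
End representatives.

(** * Oscillating nets *)

Section one_variable_nets.
Context {R : realType} {d : nat}.
Local Notation E := 'rV[R]_d.+1.
Local Notation Rd := (Rd R d.+1).
Local Notation x0 := (@coord R d.+1 ord0).

Lemma partials_chain0 (H : nat -> R -> R) s (x : E) : derivative_chain H ->
  partials s (fun x => H 0%N (x0 x)) x = (all (pred1 ord0) s)%:R * H (size s) (x0 x).
Proof.
elim: s H => [|i s IH] H dH /=; first by rewrite mul1r.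
rewrite partial_chain_coord//.
have dH' : derivative_chain (fun n y => (i == ord0)%:R * H n.+1 y).
  by move=> n y; exact: is_derive_scalef (dH n.+1 y).
by rewrite (IH _ dH') mulrA -natrM mulnb andbC.
Qed.

(** One-variable moderateness, uniform on bounded sets: for a net of functions of x_0 alone, a
    partial derivative is either 0 or a member of the chain. *)
Definition moderate_family (H : R -> nat -> R -> R) :=
  (forall e, 0 < e <= 1 -> derivative_chain (H e)) /\
  forall n r, exists N M, \forall e \near 0^'+, forall y, `|y| <= r -> `|H e n y| <= M * e ^- N.

Lemma moderate_family_net (H : R -> nat -> R -> R) : moderate_family H ->
  moderate setT (fun e (x : E) => (H e 0%N (x0 x))%:C).
Proof.
move=> [dH HM]; split=> [e e01|K cK _ beta].
  split; last exact: smooth_cst.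
  exact: (@smooth_chain_coord R d setT (H e) 0 ord0 (@openT _) (dH e e01)).
have [r r0 Hr] := compact_coord_bounded cK.
have [N [M H1]] := HM (size (mi_word beta)) r.
exists N, M; near=> e => x Kx.
have e01 : 0 < e <= 1 by near: e; exact: near01.
rewrite /mderiv /cpartials /=.
have -> : partials (mi_word beta) (fun=> 0 : R) x = 0.
  elim: (mi_word beta) => //= i s IH; rewrite (_ : partial i (fun=> 0) = fun=> 0)//.
  by apply/funext => y; rewrite /partial (@derive_cst R _ _ (0 : R)).
rewrite partials_chain0; last exact: dH.
rewrite expr0n addr0 sqrtr_sqr normrM.
have : `|H e (size (mi_word beta)) (x0 x)| <= M * e ^- N.
  have : forall y, `|y| <= r -> `|H e (size (mi_word beta)) y| <= M * e ^- N by near: e.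
  by apply; exact: Hr.
apply: le_trans; rewrite ler_piMl//.
by rewrite normr_nat; case: (all _ _).
Unshelve. all: by end_near. Qed.

(** Leibniz rule for the n-th derivative of y H(y). At n = 0 the meaningless [H n.-1] is multiplied
    by 0. Iterating m times multiplies by y^m. *)
Definition chain_mulX (H : nat -> R -> R) n y := y * H n y + n%:R * H n.-1 y.

Lemma chain_mulX_chain H : derivative_chain H -> derivative_chain (chain_mulX H).
Proof.
move=> dH n y.
have D1 := is_derive_mulf (is_derive_id y 1) (dH n y).
case: n D1 => [|n] D1.
  apply: (is_derive_ext D1) => [u|]; rewrite /chain_mulX /=; first by rewrite mul0r addr0.
  by rewrite mulr1 mul1r.
have D2 := is_derive_scalef n.+1%:R (dH n y).
apply: (is_derive_ext (is_derive_addf D1 D2)) => // ; rewrite /chain_mulX /=.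
by rewrite -[n.+2%:R]natr1; ring.
Qed.

Lemma moderate_family_mulX H : moderate_family H -> moderate_family (fun e => chain_mulX (H e)).
Proof.
move=> [dH HM]; split=> [e e01|n r]; first exact/chain_mulX_chain/dH.
have [N1 [M1 H1]] := HM n r; have [N2 [M2 H2]] := HM n.-1 r.
exists (N1 + N2)%N, (`|r| * `|M1| + n%:R * `|M2|); near=> e => y yr.
have e01 : 0 < e <= 1 by near: e; exact: near01.
have e0 : 0 <= e by case/andP: e01 => /ltW.
have b1 : `|H e n y| <= M1 * e ^- N1.
  have : forall y, `|y| <= r -> `|H e n y| <= M1 * e ^- N1 by near: e.
  exact.
have b2 : `|H e n.-1 y| <= M2 * e ^- N2.
  have : forall y, `|y| <= r -> `|H e n.-1 y| <= M2 * e ^- N2 by near: e.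
  exact.
have aux M N N' (h : R) : (N <= N')%N -> h <= M * e ^- N -> h <= `|M| * e ^- N'.
  move=> NN'; move/le_trans; apply; apply: (@le_trans _ _ (`|M| * e ^- N)).
    by rewrite ler_wpM2r ?ler_norm// invr_ge0 exprn_ge0.
  by rewrite ler_wpM2l// ler_expN.
rewrite /chain_mulX (le_trans (ler_normD _ _))// mulrDl lerD//.
  rewrite normrM -mulrA ler_pM//; first by rewrite (le_trans yr)// ler_norm.
  by apply: aux b1; rewrite leq_addr.
rewrite normrM normr_nat -mulrA ler_wpM2l//.
by apply: aux b2; rewrite leq_addl.
Unshelve. all: by end_near. Qed.

Lemma iter_chain_mulX0 m H y : iter m chain_mulX H 0%N y = y ^+ m * H 0%N y.
Proof.
elim: m => [|m IH]; first by rewrite mul1r.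
by rewrite iterS /chain_mulX mul0r addr0 IH exprS mulrA.
Qed.

Lemma moderate_family_iter m H : moderate_family H -> moderate_family (fun e => iter m chain_mulX (H e)).
Proof. by move=> mH; elim: m => //= m IH; exact: moderate_family_mulX IH. Qed.

(** The cosine is the p-th derivative of a^(-p) times a cosine with phase theta - p pi/2, and
    [rint_chain_bound] moves these p derivatives to f. *)
Lemma riemann_lebesgue (f : E -> R) p : smooth_on setT f -> compactly_supported f ->
  exists2 A : R, 0 <= A & forall a theta, 0 < a ->
    `|rint (fun x => cos (a * x0 x + theta) * f x)| <= A * a ^- p.
Proof.
move=> sf cf; have [A A0 [r r0 HA]] := rint_chain_bound p sf cf.
exists A => // a theta a0.
pose H n y := a ^- p * (a ^+ n * cos (a * y + (theta - p%:R * (pi / 2)) + n%:R * (pi / 2))).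
have dH : derivative_chain H by exact: cos_chain.
have ap : 0 <= a ^- p by rewrite invr_ge0 exprn_ge0// ltW.
have := HA H (a ^- p) dH ap; rewrite (_ : (fun x => H p (x0 x) * f x) =
    (fun x => cos (a * x0 x + theta) * f x)); last first.
  apply/funext => x; rewrite /H mulKf ?expf_neq0 ?gt_eqF//.
  by congr (cos _ * _); ring.
by apply=> y _; rewrite /H expr0 mul1r normrM ger0_norm// ler_piMr// cos_max.
Qed.

(** Only frequencies in [b1, b2] remain in the difference. Since they stay away from 0, dividing the
    weight m^s by m^p gives a p-fold primitive in y, bounded by b2^s b1^(-p) times the length of the
    interval. *)
Lemma kfun_increment (f : E -> R) s p : 0 < s -> smooth_on setT f -> compactly_supported f ->
  exists2 A : R, 0 <= A & forall theta b1 b2, 0 < b1 <= b2 ->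
    `|rint (fun x => (kfun s theta b2 (x0 x) - kfun s theta b1 (x0 x)) * f x)| <=
    A * (tpow s b2 * b1 ^- p * b2).
Proof.
move=> s0 sf cf; have [A A0 [r r0 HA]] := rint_chain_bound p sf cf.
exists A => // theta b1 b2 /andP[b10 b12].
(* The function w equals m on [b1, b2] and never falls below b1 > 0, so that the weight m^s / w(m)^p
   is continuous on all of R. *)
pose w m := b1 + tpow 1 (m - b1).
have w_gt0 m : 0 < w m by rewrite ltr_pwDl// tpow_ge0.
have wE m : b1 <= m -> w m = m.
  by move=> bm; rewrite /w tpowE ?subr_ge0// powRr1 ?subr_ge0// addrC subrK.
have cw : continuous w.
  apply: continuousDf; first exact: cst_continuous.
  apply: (@continuous_compf _ _ _ (tpow 1)); first exact: tpow_continuous.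
  by apply: continuousDf; [move=> ?; exact: cvg_id|exact: cst_continuous].
pose kappa m := tpow s m * (w m)^-1 ^+ p.
have ck : continuous kappa.
  apply: continuousMf; first exact: tpow_continuous.
  apply: (@continuous_compf _ _ _ (fun u : R => u ^+ p)); first exact: exprn_continuous.
  by move=> m; apply: continuousV; [rewrite gt_eqF|exact: cw].
have dH : derivative_chain (osc kappa (theta - p%:R * (pi / 2)) b1 b2) by exact: osc_chain.
have b20 : 0 < b2 by exact: lt_le_trans b12.
have B0 : 0 <= tpow s b2 * b1 ^- p * b2.
  by rewrite !mulr_ge0 ?tpow_ge0 ?invr_ge0 ?exprn_ge0// ltW.
have := HA _ _ dH B0.
rewrite (_ : (fun x => osc _ _ _ _ _ _ * _) = (fun x =>
   (kfun s theta b2 (x0 x) - kfun s theta b1 (x0 x)) * f x)); last first.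
  apply/funext => x; congr (_ * _).
  have ci := @kfun_integrand R s theta (x0 x) s0.
  rewrite !kfunE (iint_chasles ci (ltW b10) b12) addrAC subrr add0r.
  apply: eq_iint => m /andP[b1m _]; rewrite /kappa wE//.
  have m0 : 0 < m by exact: lt_le_trans b1m.
  rewrite -mulrA [_^-1 ^+ p * _]mulrA -exprMn mulVf ?gt_eqF// expr1n mul1r.
  by congr (_ * cos _); ring.
apply=> y _.
have kb m : b1 <= m <= b2 -> `|kappa m * m ^+ 0| <= tpow s b2 * b1 ^- p.
  move=> /andP[b1m mb2]; rewrite expr0 mulr1 /kappa wE// normrM !ger0_norm ?tpow_ge0//; last first.
    by rewrite exprn_ge0// invr_ge0 (le_trans (ltW b10)).
  rewrite ler_pM ?tpow_ge0//; first by rewrite exprn_ge0// invr_ge0 (le_trans (ltW b10)).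
    by rewrite tpow_le// ltW.
  have m0 : 0 < m by exact: lt_le_trans b1m.
  by rewrite exprVn lef_pV2 ?posrE ?exprn_gt0// lerXn2r// nnegrE ltW.
apply: (le_trans (osc_bound _ y b12 ck kb)).
apply: ler_wpM2l; last by rewrite gerBl ltW.
by rewrite mulr_ge0 ?tpow_ge0// invr_ge0 exprn_ge0// ltW.
Qed.
End one_variable_nets.

Section plane_wave.
Context {R : realType} {d : nat}.
Local Notation E := 'rV[R]_d.+1.
Local Notation Rd := (Rd R d.+1).
Local Notation x0 := (@coord R d.+1 ord0).

Definition wave_family (e : R) n y := 1 * (e^-1 ^+ n * cos (e^-1 * y + 0 + n%:R * (pi / 2))).

Lemma moderate_wave_family : moderate_family wave_family.
Proof.
split=> [e _|n r]; first exact: cos_chain.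
exists n, 1; near=> e => y _; rewrite /wave_family !mul1r normrM.
have e0 : 0 < e by near: e; exact: nbhs_right_gt.
by rewrite exprVn ger0_norm ?invr_ge0 ?exprn_ge0 ?(ltW e0)// ler_piMr ?cos_max// invr_ge0 exprn_ge0// ltW.
Unshelve. all: by end_near. Qed.

Definition wave_net : moderate_net Rd :=
  to_moderate (U := Rd) (moderate_family_net (d := d) moderate_wave_family).

Lemma wave_netE e x : net_of wave_net e x = (cos (e^-1 * x0 x))%:C.
Proof. by rewrite /= /wave_family mul1r expr0 mul1r mul0r !addr0. Qed.

Lemma wave_weakly_homogeneous alpha : weakly_homogeneous alpha (colombeau_class wave_net).
Proof.
apply: (weakly_homogeneous_real wave_netE) => l f p l0 sf cf.
have [A A0 HA] := riemann_lebesgue p sf cf.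
exists (A * l ^- p + l `^ alpha * A); near=> e.
have e0 : 0 < e by near: e; exact: nbhs_right_gt.
have cc a : continuous (fun x : E => cos (a * x0 x + 0) * f x).
  apply: continuousMf; last exact: smooth_continuous.
  apply: (@continuous_compf _ _ _ cos); first exact: continuous_cos.
  apply: continuousDf; last exact: cst_continuous.
  by apply: continuousMf; [exact: cst_continuous|exact: coord_continuous].
have sc a : compactly_supported (fun x : E => cos (a * x0 x + 0) * f x).
  exact: compactly_supportedMr.
have -> : (fun x => (cos (e^-1 * x0 (l *: x)) - l `^ alpha * cos (e^-1 * x0 x)) * f x) =
   (fun x => cos (e^-1 * l * x0 x + 0) * f x + (- l `^ alpha) * (cos (e^-1 * x0 x + 0) * f x)).
  apply/funext => x; rewrite !addr0 /coord mxE mulrA; ring.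
rewrite rintD//; last 2 first.
- by apply: continuousMf; [exact: cst_continuous|exact: cc].
- exact: (@compactly_supportedMr _ _ (fun=> - l `^ alpha)).
rewrite rintZ// (le_trans (ler_normD _ _))// mulrDl lerD//.
  have := HA (e^-1 * l) 0; rewrite mulr_gt0 ?invr_gt0// => /(_ isT).
  by rewrite exprMn invfM exprVn invrK [_ * l ^- p]mulrC mulrA.
rewrite normrM normrN (ger0_norm (powR_ge0 _ _)) -[leRHS]mulrA ler_wpM2l ?powR_ge0//.
by have := HA e^-1 0; rewrite invr_gt0 e0 exprVn invrK; apply.
Unshelve. all: by end_near. Qed.

(** At the points eps (pi/2) e_0 the cosine vanishes, while at their doubles it is -1. For l = 2 the
    defect thus has modulus 1 at points that remain in the compact segment [0, 2] e_0. *)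
Lemma wave_not_homogeneous alpha : ~ homogeneous alpha (colombeau_class wave_net).
Proof.
move=> /homogeneous_classP/(_ 2 ltac:(by []))[_].
pose line (t : R) : E := t *: delta_mx 0 ord0.
have cline : continuous line.
  by move=> t; apply: continuousZ; [exact: cvg_id|exact: cst_continuous].
have cK : compact (line @` `[0, 2]%classic).
  apply: continuous_compact; last exact: segment_compact.
  exact: continuous_subspaceT.
move=> /(_ _ cK (@subsetT _ _) [ffun=> 0%N] 1%N)[M HM].
suff : \forall e \near (0 : R)^'+, False by move=> /filter_ex[].
near=> e.
have /andP[e0 e1] : 0 < e <= 1 by near: e; exact: near01.
have : forall x, (line @` `[0, 2]%classic) x -> modc (mderiv [ffun=> 0%N]
   (fun x => net_of wave_net e (2 *: x) - (2 `^ alpha)%:C * net_of wave_net e x) x) <= M * e ^+ 1.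
  by near: e.
have /andP[p1 p2] := @pihalf_02 R.
move=> /(_ (line (e * (pi / 2))) (imageP _ _)).
have en : e != 0 by rewrite gt_eqF.
have h1 : e^-1 * x0 (line (e * (pi / 2))) = pi / 2.
  by rewrite /line /coord !mxE eqxx mulr1 mulKf.
have h2 : e^-1 * x0 (2 *: line (e * (pi / 2))) = pi.
  by rewrite /coord mxE -/(x0 _) mulrCA h1 mulrC divfK.
have I2 : `[0, 2]%classic (e * (pi / 2)).
  rewrite /= in_itv/=; apply/andP; split; first by rewrite mulr_ge0// ltW.
  by rewrite (le_trans _ (ltW p2))// ler_piMl// ltW.
move=> /(_ I2).
rewrite mderiv_order0 !wave_netE h1 h2 cospi cos_pihalf mulr0 subr0 modcR normrN1 expr1.
apply/negP; rewrite -ltNge.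
rewrite (le_lt_trans (ler_wpM2r (ltW e0) (ler_norm M)))//.
have M1 : 0 < `|M| + 1 by rewrite ltr_wpDl.
apply: (@le_lt_trans _ _ ((`|M| + 1) * e)).
  by apply: ler_wpM2r; rewrite ?lerDl// ltW.
have : e < (`|M| + 1)^-1 by near: e; apply: nbhs_right_lt; rewrite invr_gt0.
by rewrite -(ltr_pM2l M1) divff// gt_eqF.
Unshelve. all: by end_near. Qed.
End plane_wave.

(** * Bump functions and the growth of the pairings *)

Section cube_measure.
Context {R : realType}.

Lemma lebesgueN_cons_setX d (A : set (measurableTypeR R)) (B : set (d.-tuple (measurableTypeR R))) :
  measurable A -> measurable B ->
  lebesgueN d.+1 [set t | A (tnth t ord0) /\ B [tuple of behead t]] =
  (@lebesgue_measure R A * lebesgueN d B)%E.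
Proof.
move=> mA mB; rewrite /lebesgueN /= /tuple_step /pushforward -product_measure1E//.
congr (_ \x _)%E; have bE x (t : d.-tuple (measurableTypeR R)) :
    [tuple of behead (cons_pair (x, t))] = t by exact/val_inj.
by apply/seteqP; split=> -[x t] /=; rewrite bE.
Qed.

Lemma tuple_box_cons d (r : R) : @tuple_box R d.+1 r =
  [set t | `[-r, r]%classic (tnth t ord0) /\ @tuple_box R d r [tuple of behead t]].
Proof.
apply/seteqP; split=> t /=.
  move=> H; split; first by rewrite in_itv/= -ler_norml.
  by move=> i; rewrite tnth_behead; exact: H.
move=> [t0 tb] i; have [->|] := eqVneq i ord0.
  by rewrite ler_norml; move: t0; rewrite in_itv.
case: (unliftP ord0 i) => [j ->|->]; last by rewrite eqxx.
move=> _; have := tb j; rewrite tnth_behead.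
by rewrite (_ : inord j.+1 = lift ord0 j)//; apply: val_inj; rewrite /= inordK// ltnS.
Qed.

Lemma lebesgueN_box_gt0 d (r : R) : 0 < r -> (0 < lebesgueN d (@tuple_box R d r))%E.
Proof.
move=> r0; elim: d => [|d IH].
  rewrite /= /dirac /= indicE mem_set ?lte01//.
  by move=> -[].
rewrite tuple_box_cons lebesgueN_cons_setX; [|exact: measurable_itv|exact: measurable_tuple_box].
have rr : - r < r by lra.
by rewrite mule_gt0// lebesgue_measure_itv/= lte_fin rr -EFinD lte_fin; lra.
Qed.
End cube_measure.

Section truncated_homogeneous.
Context {R : realType} {d : nat}.
Local Notation E := 'rV[R]_d.+1.
Local Notation Rd := (Rd R d.+1).
Local Notation x0 := (@coord R d.+1 ord0).

Lemma smooth_pow k : smooth_on setT (fun x : E => x0 x ^+ k).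
Proof.
elim: k => [|k IH]; first exact: smooth_cst.
rewrite (_ : (fun x => _) = (fun x : E => x0 x * x0 x ^+ k)).
  by apply: (smooth_mul (@openT E)); [exact: smooth_coord|exact: IH].
by apply/funext => x; rewrite exprS.
Qed.

Lemma cube_bump_supp : compactly_supported (@cube_bump R d.+1).
Proof.
exists [set x : E | forall i, `[- 2, 2]%classic (x ord0 i)].
  by apply: (@rV_compact R d.+1 (fun=> `[-2, 2]%classic)) => i; exact: segment_compact.
move=> x nx; have [i Hi] : exists i, ~ `[- 2, 2]%classic (x ord0 i).
  by apply: contrapT => H; apply: nx => i; apply: contrapT => ni; apply: H; exists i.
apply: (@cube_bump0 _ _ _ i); rewrite leNgt; apply/negP => lt; apply: Hi.
by rewrite /= in_itv/= -ler_norml ltW.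
Qed.

Lemma smooth_bump_pow k : smooth_on setT (fun x : E => x0 x ^+ k * cube_bump x).
Proof. by apply: smooth_mul; [exact: openT|exact: smooth_pow|exact: smooth_cube_bump]. Qed.

Lemma supp_bump_pow k : compactly_supported (fun x : E => x0 x ^+ k * cube_bump x).
Proof. exact: compactly_supportedMr cube_bump_supp. Qed.

(** The integrand is nonnegative since the power is even, and it is at least 2^(-2m) on the box
    where x_0 lies in [1/2, 1] and the other coordinates in [-1, 1]. *)
Lemma rint_bump_gt0 m : 0 < rint (fun x : E => x0 x ^+ (2 * m) * cube_bump x).
Proof.
pose B := [set t : d.+1.-tuple (measurableTypeR R) | `[2^-1, 1]%classic (tnth t ord0) /\
  @tuple_box R d 1 [tuple of behead t]].
have mB : measurable B.
  rewrite (_ : B = (fun t : d.+1.-tuple (measurableTypeR R) => tnth t ord0) @^-1` `[2^-1, 1]%classic `&`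
    (fun t : d.+1.-tuple (measurableTypeR R) => [tuple of behead t]) @^-1` @tuple_box R d 1)//.
  apply: measurableI; rewrite -[X in measurable X]setTI.
    exact: measurable_tnth.
  by apply: measurable_behead => //; exact: measurable_tuple_box.
have muB : lebesgueN d.+1 B = (2^-1%:E * lebesgueN d (@tuple_box R d 1))%E.
  rewrite lebesgueN_cons_setX; [|exact: measurable_itv|exact: measurable_tuple_box].
  rewrite lebesgue_measure_itv/= lte_fin invf_lt1// ltr1n -EFinD.
  by congr (_%:E * _)%E; lra.
have Bfin : (lebesgueN d.+1 B < +oo)%E.
  by rewrite muB lte_mul_pinfty//; exact: lebesgueN_box.
have B0 : 0 < fine (lebesgueN d.+1 B).
  rewrite fine_gt0// Bfin andbT muB mule_gt0 ?lte_fin//; exact: lebesgueN_box_gt0.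
pose c : R := 2^-1 ^+ (2 * m).
have c0 : 0 < c by rewrite exprn_gt0.
have iB : (lebesgueN d.+1).-integrable setT (EFin \o (\1_B : _ -> R)).
  apply/integrableP; split; first by apply/measurable_EFinP; exact: measurable_indic.
  under eq_integral do rewrite /= ger0_norm//.
  by rewrite integral_indic// setIT.
apply: (@lt_le_trans _ _ (\int[lebesgueN d.+1]_t (c * \1_B t))).
  rewrite RintegralZl// mulr_gt0//.
  by rewrite /Rintegral integral_indic// setIT.
apply: le_Rintegral => //.
- have := integrableZl measurableT c iB.
  by congr (integrable _ _ _); apply/funext => t.
- exact: (integrable_row (smooth_continuous (smooth_bump_pow (2 * m))) (supp_bump_pow (2 * m))).
move=> t _; rewrite indicE; case: (boolP (t \in B)) => [|_]; last first.
  by rewrite mulr0 mulr_ge0 ?cube_bump_ge0// exprM exprn_ge0// sqr_ge0.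
move=> /set_mem[t0 tb]; have tb1 : @tuple_box R d.+1 1 t.
  rewrite tuple_box_cons; split => //; move: t0; rewrite /= !in_itv/= => /andP[h1 ->].
  by rewrite (le_trans _ h1)//; lra.
rewrite cube_bump1 ?mulr1; last by move=> i; rewrite /coord mxE; exact: tb1.
move: t0; rewrite /= in_itv/= => /andP[h1 _].
by rewrite /coord mxE lerXn2r// nnegrE ?invr_ge0// (le_trans _ h1).
Qed.

Section pairing_asymptotics.
Variables (sigma : R) (sigma01 : 0 < sigma <= 1).

Let sigma0 : 0 < sigma. Proof. by case/andP: sigma01. Qed.

Lemma cont_kfun_mul s theta b (f : E -> R) : 0 < s -> continuous f ->
  continuous (fun x => kfun s theta b (x0 x) * f x).
Proof.
move=> s0 cf; apply: continuousMf => //.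
apply: (@continuous_compf _ _ _ (kfun s theta b)); last exact: coord_continuous.
by apply: chain_continuous; apply: osc_chain; exact: tpow_continuous.
Qed.

Lemma cont_cos_mul a theta (f : E -> R) : continuous f ->
  continuous (fun x => cos (a * x0 x + theta) * f x).
Proof.
move=> cf; apply: continuousMf => //.
apply: (@continuous_compf _ _ _ cos); first exact: continuous_cos.
apply: continuousDf; last exact: cst_continuous.
by apply: continuousMf; [exact: cst_continuous|exact: coord_continuous].
Qed.

(** Each use of [kfunM] consumes one factor x_0, lowers the exponent by 1 and the phase by pi/2;
    after j of them the exponent is sigma and the phase 0. The boundary terms grow polynomially in b
    but oscillate at frequency b, so they decay faster than any power against a test function. The
    constant C is the product of the -(sigma + i) for 1 <= i <= j, hence not 0. *)
Lemma kfun_pairing_reduce (f : E -> R) j : smooth_on setT f -> compactly_supported f ->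
  exists2 C : R, C != 0 & forall p, exists2 M : R, 0 <= M & forall b, 1 <= b ->
    `|rint (fun x => kfun (sigma + j%:R) (j%:R * (pi / 2)) b (x0 x) * (x0 x ^+ j * f x)) -
      C * rint (fun x => kfun sigma 0 b (x0 x) * f x)| <= M * b ^- p.
Proof.
move=> sf cf; elim: j => [|j [C C0 IH]].
  exists 1; rewrite ?oner_eq0// => p; exists 0 => // b b1.
  rewrite mul1r addr0 mul0r.
  rewrite (_ : (fun x => _ * (_ * _)) = (fun x => kfun sigma 0 b (x0 x) * f x)).
    by rewrite subrr normr0 mul0r.
  by apply/funext => x; rewrite expr0 mul1r.
have sj0 : 0 < sigma + j%:R by rewrite ltr_wpDr.
exists (- (sigma + j.+1%:R) * C).
  by rewrite mulf_neq0// oppr_eq0 gt_eqF// ltr_wpDr.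
move=> p; have [N HN] := tpow_leX (sigma + j.+1%:R).
have sfj : smooth_on setT (fun x => x0 x ^+ j * f x).
  by apply: smooth_mul; [exact: openT|exact: smooth_pow|].
have cfj : compactly_supported (fun x => x0 x ^+ j * f x) by exact: compactly_supportedMr.
(* The extra order N pays for the factor [tpow (sigma + j.+1%:R) b] <= b^N of the boundary term. *)
have [A A0 HA] := riemann_lebesgue (p + N) sfj cfj.
have [M M0 HM] := IH p.
exists (A + (sigma + j.+1%:R) * M).
  by rewrite addr_ge0// mulr_ge0// ltW// ltr_wpDr.
move=> b b1; have b0 : 0 < b by exact: lt_le_trans b1.
pose th : R := j%:R * (pi / 2).
have -> : (fun x => kfun (sigma + j.+1%:R) (j.+1%:R * (pi / 2)) b (x0 x) * (x0 x ^+ j.+1 * f x)) =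
    (fun x => tpow (sigma + j.+1%:R) b * (cos (b * x0 x + th) * (x0 x ^+ j * f x)) +
      (- (sigma + j.+1%:R)) * (kfun (sigma + j%:R) th b (x0 x) * (x0 x ^+ j * f x))).
  apply/funext => x; have := kfunM (j.+1%:R * (pi / 2)) (x0 x) sj0 (ltW b0).
  have -> : sigma + j%:R + 1 = sigma + j.+1%:R by rewrite -natr1 addrA.
  have -> : j.+1%:R * (pi / 2) - pi / 2 = th by rewrite /th -natr1; ring.
  rewrite -addrA (_ : j.+1%:R * (pi / 2) - pi / 2 = th); last by rewrite /th -natr1; ring.
  move=> H; rewrite exprS mulrA mulrA [_ * x0 x]mulrC [X in X * _ * _]H; ring.
have ccf := smooth_continuous sfj.
have cc := @cont_cos_mul b th _ ccf.
have ck := @cont_kfun_mul (sigma + j%:R) th b _ sj0 ccf.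
have sc : compactly_supported (fun x => cos (b * x0 x + th) * (x0 x ^+ j * f x)).
  exact: compactly_supportedMr.
have sk : compactly_supported (fun x => kfun (sigma + j%:R) th b (x0 x) * (x0 x ^+ j * f x)).
  exact: compactly_supportedMr.
rewrite rintD; last 4 first.
- by apply: continuousMf; [exact: cst_continuous|exact: cc].
- by apply: continuousMf; [exact: cst_continuous|exact: ck].
- exact: (@compactly_supportedMr _ _ (fun=> _)).
- exact: (@compactly_supportedMr _ _ (fun=> _)).
rewrite !rintZ//.
set I1 := rint _; set I2 := rint _; set I3 := rint _.
have -> : tpow (sigma + j.+1%:R) b * I1 + - (sigma + j.+1%:R) * I2 - - (sigma + j.+1%:R) * C * I3 =
  tpow (sigma + j.+1%:R) b * I1 - (sigma + j.+1%:R) * (I2 - C * I3) by ring.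
have sg0 : 0 <= sigma + j.+1%:R by rewrite ltW// ltr_wpDr.
rewrite (le_trans (ler_normB _ _))// [leRHS]mulrDl lerD//; last first.
  by rewrite normrM ger0_norm// -mulrA ler_wpM2l//; exact: HM.
rewrite normrM ger0_norm ?tpow_ge0//.
apply: (@le_trans _ _ (b ^+ N * (A * b ^- (p + N)))).
  by rewrite ler_pM ?tpow_ge0//; [exact: HN|exact: HA].
have bN : b ^+ N != 0 by rewrite expf_neq0// gt_eqF.
have bp : b ^+ p != 0 by rewrite expf_neq0// gt_eqF.
have -> // : b ^+ N * (A * b ^- (p + N)) = A * b ^- p.
rewrite exprD; field; exact/andP.
Qed.

(** The bound [kfun_le] is integrated against g0 >= 0, where f = x_0^2 g0. Its right-hand side has a
    single term that does not oscillate in x_0, namely -sigma b^(sigma-1), which the factor b turns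
    into -sigma b^sigma. The two oscillating terms gain b^(-2) and b^(-1) by [riemann_lebesgue] and
    stay bounded because sigma <= 1. *)
Lemma kfun_pairing_lower m :
  exists2 c : R, 0 < c & exists c' : R, forall b, 1 <= b ->
  b * rint (fun x : E => kfun sigma 0 b (x0 x) * (x0 x ^+ (2 * m.+1) * cube_bump x)) <=
  c' - c * b `^ sigma.
Proof.
set g0 := fun x : E => x0 x ^+ (2 * m) * cube_bump x.
set g1 := fun x : E => x0 x ^+ (2 * m).+1 * cube_bump x.
set f := fun x : E => x0 x ^+ (2 * m.+1) * cube_bump x.
have I0 : 0 < rint g0 := rint_bump_gt0 m.
have [A0 A00 H0] := riemann_lebesgue 1 (smooth_bump_pow (2 * m)) (supp_bump_pow (2 * m)).
have [A1 A10 H1] := riemann_lebesgue 2 (smooth_bump_pow (2 * m).+1) (supp_bump_pow (2 * m).+1).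
exists (sigma * rint g0); first by rewrite mulr_gt0.
exists (A1 + sigma * A0) => b b1; have b0 : 0 < b by exact: lt_le_trans b1.
have cg0 : continuous g0 by exact: smooth_continuous (smooth_bump_pow _).
have cg1 : continuous g1 by exact: smooth_continuous (smooth_bump_pow _).
have cf : continuous f by exact: smooth_continuous (smooth_bump_pow _).
have sg0 : compactly_supported g0 by exact: supp_bump_pow.
have sg1 : compactly_supported g1 by exact: supp_bump_pow.
have sf : compactly_supported f by exact: supp_bump_pow.
pose h x := b `^ sigma * (cos (b * x0 x - pi / 2) * g1 x) +
  (sigma * b `^ (sigma - 1) * (cos (b * x0 x + 0) * g0 x) + - (sigma * b `^ (sigma - 1)) * g0 x).
have c1 := @cont_cos_mul b (- (pi / 2)) _ cg1.
have c0 := @cont_cos_mul b 0 _ cg0.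
have s1 : compactly_supported (fun x => cos (b * x0 x - pi / 2) * g1 x) by exact: compactly_supportedMr.
have s0 : compactly_supported (fun x => cos (b * x0 x + 0) * g0 x) by exact: compactly_supportedMr.
have cM (k : R) (F : E -> R) : continuous F -> continuous (fun x => k * F x).
  by apply: continuousMf; exact: cst_continuous.
have sM (k : R) (F : E -> R) : compactly_supported F -> compactly_supported (fun x => k * F x).
  exact: (@compactly_supportedMr _ _ (fun=> k)).
have le1 : rint (fun x => kfun sigma 0 b (x0 x) * f x) <= rint h.
  apply: ler_rint.
  - exact: cont_kfun_mul.
  - by apply: continuousDf; [exact: cM|apply: continuousDf; exact: cM].
  - exact: compactly_supportedMr.
  - by apply: compactly_supportedD; [exact: sM|apply: compactly_supportedD; exact: sM].
  move=> x; have := kfun_le (x0 x) sigma01 b0.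
  have g00 : 0 <= g0 x.
    by rewrite /g0 mulr_ge0 ?cube_bump_ge0// exprM exprn_ge0// sqr_ge0.
  move=> /(ler_wpM2r g00).
  have -> : x0 x ^+ 2 * kfun sigma 0 b (x0 x) * g0 x = kfun sigma 0 b (x0 x) * f x.
    by rewrite /g0 /f mulnS exprD; ring.
  move=> H; apply: le_trans H _.
  rewrite /h cosBpihalf addr0 /g1 /g0 exprS le_eqVlt; apply/orP; left; apply/eqP; ring.
have hE : rint h = b `^ sigma * rint (fun x => cos (b * x0 x - pi / 2) * g1 x) +
  (sigma * b `^ (sigma - 1) * rint (fun x => cos (b * x0 x + 0) * g0 x)
    - sigma * b `^ (sigma - 1) * rint g0).
  rewrite rintD; [|exact: cM|by apply: continuousDf; exact: cM|exact: sM|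
    by apply: compactly_supportedD; exact: sM].
  rewrite rintD; [|exact: cM|exact: cM|exact: sM|exact: sM].
  by rewrite !rintZ// mulNr.
have bs : b * b `^ (sigma - 1) = b `^ sigma by rewrite mulr_powRB1// ltW.
have bsb : b `^ sigma <= b.
  by rewrite -[leRHS]powRr1 ?ler_powR//; [case/andP: sigma01|exact: ltW].
apply: (le_trans (ler_wpM2l (ltW b0) le1)); rewrite hE.
have H0b := H0 b 0 b0; have H1b := H1 b (- (pi / 2)) b0.
set I1 := rint (fun x => cos (b * x0 x - pi / 2) * g1 x) in hE *.
set I2 := rint (fun x => cos (b * x0 x + 0) * g0 x) in hE *.
have -> : b * (b `^ sigma * I1 + (sigma * b `^ (sigma - 1) * I2 - sigma * b `^ (sigma - 1) * rint g0)) =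
  b * b `^ sigma * I1 + sigma * (b * b `^ (sigma - 1)) * I2 - sigma * (b * b `^ (sigma - 1)) * rint g0 by ring.
rewrite bs; apply: lerB; last by rewrite mulrAC.
apply: lerD.
- apply: (@le_trans _ _ (b * b * (A1 * b ^- 2))); last first.
    by rewrite mulrCA expr2 divff ?mulr1// mulf_neq0// gt_eqF.
  apply: (le_trans (ler_norm _)); rewrite normrM ler_pM//.
  by rewrite ger0_norm ?mulr_ge0 ?powR_ge0 ?(ltW b0)// ler_pM ?powR_ge0// ltW.
- apply: (@le_trans _ _ (sigma * b * (A0 * b ^- 1))); last first.
    by rewrite expr1 -mulrA [b * _]mulrC mulfVK// gt_eqF.
  apply: (le_trans (ler_norm _)); rewrite normrM ler_pM//.
  by rewrite ger0_norm ?mulr_ge0 ?powR_ge0 ?(ltW sigma0)// ler_wpM2l// ltW.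
Qed.
End pairing_asymptotics.
End truncated_homogeneous.

(** * A weakly homogeneous element associated to no distribution *)

Section nonassociated.
Context {R : realType} {d : nat}.
Local Notation E := 'rV[R]_d.+1.
Local Notation Rd := (Rd R d.+1).
Local Notation x0 := (@coord R d.+1 ord0).

(** For an integer m > alpha + 1, the number s = m - alpha - 1 is positive; j + 1 is its ceiling and
    sigma = s - j. *)
Lemma degree_decomposition (alpha : R) : exists (m j : nat) (sigma : R),
  0 < sigma <= 1 /\ alpha = m%:R - (sigma + j%:R + 1).
Proof.
pose m := (Num.truncn `|alpha|).+2.
have am : alpha + 1 < m%:R.
  rewrite /m -natr1 ltrD2r (le_lt_trans (ler_norm _))//; exact: truncnS_gt.
pose s := m%:R - (alpha + 1); have s0 : 0 < s by rewrite subr_gt0.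
have ex : exists n : nat, s <= n%:R.
  by exists (Num.truncn s).+1; rewrite ltW// truncnS_gt.
case: (ex_minnP ex) => -[|j] sj minj; first by move: sj; rewrite leNgt s0.
exists m, j, (s - j%:R); split; last by rewrite /s; ring.
have -> : 0 < s - j%:R.
  by rewrite subr_gt0 ltNge; apply/negP => /minj; rewrite ltnn.
by rewrite lerBlDl natr1.
Qed.

Section truncated_net.
Variables (m : nat) (s theta : R) (s0 : 0 < s).

(** The factor [e^-1] leaves the degree in x unchanged. It turns the term of order b^(sigma-1) in
    the bound on the pairings into one of order b^sigma, which is unbounded. *)
Definition trunc_family (e : R) n y := e^-1 * osc (tpow s) theta 0 e^-1 n y.

Lemma moderate_trunc_family : moderate_family trunc_family.
Proof.
have ct := tpow_continuous s0; split=> [e _ n y|n r].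
  exact: (is_derive_scalef _ (osc_chain theta 0 e^-1 ct n y)).
have [N HN] := tpow_leX s.
exists (N + n + 2)%N, 1; near=> e => y _; rewrite mul1r /trunc_family.
have /andP[e0 e1] : 0 < e <= 1 by near: e; exact: near01.
have b1 : 1 <= e^-1 by rewrite invf_ge1.
have b0 : 0 <= e^-1 by exact: le_trans b1.
rewrite normrM ger0_norm// -exprVn.
have kb u : 0 <= u <= e^-1 -> `|tpow s u * u ^+ n| <= e^-1 ^+ N * e^-1 ^+ n.
  move=> /andP[u0 ub]; rewrite ger0_norm ?mulr_ge0 ?tpow_ge0 ?exprn_ge0//.
  rewrite ler_pM ?tpow_ge0 ?exprn_ge0//; last by rewrite lerXn2r// nnegrE.
  by rewrite (le_trans (tpow_le (ltW s0) ub))// HN.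
rewrite (le_trans (ler_wpM2l b0 (osc_bound theta y b0 ct kb)))// subr0.
by rewrite !exprD expr2 mulrCA mulrA.
Unshelve. all: by end_near. Qed.

Definition trunc_net : moderate_net Rd :=
  to_moderate (U := Rd) (moderate_family_net (d := d) (moderate_family_iter m moderate_trunc_family)).

Lemma trunc_netE e x :
  net_of trunc_net e x = (e^-1 * (x0 x ^+ m * kfun s theta e^-1 (x0 x)))%:C.
Proof. by rewrite /= iter_chain_mulX0 /trunc_family mulrCA. Qed.

Lemma trunc_weakly_homogeneous :
  weakly_homogeneous (m%:R - (s + 1)) (colombeau_class trunc_net).
Proof.
apply: (weakly_homogeneous_real trunc_netE) => l f q l0 sf cf.
set alpha := m%:R - (s + 1).
pose g x := x0 x ^+ m * f x.
have sg : smooth_on setT g by apply: smooth_mul; [exact: openT|exact: smooth_pow|].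
have cg : compactly_supported g by exact: compactly_supportedMr.
have [N HN] := tpow_leX s.
(* Besides the required order q, N absorbs the growth of [tpow] and 2 absorbs two factors [e^-1]:
   the prefactor of the net and the upper frequency in [kfun_increment]. *)
have [A A0 HA] := kfun_increment (q + N + 2) s0 sg cg.
(* The frequencies concerned lie between c1 / e and c2 / e, whichever of 1 and l is the larger. *)
pose c1 := Num.min 1 l; pose c2 := Num.max 1 l.
have c10 : 0 < c1 by rewrite lt_min ltr01.
have c20 : 0 < c2 by rewrite lt_max ltr01.
have c12 : c1 <= c2 by rewrite ge_min le_max lexx.
exists (l `^ alpha * (A * (c2 `^ s * c1 ^- (q + N + 2) * c2))); near=> e.
have /andP[e0 e1] : 0 < e <= 1 by near: e; exact: near01.
have b0 : 0 < e^-1 by rewrite invr_gt0.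
have b1 : 1 <= e^-1 by rewrite invf_ge1.
pose I := rint (fun x => (kfun s theta (l * e^-1) (x0 x) - kfun s theta e^-1 (x0 x)) * g x).
have la : l ^+ m * l `^ (- (s + 1)) = l `^ alpha.
  by rewrite -powR_mulrn ?(ltW l0)// -powRD// (gt_eqF l0) implybT.
have -> : (fun x => (e^-1 * (x0 (l *: x) ^+ m * kfun s theta e^-1 (x0 (l *: x))) -
     l `^ alpha * (e^-1 * (x0 x ^+ m * kfun s theta e^-1 (x0 x)))) * f x) =
  (fun x => (l `^ alpha * e^-1) *
     ((kfun s theta (l * e^-1) (x0 x) - kfun s theta e^-1 (x0 x)) * g x)).
  apply/funext => x; have -> : x0 (l *: x) = l * x0 x by rewrite /coord mxE.
  by rewrite kfun_scale ?(ltW b0)// exprMn -la /g; ring.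
have cB b b' : continuous (fun x : E => kfun s theta b (x0 x) - kfun s theta b' (x0 x)).
  suff cK : forall b, continuous (fun x : E => kfun s theta b (x0 x)).
    by move=> x; exact: (continuousB (cK b x) (cK b' x)).
  move=> {b'}b.
  apply: (@continuous_compf _ _ _ (kfun s theta b)); last exact: coord_continuous.
  by apply: chain_continuous; apply: osc_chain; exact: tpow_continuous.
rewrite rintZ; last 2 first.
- by apply: continuousMf; [exact: cB|exact: smooth_continuous].
- exact: compactly_supportedMr.
rewrite -/I normrM ger0_norm ?mulr_ge0 ?powR_ge0 ?(ltW b0)//.
have HI : `|I| <= A * (tpow s (c2 * e^-1) * (c1 * e^-1) ^- (q + N + 2) * (c2 * e^-1)).
  rewrite /I /c1 /c2; have [l1|/ltW l1] := leP 1 l.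
    have := HA theta e^-1 (l * e^-1); rewrite b0 ler_peMl ?(ltW b0)// => /(_ isT).
    by rewrite mul1r.
  have := HA theta (l * e^-1) e^-1; rewrite mulr_gt0// ler_piMl ?(ltW b0)// => /(_ isT).
  rewrite mul1r; set J := rint _ => HJ; rewrite -/I (_ : I = - J) ?normrN// /I /J.
  rewrite -[RHS]mulN1r -rintZ; last 2 first.
  - by apply: continuousMf; [exact: cB|exact: smooth_continuous].
  - exact: compactly_supportedMr.
  by congr rint; apply/funext => x; ring.
rewrite -!mulrA ler_wpM2l ?powR_ge0//.
apply: (le_trans (ler_wpM2l (ltW b0) HI)).
have t0 : tpow s (c2 * e^-1) <= c2 `^ s * e^-1 ^+ N.
  by rewrite tpowM ?(ltW c20)// ler_wpM2l ?powR_ge0// HN.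
have cp : 0 <= (c1 * e^-1) ^- (q + N + 2) * (c2 * e^-1).
  by rewrite mulr_ge0 ?invr_ge0 ?exprn_ge0// mulr_ge0// ltW.
apply: (@le_trans _ _ (e^-1 * (A * (c2 `^ s * e^-1 ^+ N * ((c1 * e^-1) ^- (q + N + 2) * (c2 * e^-1)))))).
  by rewrite ler_wpM2l ?(ltW b0)// ler_wpM2l// -mulrA ler_wpM2r.
have en : e != 0 by rewrite gt_eqF.
rewrite le_eqVlt; apply/orP; left; apply/eqP.
have eN : e ^+ N != 0 by rewrite expf_neq0.
rewrite exprMn invfM !exprVn invrK ![e ^+ (_ + _)]exprD.
move: (c1 ^- (q + N + 2)) => X; field; exact/andP.
Unshelve. all: by end_near. Qed.
End truncated_net.

(** Together with the x_0^m of the net, the power x_0^(j+m+2) of the test function makes x_0^j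
    x_0^(2(m+1)): j factors to bring the exponent down to sigma, and an even power for the one-sided
    bound. An associated distribution would keep the pairings bounded. *)
Lemma trunc_not_associated (m j : nat) (sigma : R) (sigma01 : 0 < sigma <= 1)
    (s0 : 0 < sigma + j%:R) (w : schwartz_distribution R d.+1) :
  ~ associated (colombeau_class (trunc_net m (j%:R * (pi / 2)) s0)) w.
Proof.
move=> H; have sg0 : 0 < sigma by case/andP: sigma01.
pose g x : R := x0 x ^+ (j + m.+2) * cube_bump x.
have sg : smooth_on setT g by exact: smooth_bump_pow.
have tsg : csmooth_on setT (fun x => (g x)%:C) by split; [exact: sg|exact: smooth_cst].
have tcg : exists2 K : set E, compact K & forall x, ~ K x -> (g x)%:C = 0.
  have [K cK H0] := @supp_bump_pow R d (j + m.+2); exists K => // x nK.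
  by rewrite /g (H0 x nK).
pose phi := TestFunction tsg tcg.
pose f x : R := x0 x ^+ (2 * m.+1) * cube_bump x.
have sf : smooth_on setT f by exact: smooth_bump_pow.
have cf : compactly_supported f by exact: supp_bump_pow.
have [C C0 HC] := kfun_pairing_reduce sigma01 j sf cf.
(* Order 1 suffices: the factor [e^-1] of the net turns the error M / b into M. *)
have [M M0 HM] := HC 1%N.
have [c c0 [c' Hc]] := kfun_pairing_lower (d := d) sigma01 m.
set u := trunc_net m (j%:R * (pi / 2)) s0 in H *.
pose P b := rint (fun x => kfun (sigma + j%:R) (j%:R * (pi / 2)) b (x0 x) * (x0 x ^+ j * f x)).
have pairE e : cintegral (fun x => net_of u e x * phi x) = (e^-1 * P e^-1)%:C.
  rewrite (_ : (fun x => _) = (fun x =>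
      (e^-1 * (x0 x ^+ m * kfun (sigma + j%:R) (j%:R * (pi / 2)) e^-1 (x0 x)))%:C * phi x)); last first.
    by apply/funext => x; rewrite trunc_netE.
  rewrite real_pairing /=.
  have cKf : continuous (fun x => kfun (sigma + j%:R) (j%:R * (pi / 2)) e^-1 (x0 x) * (x0 x ^+ j * f x)).
    apply: continuousMf.
      apply: (@continuous_compf _ _ _ (kfun (sigma + j%:R) (j%:R * (pi / 2)) e^-1)); last exact: coord_continuous.
      by apply: chain_continuous; apply: osc_chain; exact: tpow_continuous.
    by apply: continuousMf; apply: smooth_continuous; [exact: smooth_pow|exact: sf].
  have sKf : compactly_supported (fun x => kfun (sigma + j%:R) (j%:R * (pi / 2)) e^-1 (x0 x) * (x0 x ^+ j * f x)).
    by apply: compactly_supportedMr; exact: compactly_supportedMr.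
  apply: f_equal2.
    rewrite /P -rintZ//; congr rint; apply/funext => x.
    rewrite /g /f exprD; have -> : (2 * m.+1 = m + m.+2)%N by rewrite mul2n -addnn addSnnS.
    by rewrite exprD; ring.
  rewrite (_ : (fun x => _) = (fun=> 0)); last by apply/funext => x; rewrite mulr0.
  by rewrite /rint /Rintegral integral0.
have [_ mu] := moderate_netP u.
have su := (moderate_netP u).1; have sv := (moderate_netP (repr (colombeau_class u))).1.
have [B HB] := pairing_congr phi sv su (repr_class_negligible u) 0%N.
have /cvgrPdist_le/(_ 1 ltr01) Hw := H phi.
suff : \forall e \near (0 : R)^'+, False by move=> /filter_ex[].
(* As soon as b^sigma exceeds Q, the bound of [kfun_pairing_lower] contradicts the bound on the
   pairing, which the division by |C| transfers to exponent sigma. *)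
pose Q := (`|c'| + (1 + `|B| + modc (w phi) + M) / `|C| + 1) / c.
have Cn : 0 < `|C| by rewrite normr_gt0.
have cvb : \forall e \near (0 : R)^'+, Q < e^-1 `^ sigma.
  have Q0 : 0 < Q.
    rewrite /Q divr_gt0// ltr_wpDl// addr_ge0// divr_ge0//.
    by rewrite !addr_ge0// modc_ge0.
  near=> e; have e0 : 0 < e by near: e; exact: nbhs_right_gt.
  have : e < (Q `^ sigma^-1)^-1.
    by near: e; apply: nbhs_right_lt; rewrite invr_gt0 powR_gt0.
  rewrite -[X in X < _]invrK ltf_pV2 ?posrE ?invr_gt0 ?powR_gt0// => h.
  have := gt0_ltr_powR sg0 _ _ h; rewrite !nnegrE powR_ge0 invr_ge0 (ltW e0) => /(_ isT isT).
  by rewrite -powRrM mulVf ?gt_eqF// powRr1// ltW.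
near=> e.
have /andP[e0 e1] : 0 < e <= 1 by near: e; exact: near01.
have b1 : 1 <= e^-1 by rewrite invf_ge1.
have b0 : 0 < e^-1 by rewrite invr_gt0.
have h1 : `|0 - modc (cintegral (fun x => net_of (repr (colombeau_class u)) e x * phi x) - w phi)| <= 1 by near: e.
have h2 : modc (cintegral (fun x => net_of (repr (colombeau_class u)) e x * phi x) -
    cintegral (fun x => net_of u e x * phi x)) <= B * e ^+ 0 by near: e.
have hQ : Q < e^-1 `^ sigma by near: e.
rewrite sub0r normrN ger0_norm ?modc_ge0// in h1.
rewrite expr0 mulr1 pairE in h2.
set z := cintegral _ in h1 h2.
have hP : `|e^-1 * P e^-1| <= 1 + `|B| + modc (w phi).
  set y := (_)%:C in h2.
  have yE : y = ((z - w phi) + w phi) - (z - y) by ring.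
  have -> : `|e^-1 * P e^-1| = modc y by rewrite modcR.
  rewrite yE (le_trans (modcB _ _))//.
  have := modcD (z - w phi) (w phi); have := ler_norm B; lra.
set p0 := rint (fun x => kfun sigma 0 e^-1 (x0 x) * f x) in Hc *.
have hM := HM e^-1 b1; rewrite -/(P _) expr1 in hM.
have hC : `|C * (e^-1 * rint (fun x => kfun sigma 0 e^-1 (x0 x) * f x))| <= 1 + `|B| + modc (w phi) + M.
  set p1 := rint (fun x => kfun sigma 0 e^-1 (x0 x) * f x) in hM *.
  have -> : C * (e^-1 * p1) = e^-1 * P e^-1 - e^-1 * (P e^-1 - C * p1) by ring.
  rewrite (le_trans (ler_normB _ _))// lerD// normrM gtr0_norm//.
  by rewrite (le_trans (ler_wpM2l (ltW b0) hM))// mulrC mulfVK// gt_eqF.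
rewrite normrM mulrC -ler_pdivlMr// in hC.
have := Hc _ b1; move: hC; rewrite -/f.
set p2 := e^-1 * rint _; rewrite ler_norml => /andP[hC _] hc.
have : c * Q < c * e^-1 `^ sigma by rewrite ltr_pM2l.
rewrite /Q mulrC divfK ?gt_eqF//.
have := ler_norm c'; lra.
Unshelve. all: by end_near. Qed.
End nonassociated.

(** * Integrals along a ray *)

Section ray_functionals.
Context {R : realType} {d : nat}.
Local Notation E := 'rV[R]_d.+1.
Implicit Types (a f g : E -> R).
Variables (s : R) (s0 : 0 < s).

Definition ray (t : R) : E := t *: delta_mx 0 ord0.

Lemma ray_continuous : continuous ray.
Proof. by move=> t; apply: continuousZ; [exact: cvg_id|exact: cst_continuous]. Qed.

Lemma coord_ray i t : coord i (ray t) = (i == ord0)%:R * t.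
Proof. by rewrite /coord !mxE eqxx /= mulrC. Qed.

Definition ray_integral f : R :=
  \int[@lebesgue_measure R]_(t in `[0, +oo[) (tpow s t * f (ray t)).

(** Vanishing off a slab in x_0 is all that an integral along the ray requires, and it is preserved
    by differentiation. *)
Definition supp0 T f := forall x, T < `|coord ord0 x| -> f x = 0.

Lemma ray_integralE T f : 0 <= T -> supp0 T f ->
  ray_integral f = iint 0 T (fun t => tpow s t * f (ray t)).
Proof.
move=> T0 fT; rewrite /ray_integral /iint Rintegral_mkcond [RHS]Rintegral_mkcond.
congr Rintegral; apply/funext => t; rewrite !patchE.
have [t0|t0] := leP 0 t; last first.
  by rewrite !memNset//= in_itv/= leNgt t0.
rewrite mem_set/=; last by rewrite in_itv/= t0.
have [tT|Tt] := leP t T; first by rewrite mem_set//= in_itv/= t0.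
rewrite memNset/=; last by rewrite in_itv/= t0 leNgt Tt.
by rewrite fT ?mulr0// coord_ray eqxx mul1r ger0_norm.
Qed.

Lemma ray_integrand_continuous f : continuous f -> continuous (fun t => tpow s t * f (ray t)).
Proof.
move=> cf; apply: continuousMf; first exact: tpow_continuous.
by apply: continuous_compf => //; exact: ray_continuous.
Qed.

Lemma ray_integral_lin T (b c : R) f g : 0 <= T -> continuous f -> continuous g ->
  supp0 T f -> supp0 T g ->
  ray_integral (fun x => b * f x + c * g x) = b * ray_integral f + c * ray_integral g.
Proof.
move=> T0 cf cg fT gT; rewrite (ray_integralE T0 fT) (ray_integralE T0 gT).
rewrite (@ray_integralE T); last 2 first.
- exact: T0.
- by move=> x xT; rewrite fT// gT// !mulr0 addr0.
have cb (k : R) h : continuous h -> continuous (fun t => k * (tpow s t * h (ray t))).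
  move=> ch; apply: continuousMf; first exact: cst_continuous.
  exact: ray_integrand_continuous.
rewrite -!iintZ; [|exact: ray_integrand_continuous|exact: ray_integrand_continuous].
rewrite -iintD; [|exact: cb|exact: cb].
by apply: eq_iint => t _; ring.
Qed.

Lemma ray_integral_bound T f B : 0 <= T -> continuous f -> supp0 T f ->
  (forall t, 0 <= t <= T -> `|f (ray t)| <= B) ->
  `|ray_integral f| <= tpow s T * B * T.
Proof.
move=> T0 cf fT fB; rewrite (ray_integralE T0 fT) -[X in _ * X]subr0.
apply: iint_bound => //; first exact: ray_integrand_continuous.
move=> t tT; rewrite normrM ger0_norm ?tpow_ge0// ler_pM ?tpow_ge0//; last exact: fB.
by rewrite tpow_le ?(ltW s0)//; case/andP: tT.
Qed.

Lemma ray_integral_scale T l f : 0 <= T -> 0 < l -> continuous f -> supp0 T f ->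
  ray_integral (fun x => f (l^-1 *: x)) = l `^ (s + 1) * ray_integral f.
Proof.
move=> T0 l0 cf fT; rewrite (ray_integralE T0 fT).
have lT : 0 <= l * T by rewrite mulr_ge0// ltW.
have ln : l != 0 by rewrite gt_eqF.
rewrite (@ray_integralE (l * T)); last 2 first.
- exact: lT.
- move=> x xT; apply: fT; rewrite /coord mxE normrM gtr0_norm ?invr_gt0//.
  by rewrite ltr_pdivlMl.
have ci := ray_integrand_continuous cf.
pose h t := tpow s t * f (l^-1 *: ray t).
have ch : continuous h.
  apply: continuousMf; first exact: tpow_continuous.
  apply: continuous_compf => //; apply: (@continuous_compf _ _ _ (fun x : E => l^-1 *: x)).
    exact: scaler_continuous.
  exact: ray_continuous.
have := @iint_scale R 0 T l 0 h l0 T0 ch; rewrite mulr0 !addr0 => H.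
have {H} -> : iint 0 (l * T) h = l * iint 0 T (fun t => h (l * t + 0)) by rewrite H mulVKf.
rewrite powRD ?ln ?implybT// powRr1 ?(ltW l0)// [_ * l]mulrC -mulrA; congr (_ * _).
rewrite -iintZ//; apply: eq_iint => t _; rewrite addr0 /h tpowM ?(ltW l0)//.
by rewrite -mulrA /ray scalerA mulKf.
Qed.

Lemma supp0_partial T i f : supp0 T f -> supp0 T (partial i f).
Proof.
move=> fT x xT.
have oT : open [set x : E | T < `|coord ord0 x|].
  have : open ((fun x : E => `|coord ord0 x|) @^-1` `]T, +oo[%classic).
    move/continuousP : (continuous_compf (@norm_continuous R R) (@coord_continuous R d.+1 ord0)).
    by apply; exact: interval_open.
  by congr open; apply/seteqP; split=> y /=; rewrite in_itv/= andbT.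
rewrite (@partial_ext _ _ _ f (fun=> 0) i oT _ x xT)//.
by rewrite /partial (@derive_cst R _ _ (0 : R)).
Qed.

Lemma supp0_partials T w f : supp0 T f -> supp0 T (partials w f).
Proof. by elim: w f => //= i w IH f fT; apply: IH; exact: supp0_partial. Qed.

Definition rayd k f := ray_integral (partials (nseq k ord0) f).

Lemma rayd_lin k T (b c : R) f g : 0 <= T -> smooth_on setT f -> smooth_on setT g ->
  supp0 T f -> supp0 T g ->
  rayd k (fun x => b * f x + c * g x) = b * rayd k f + c * rayd k g.
Proof.
move=> T0 sf sg fT gT; rewrite /rayd -(@ray_integral_lin T)//.
- congr ray_integral; apply/funext => x.
  have [/smoothP kf /smoothP kg] := (sf, sg).
  by have [_ ->] := partials_lin b c (@openT E) (kf (size (nseq k ord0))) (kg _) (I : setT x).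
- by apply: smooth_continuous; exact: smooth_partials.
- by apply: smooth_continuous; exact: smooth_partials.
- exact: supp0_partials.
- exact: supp0_partials.
Qed.

Lemma raydS k f : rayd k.+1 f = rayd k (partial ord0 f).
Proof. by []. Qed.

Lemma eq_rayd k f g : (forall x, f x = g x) -> rayd k f = rayd k g.
Proof. by move=> /funext ->. Qed.

Section ray_convolution.
Variable c : R.
Implicit Types (kappa : R -> R).

(** The scale c is 1/eps for regularizations and 1 for the profiles obtained by blow-up. *)
Definition rayconv kappa T f x := iint 0 T (fun t => kappa t * f (c *: (x - ray t))).

Lemma rayconv_joint f kappa : continuous f -> continuous kappa ->
  continuous (fun p : R * E => kappa p.1 * f (c *: (p.2 - ray p.1))).
Proof.
move=> cf ck; apply: continuousMf.
  by apply: continuous_compf => // p; exact: cvg_fst.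
apply: continuous_compf => //.
apply: (continuous_compf (@scaler_continuous _ _ c)) => p.
apply: continuousB; first exact: cvg_snd.
by apply: continuous_comp; [exact: cvg_fst|exact: ray_continuous].
Qed.

Lemma rayconv_integrand f kappa x : continuous f -> continuous kappa ->
  continuous (fun t => kappa t * f (c *: (x - ray t))).
Proof.
move=> cf ck; apply: continuousMf => //; apply: continuous_compf => //.
apply: (continuous_compf (@scaler_continuous _ _ c)) => t.
by apply: continuousB; [exact: cst_continuous|exact: ray_continuous].
Qed.

Lemma rayconv_C1 kappa T f x : continuous kappa -> smooth_on setT f ->
  C1_at (rayconv kappa T f) x /\
  forall i, partial i (rayconv kappa T f) x = c * rayconv kappa T (partial i f) x.
Proof.
move=> ck sf.
have key i : is_derive x (delta_mx 0 i) (rayconv kappa T f) (c * rayconv kappa T (partial i f) x).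
  set v := delta_mx 0 i.
  have spf := smooth_partial i sf.
  have cpf := smooth_continuous spf; have cf := smooth_continuous sf.
  pose z h t := c *: (h *: v + x - ray t).
  have zE h t : z h t = (c * h) *: v + c *: (x - ray t).
    by rewrite /z -addrA scalerDr scalerA.
  have dF (t h : R) : is_derive h 1 (fun h => kappa t * f (z h t)) (kappa t * (c * partial i f (z h t))).
    have dl : is_derive (c * h + 0) 1 (fun h => f (h *: v + c *: (x - ray t)))
        (partial i f ((c * h + 0) *: v + c *: (x - ray t))).
      by apply: line_is_derive; exact: smooth_C1 sf _.
    apply: (is_derive_ext (is_derive_scalef (kappa t) (is_derive_comp_affine dl))) => [u|].
      by rewrite addr0 zE.
    by rewrite addr0 zE mulrC [_ * c]mulrC mulrC.
  have cz : continuous (fun p : R * R => z p.2 p.1).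
    have -> : (fun p : R * R => z p.2 p.1) = (fun p => c *: (p.2 *: v + (x - ray p.1))).
      by apply/funext => p; rewrite /z addrA.
    apply: continuousZv; first exact: cst_continuous.
    apply: continuousDv.
      by apply: continuousZv => [p|]; [exact: cvg_snd|exact: cst_continuous].
    apply: continuousBv; first exact: cst_continuous.
    apply: continuous_compf; first exact: ray_continuous.
    by move=> p; exact: cvg_fst.
  have D := @iint_derive R (fun t h => kappa t * f (z h t))
    (fun t h => kappa t * (c * partial i f (z h t))) 0 T 0 dF.
  have {}D : is_derive (0 : R) 1 (fun h => iint 0 T (fun t => kappa t * f (z h t)))
      (iint 0 T (fun t => kappa t * (c * partial i f (z 0 t)))).
    apply: D => [h|].
      exact: (@rayconv_integrand f kappa (h *: v + x)).
    apply: continuousMf; first by apply: continuous_compf => // p; exact: cvg_fst.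
    apply: continuousMf; first exact: cst_continuous.
    exact: continuous_compf.
  apply: DeriveDef; first by apply/derivable1P; case: D.
  have line0 (g : E -> R) y : derive (fun h : R => g (h *: v + y)) 0 1 = 'D_v g y.
    rewrite /derive; congr (lim _); apply: f_equal2 => //; apply/funext => t /=.
    by rewrite /shift/= !addr0 [t *: 1]mulr1 scale0r add0r.
  rewrite -line0; case: D => _ ->.
  rewrite /rayconv -iintZ; last exact: rayconv_integrand.
  apply: eq_iint => t _; rewrite /z scale0r add0r; ring.
split; last by move=> i; case: (key i).
split; last by move=> i; case: (key i).
apply: (@iint_continuous R E (fun t x => kappa t * f (c *: (x - ray t)))).
by apply: rayconv_joint => //; exact: smooth_continuous.
Qed.

Lemma rayconv_partials kappa T w f : continuous kappa -> smooth_on setT f ->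
  partials w (rayconv kappa T f) = fun x => c ^+ size w * rayconv kappa T (partials w f) x.
Proof.
move=> ck; elim/last_ind: w f => [|w i IH] f sf.
  by apply/funext => x; rewrite expr0 mul1r.
have pr g : partials (rcons w i) g = partial i (partials w g).
  by rewrite /partials -cats1 foldl_cat.
rewrite pr IH// pr; apply/funext => x; rewrite size_rcons exprSr -mulrA.
have [C1 <-] := rayconv_C1 T x ck (smooth_partials w sf).
have [_ D1] := C1.
by rewrite /partial (deriveZ (c ^+ size w) (D1 i)).
Qed.

Lemma rayconv_smooth kappa T f : continuous kappa -> smooth_on setT f ->
  smooth_on setT (rayconv kappa T f).
Proof.
move=> ck sf w x _; rewrite rayconv_partials//.
have [C1 _] := rayconv_C1 T x ck (smooth_partials w sf).
have C0 : C1_at (fun=> 0 : R) x by exact: C1_cst.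
have := C1_lin (c ^+ size w) 0 C1 C0.
by under [X in C1_at X _]eq_fun do rewrite mulr0 addr0.
Qed.

(** For c = 1/eps and f a part of the mollifier, this is the value at x of the regularization of the
    distribution a w, up to the power of eps in front. The k derivatives of w act on the product. *)
Definition raylocal k a f x := rayd k (fun y => a y * f (c *: (x - y))).

Lemma reflect_smooth_real f x : smooth_on setT f -> smooth_on setT (fun y => f (c *: (x - y))).
Proof.
move=> sf; have := smooth_affine (- c) (c *: x) sf.
by under [X in smooth_on _ X]eq_fun do rewrite scaleNr addrC -scalerBr.
Qed.

Lemma partial_reflect f x i : smooth_on setT f ->
  partial i (fun y => f (c *: (x - y))) = fun y => - c * partial i f (c *: (x - y)).
Proof.
move=> sf; apply/funext => y.
have E1 : (fun y => f (c *: (x - y))) = (fun y => f (- c *: y + c *: x)).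
  by apply/funext => z; rewrite scaleNr [in RHS]addrC -scalerBr.
have E2 : c *: (x - y) = - c *: y + c *: x by rewrite scaleNr [in RHS]addrC -scalerBr.
rewrite E1 E2; apply: (C1_affine _).2; exact: smooth_C1 sf _.
Qed.

Lemma raylocal0 T a f x : 0 <= T -> smooth_on setT a -> smooth_on setT f -> supp0 T a ->
  raylocal 0 a f x = rayconv (fun t => tpow s t * a (ray t)) T f x.
Proof.
move=> T0 sa sf aT; rewrite /raylocal /rayd /= (ray_integralE T0); last first.
  by move=> y yT; rewrite aT// mul0r.
by apply: eq_iint => t _; rewrite mulrA.
Qed.

Lemma raylocalS k T a f x : 0 <= T -> smooth_on setT a -> smooth_on setT f -> supp0 T a ->
  raylocal k.+1 a f x = 1 * raylocal k (partial ord0 a) f x + (- c) * raylocal k a (partial ord0 f) x.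
Proof.
move=> T0 sa sf aT; have oT := @openT E.
have sr := reflect_smooth_real x sf.
have spa := smooth_partial ord0 sa; have spf := smooth_partial ord0 sf.
have z1 : supp0 T (fun y => partial ord0 a y * f (c *: (x - y))).
  by move=> y yT; rewrite (supp0_partial _ aT)// mul0r.
have z2 : supp0 T (fun y => a y * partial ord0 f (c *: (x - y))).
  by move=> y yT; rewrite aT// mul0r.
rewrite /raylocal raydS -(@rayd_lin k T 1 (- c) _ _ T0 (smooth_mul oT spa sr)
  (smooth_mul oT sa (reflect_smooth_real x spf)) z1 z2).
apply: eq_rayd => y; rewrite partial_mul; [|exact: smooth_C1 sa _|exact: smooth_C1 sr _].
by rewrite (partial_reflect _ _ sf); ring.
Qed.

(** Induction on k by [raylocalS]: each derivative of w falls either on a or, with a factor -c, on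
    f, whence (1 + |c|)^k. Smoothness is proved along, since splitting the partial derivatives of
    the two terms requires it. *)
Lemma raylocal_estimate k T a f : 0 <= T -> smooth_on setT a -> smooth_on setT f -> supp0 T a ->
  smooth_on setT (raylocal k a f) /\
  forall w x B, (forall i j t, (i <= k)%N -> (j <= k)%N -> 0 <= t <= T ->
      `|partials (nseq i ord0) a (ray t)| *
      `|partials (nseq j ord0 ++ w) f (c *: (x - ray t))| <= B) ->
    `|partials w (raylocal k a f) x| <= (1 + `|c|) ^+ k * `|c| ^+ size w * tpow s T * T * B.
Proof.
move=> T0; elim: k a f => [|k IH] a f sa sf aT.
  have cka : continuous (fun t => tpow s t * a (ray t)).
    by apply: ray_integrand_continuous; exact: smooth_continuous.
  have E0 : raylocal 0 a f = rayconv (fun t => tpow s t * a (ray t)) T f.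
    by apply/funext => x; exact: raylocal0.
  rewrite E0; split; first exact: rayconv_smooth.
  move=> w x B HB; rewrite rayconv_partials// expr0 mul1r normrM normrX -!mulrA.
  rewrite ler_wpM2l ?exprn_ge0//.
  have -> : tpow s T * (T * B) = (tpow s T * B) * (T - 0) by ring.
  apply: iint_bound => //.
    by apply: rayconv_integrand => //; apply: smooth_continuous; exact: smooth_partials.
  move=> t tT; rewrite !normrM -mulrA ler_pM ?mulr_ge0//.
    by rewrite ger0_norm ?tpow_ge0// tpow_le ?(ltW s0)//; case/andP: tT.
  exact: (HB 0%N 0%N t).
have oT := @openT E.
have sa1 := smooth_partial ord0 sa; have sf1 := smooth_partial ord0 sf.
have aT1 := supp0_partial ord0 aT.
have [s1 b1] := IH _ _ sa1 sf aT1; have [s2 b2] := IH _ _ sa sf1 aT.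
have ES : raylocal k.+1 a f = fun x => 1 * raylocal k (partial ord0 a) f x +
    (- c) * raylocal k a (partial ord0 f) x by apply/funext => x; exact: raylocalS T0 sa sf aT.
rewrite ES; split; first exact: smooth_lin.
move=> w x B HB; have [/smoothP k1 /smoothP k2] := (s1, s2).
have [_ ->] := partials_lin 1 (- c) oT (k1 (size w)) (k2 (size w)) (I : setT x).
rewrite mul1r (le_trans (ler_normD _ _))// exprS -!mulrA mulrDl mul1r lerD//.
  by rewrite !mulrA; apply: b1 => i j t ik jk tT; apply: (HB i.+1 j t) => //; exact: leqW.
rewrite normrM normrN ler_wpM2l// !mulrA.
by apply: b2 => i j t ik jk tT; apply: (HB i j.+1 t) => //; exact: leqW.
Qed.

(* Up to terms where some derivative falls on [a], all the derivatives fall on [f]. *)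
Lemma raylocal_main_term k T a f : 0 <= T -> smooth_on setT a -> smooth_on setT f -> supp0 T a ->
  forall w x B, 0 <= B -> (forall i j t, (0 < i <= k)%N -> (j <= k)%N -> 0 <= t <= T ->
      `|partials (nseq i ord0) a (ray t)| *
      `|partials (nseq j ord0 ++ w) f (c *: (x - ray t))| <= B) ->
    `|partials w (raylocal k a f) x -
      (- c) ^+ k * c ^+ size w *
        rayconv (fun t => tpow s t * a (ray t)) T (partials (nseq k ord0 ++ w) f) x| <=
    (1 + `|c|) ^+ k * `|c| ^+ size w * tpow s T * T * B.
Proof.
move=> T0; elim: k a f => [|k IH] a f sa sf aT w x B B0 HB.
  have cka : continuous (fun t => tpow s t * a (ray t)).
    by apply: ray_integrand_continuous; exact: smooth_continuous.
  have -> : raylocal 0 a f = rayconv (fun t => tpow s t * a (ray t)) T f.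
    by apply/funext => y; exact: raylocal0.
  rewrite rayconv_partials// expr0 mul1r subrr normr0.
  by rewrite !mulr_ge0 ?exprn_ge0 ?addr_ge0 ?tpow_ge0.
have oT := @openT E.
have sa1 := smooth_partial ord0 sa; have sf1 := smooth_partial ord0 sf.
have aT1 := supp0_partial ord0 aT.
have [s1 b1] := raylocal_estimate k T0 sa1 sf aT1.
have [s2 _] := raylocal_estimate k T0 sa sf1 aT.
have ES : raylocal k.+1 a f = fun x => 1 * raylocal k (partial ord0 a) f x +
    (- c) * raylocal k a (partial ord0 f) x by apply/funext => y; exact: raylocalS T0 sa sf aT.
rewrite ES; have [/smoothP k1 /smoothP k2] := (s1, s2).
have [_ ->] := partials_lin 1 (- c) oT (k1 (size w)) (k2 (size w)) (I : setT x).
rewrite /= mul1r [(- c) ^+ k.+1]exprS -!mulrA -addrA -mulrBr (le_trans (ler_normD _ _))//.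
rewrite exprS -!mulrA mulrDl mul1r lerD//.
  rewrite !mulrA; apply: b1 => i j t ik jk tT; apply: (HB i.+1 j t) => //; exact: leqW.
rewrite normrM normrN ler_wpM2l// !mulrA.
by apply: (IH _ _ sa sf1 aT) => // i j t /andP[i0 ik] jk tT; apply: (HB i j.+1 t) => //; rewrite i0 leqW.
Qed.
End ray_convolution.
End ray_functionals.

(** * Regularization of distributions carried by a ray *)

Section real_nets.
Context {R : realType} {d : nat}.
Local Notation E := 'rV[R]_d.
Implicit Types (U : set E) (v : R -> E -> R).

Definition moderate_part U v := (forall e : R, 0 < e <= 1 -> smooth_on U (v e)) /\
  forall K, compact K -> K `<=` U -> forall beta : mindex d, exists N M,
    \forall e \near 0^'+, forall x, K x -> `|partials (mi_word beta) (v e) x| <= M * e ^- N.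

Definition negligible_part U v := (forall e : R, 0 < e <= 1 -> smooth_on U (v e)) /\
  forall K, compact K -> K `<=` U -> forall (beta : mindex d) m, exists M,
    \forall e \near 0^'+, forall x, K x -> `|partials (mi_word beta) (v e) x| <= M * e ^+ m.

Lemma moderate_part_lin U (b c : R) v w : open U -> moderate_part U v -> moderate_part U w ->
  moderate_part U (fun e x => b * v e x + c * w e x).
Proof.
move=> oU [sv mv] [sw mw]; split=> [e e01|K cK KU beta].
  exact: (smooth_lin b c oU (sv e e01) (sw e e01)).
have [N1 [M1 H1]] := mv K cK KU beta; have [N2 [M2 H2]] := mw K cK KU beta.
exists (N1 + N2)%N, (`|b| * `|M1| + `|c| * `|M2|); near=> e => x Kx.
have e01 : 0 < e <= 1 by near: e; exact: near01.
have e0 : 0 <= e by case/andP: e01 => /ltW.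
have [/smoothP s1 /smoothP s2] := (sv e e01, sw e e01).
have [_ ->] := partials_lin b c oU (s1 (size (mi_word beta))) (s2 _) (KU x Kx).
have b1 : forall x, K x -> `|partials (mi_word beta) (v e) x| <= M1 * e ^- N1 by near: e.
have b2 : forall x, K x -> `|partials (mi_word beta) (w e) x| <= M2 * e ^- N2 by near: e.
have aux M N N' (h : R) : (N <= N')%N -> h <= M * e ^- N -> h <= `|M| * e ^- N'.
  move=> NN'; move/le_trans; apply; apply: (@le_trans _ _ (`|M| * e ^- N)).
    by rewrite ler_wpM2r ?ler_norm// invr_ge0 exprn_ge0.
  by rewrite ler_wpM2l// ler_expN.
rewrite (le_trans (ler_normD _ _))// [leRHS]mulrDl lerD// normrM -mulrA ler_wpM2l//.
  by apply: aux (b1 x Kx); rewrite leq_addr.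
by apply: aux (b2 x Kx); rewrite leq_addl.
Unshelve. all: by end_near. Qed.

Lemma negligible_part_lin U (b c : R) v w : open U -> negligible_part U v -> negligible_part U w ->
  negligible_part U (fun e x => b * v e x + c * w e x).
Proof.
move=> oU [sv mv] [sw mw]; split=> [e e01|K cK KU beta m].
  exact: (smooth_lin b c oU (sv e e01) (sw e e01)).
have [M1 H1] := mv K cK KU beta m; have [M2 H2] := mw K cK KU beta m.
exists (`|b| * M1 + `|c| * M2); near=> e => x Kx.
have e01 : 0 < e <= 1 by near: e; exact: near01.
have [/smoothP s1 /smoothP s2] := (sv e e01, sw e e01).
have [_ ->] := partials_lin b c oU (s1 (size (mi_word beta))) (s2 _) (KU x Kx).
rewrite (le_trans (ler_normD _ _))// mulrDl lerD// normrM -mulrA ler_wpM2l//.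
  by move: x Kx; near: e.
by move: x Kx; near: e.
Unshelve. all: by end_near. Qed.

Lemma moderate_parts U (u : @net R d) : moderate_part U (fun e x => complex.Re (u e x)) ->
  moderate_part U (fun e x => complex.Im (u e x)) -> moderate U u.
Proof.
move=> [sv mv] [sw mw]; split=> [e e01|K cK KU beta]; first by split; [exact: sv|exact: sw].
have [N1 [M1 H1]] := mv K cK KU beta; have [N2 [M2 H2]] := mw K cK KU beta.
exists (N1 + N2)%N, (`|M1| + `|M2|); near=> e => x Kx.
have e01 : 0 < e <= 1 by near: e; exact: near01.
have e0 : 0 <= e by case/andP: e01 => /ltW.
have aux M N N' (h : R) : (N <= N')%N -> h <= M * e ^- N -> h <= `|M| * e ^- N'.
  move=> NN'; move/le_trans; apply; apply: (@le_trans _ _ (`|M| * e ^- N)).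
    by rewrite ler_wpM2r ?ler_norm// invr_ge0 exprn_ge0.
  by rewrite ler_wpM2l// ler_expN.
rewrite (le_trans (modc_le _))//= mulrDl lerD//.
  apply: (aux _ N1); first by rewrite leq_addr.
  by move: x Kx; near: e.
apply: (aux _ N2); first by rewrite leq_addl.
by move: x Kx; near: e.
Unshelve. all: by end_near. Qed.

Lemma negligible_parts U (u : @net R d) : negligible_part U (fun e x => complex.Re (u e x)) ->
  negligible_part U (fun e x => complex.Im (u e x)) -> negligible_net U u.
Proof.
move=> [sv mv] [sw mw]; split=> [e e01|K cK KU beta m]; first by split; [exact: sv|exact: sw].
have [M1 H1] := mv K cK KU beta m; have [M2 H2] := mw K cK KU beta m.
exists (M1 + M2); near=> e => x Kx.
rewrite (le_trans (modc_le _))//= mulrDl lerD//; by move: x Kx; near: e.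
Unshelve. all: by end_near. Qed.

(** Around each point of K an r-ball inside V leaves the margin r/2 to all the points of its half;
    compactness makes the margin uniform. *)
Lemma compact_open_margin (K V : set E) : compact K -> open V -> K `<=` V ->
  exists2 r : R, 0 < r & forall x y, K x -> (forall i, `|coord i x - coord i y| < r) -> V y.
Proof.
move=> cK oV KV.
have cov : near_covering K by exact/compact_near_coveringP.
pose P (r : R) (x : E) := forall y, (forall i, `|coord i x - coord i y| < r) -> V y.
have near_P : \forall r \near (0 : R)^'+, K `<=` P r.
  apply: cov => x Kx.
  have [r /= r0 br] : nbhs_ball x V by apply/nbhs_ballP; apply: open_nbhs_nbhs; split => //; exact: KV.
  exists (ball x (r / 2), [set e | 0 < e < r / 2]) => /=.
    split; first by apply: nbhsx_ballx; rewrite divr_gt0.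
    near=> e; apply/andP; split; first by near: e; exact: nbhs_right_gt.
    by near: e; apply: nbhs_right_lt; rewrite divr_gt0.
  move=> [x' e] /= [bx' /andP[e0 er]] y Hy; apply: br; split => // j i.
  rewrite ord1 -ball_normE /=.
  have [_ /(_ ord0 i)] := bx'; rewrite -ball_normE /= => h1.
  have h2 := Hy i; rewrite /coord in h2.
  have -> : x ord0 i - y ord0 i = (x ord0 i - x' ord0 i) + (x' ord0 i - y ord0 i) by ring.
  rewrite (le_lt_trans (ler_normD _ _))// [r]splitr ltrD// (lt_trans h2)//.
have near0 : \forall r \near (0 : R)^'+, 0 < r by exact: nbhs_right_gt.
have /filter_ex[r [r0 HP]] : \forall r \near (0 : R)^'+, 0 < r /\ K `<=` P r by exact: filterI.
by exists r => // x y Kx; exact: HP.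
Unshelve. all: by end_near. Qed.
End real_nets.

Section regularization.
Context {R : realType} {d : nat}.
Local Notation E := 'rV[R]_d.+1.
Variables (s : R) (k : nat) (s0 : 0 < s).
Implicit Types (a : R -> E -> R) (f : E -> R).

(** Direction 0 comes first in the enumeration, so derivatives along e_0 placed before the word of a
    multi-index again form such a word. Hence partial derivatives never have to be commuted. *)
Lemma mi_word_cons (j : nat) (beta : mindex d.+1) :
  nseq j ord0 ++ mi_word beta = mi_word [ffun i => ((if i == ord0 then j else 0) + beta i)%N].
Proof.
rewrite /mi_word enum_ordSl /= ffunE eqxx nseqD -catA; congr (_ ++ (_ ++ _)).
by congr flatten; rewrite -!map_comp; apply: eq_map => i /=; rewrite ffunE.
Qed.

Lemma mi_word_nseq (j : nat) :
  mi_word [ffun i : 'I_d.+1 => if i == ord0 then j else 0%N] = nseq j ord0.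
Proof.
rewrite /mi_word enum_ordSl /= ffunE eqxx (_ : flatten _ = [::]) ?cats0//.
rewrite -map_comp; elim: (enum _) => //= i l ->; by rewrite ffunE.
Qed.

(** Schwartz decay of a real function, with powers of one coordinate in place of monomials. *)
Definition real_decay f := smooth_on setT f /\
  forall (beta : mindex d.+1) q, exists2 M, 0 <= M & forall z i,
    `|coord i z| ^+ q * `|partials (mi_word beta) f z| <= M.

Lemma schwartz_real_decay (rho : E -> R[i]) : schwartz rho ->
  real_decay (fun x => complex.Re (rho x)) /\ real_decay (fun x => complex.Im (rho x)).
Proof.
move=> [[sr si] H].
have key (beta : mindex d.+1) q : exists2 M, 0 <= M & forall z i,
    `|coord i z| ^+ q * modc (mderiv beta rho z) <= M.
  have /choice[M HM] : forall i : 'I_d.+1, exists M : R, forall x : E,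
      `|coord i x| ^+ q * modc (mderiv beta rho x) <= M.
    move=> i; have [M HM] := H beta [ffun j => if j == i then q else 0%N].
    exists M => x; apply: le_trans (HM x); rewrite Normc.normcM modcR.
    rewrite /monomial (bigD1 i)//= big1 ?mulr1; last first.
      by move=> j ji; rewrite ffunE (negbTE ji) expr0.
    by rewrite ffunE eqxx normrX.
  exists (\sum_i `|M i|); first exact: sumr_ge0.
  move=> z i; rewrite (bigD1 i)//=; apply: (le_trans (HM i z)).
  by rewrite (le_trans (ler_norm _))// lerDl sumr_ge0.
split; split => // beta q; have [M M0 HM] := key beta q; exists M => // z i;
  apply: le_trans (HM z i); rewrite ler_wpM2l ?exprn_ge0//.
  exact: (Re_le_modc (mderiv beta rho z)).
exact: (Im_le_modc (mderiv beta rho z)).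
Qed.

(** This covers both a fixed test function and the growing cutoff [cube_bump (e *: x)], whose width
    in x_0 is of order 1/e. Derivatives are bounded on the ray only, where they are evaluated. *)
Definition cutoff_family T a := [/\ forall e, 0 < e <= 1 -> smooth_on setT (a e),
  forall e, 0 < e <= 1 -> supp0 (T / e) (a e) &
  forall j, exists2 M, 0 <= M & forall e t, 0 < e <= 1 ->
    `|partials (nseq j ord0) (a e) (ray t)| <= M].

Definition regularized a f e x := e ^- d.+1 * raylocal s e^-1 k (a e) f x.

(** The constant of [raylocal_estimate] for c = 1/e and a slab of width T / e, times the
    normalization of the mollifier, is polynomial in 1/e. *)
Lemma prefactor_bound T n : 0 <= T -> exists N, exists2 C, 0 <= C & forall e, 0 < e <= 1 ->
  e ^- d.+1 * ((1 + `|e^-1|) ^+ k * `|e^-1| ^+ n * tpow s (T / e) * (T / e)) <= C * e ^- N.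
Proof.
move=> T0; have [N0 HN0] := tpow_leX s.
exists (d.+1 + (k + n + N0 + 1))%N, (2 ^+ k * T `^ s * T).
  by rewrite !mulr_ge0 ?exprn_ge0 ?powR_ge0.
move=> e /andP[e0 e1]; have b0 : 0 < e^-1 by rewrite invr_gt0.
have b1 : 1 <= e^-1 by rewrite invf_ge1.
rewrite gtr0_norm// -!exprVn exprD [leRHS]mulrCA ler_wpM2l ?exprn_ge0 ?(ltW b0)//.
rewrite !exprD expr1.
have h1 : (1 + e^-1) ^+ k <= 2 ^+ k * e^-1 ^+ k.
  by rewrite -exprMn lerXn2r ?nnegrE ?addr_ge0 ?mulr_ge0 ?(ltW b0)//; lra.
have h2 : tpow s (T / e) <= T `^ s * e^-1 ^+ N0.
  by rewrite tpowM// ler_wpM2l ?powR_ge0// HN0.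
apply: (@le_trans _ _ (2 ^+ k * e^-1 ^+ k * e^-1 ^+ n * (T `^ s * e^-1 ^+ N0) * (T / e))).
  have p1 : 0 <= e^-1 ^+ n by rewrite exprn_ge0// ltW.
  rewrite ler_wpM2r//; first by rewrite mulr_ge0// ltW.
  apply: ler_pM => //.
  - by rewrite mulr_ge0// exprn_ge0// addr_ge0// ltW.
  - exact: tpow_ge0.
  - exact: ler_wpM2r.
by rewrite le_eqVlt; apply/orP; left; apply/eqP; ring.
Qed.

Lemma regularized_smooth T a f e : 0 <= T -> cutoff_family T a -> smooth_on setT f ->
  0 < e <= 1 -> smooth_on setT (raylocal s e^-1 k (a e) f) /\ smooth_on setT (regularized a f e).
Proof.
move=> T0 [sa aT _] sf e01; have Te : 0 <= T / e by case/andP: e01 => /ltW e0 _; rewrite divr_ge0.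
have [sl _] := raylocal_estimate s0 e^-1 k Te (sa e e01) sf (aT e e01).
split; first exact: sl.
apply: (smooth_ext (@openT E) _
  (smooth_lin (e ^- d.+1) 0 (@openT E) sl (@smooth_cst _ _ setT 0))) => x _.
by rewrite mulr0 addr0.
Qed.

Lemma regularized_partials T a f e w x : 0 <= T -> cutoff_family T a -> smooth_on setT f ->
  0 < e <= 1 -> partials w (regularized a f e) x = e ^- d.+1 * partials w (raylocal s e^-1 k (a e) f) x.
Proof.
move=> T0 ca sf e01; have [/smoothP sl _] := regularized_smooth T0 ca sf e01.
have /smoothP s00 := @smooth_cst R d.+1 setT 0.
have [_] := partials_lin (e ^- d.+1) 0 (@openT E) (sl (size w)) (s00 _) (I : setT x).
have -> : regularized a f e = fun y => e ^- d.+1 * raylocal s e^-1 k (a e) f y + 0 * 0.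
  by apply/funext => y; rewrite mulr0 addr0.
by move=> ->; rewrite mul0r addr0.
Qed.

Lemma decay_uniform f beta q : real_decay f -> exists2 M, 0 <= M & forall j z i, (j <= k)%N ->
  `|coord i z| ^+ q * `|partials (nseq j ord0 ++ mi_word beta) f z| <= M.
Proof.
move=> [_ H].
have /choice[M HM] : forall j : 'I_k.+1, exists M : R, forall (z : E) i,
    `|coord i z| ^+ q * `|partials (nseq j ord0 ++ mi_word beta) f z| <= M.
  move=> j; have [M _ HM] := H [ffun i => ((if i == ord0 then j : nat else 0) + beta i)%N] q.
  by exists M => z i; rewrite mi_word_cons; exact: HM.
exists (\sum_j `|M j|); first exact: sumr_ge0.
move=> j z i jk; have := HM (Ordinal (jk : (j < k.+1)%N)) z i => /= /le_trans; apply.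
rewrite (bigD1 (Ordinal (jk : (j < k.+1)%N)))//=.
by rewrite (le_trans (ler_norm _))// lerDl sumr_ge0.
Qed.

Lemma cutoff_uniform T a : cutoff_family T a -> exists2 M, 0 <= M & forall i e t, (i <= k)%N ->
  0 < e <= 1 -> `|partials (nseq i ord0) (a e) (ray t)| <= M.
Proof.
move=> [_ _ H].
have /choice[M HM] : forall j : 'I_k.+1, exists M : R, forall e t,
    0 < e <= 1 -> `|partials (nseq j ord0) (a e) (ray t)| <= M.
  by move=> j; have [M _ HM] := H j; exists M.
exists (\sum_j `|M j|); first exact: sumr_ge0.
move=> j e t jk e01; have := HM (Ordinal (jk : (j < k.+1)%N)) e t e01 => /= /le_trans; apply.
rewrite (bigD1 (Ordinal (jk : (j < k.+1)%N)))//=.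
by rewrite (le_trans (ler_norm _))// lerDl sumr_ge0.
Qed.

Lemma regularized_moderate T a f : 0 <= T -> cutoff_family T a -> real_decay f ->
  moderate_part setT (regularized a f).
Proof.
move=> T0 ca df; have [sf _] := df; split=> [e e01|K cK _ beta].
  by have [] := regularized_smooth T0 ca sf e01.
have [N [C C0 HC]] := prefactor_bound (size (mi_word beta)) T0.
have [M1 M10 H1] := cutoff_uniform ca.
have [M2 M20 H2] := decay_uniform beta 0 df.
exists N, (C * (M1 * M2)); near=> e => x _.
have e01 : 0 < e <= 1 by near: e; exact: near01.
have e0 : 0 < e by case/andP: e01.
have Te : 0 <= T / e by rewrite divr_ge0// ltW.
have [sa aT _] := ca; have [_ est] := raylocal_estimate s0 e^-1 k Te (sa e e01) sf (aT e e01).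
have B : forall i j t, (i <= k)%N -> (j <= k)%N -> 0 <= t <= T / e ->
      `|partials (nseq i ord0) (a e) (ray t)| *
      `|partials (nseq j ord0 ++ mi_word beta) f (e^-1 *: (x - ray t))| <= M1 * M2.
  move=> i j t ik jk _; rewrite ler_pM ?H1//.
  by have := H2 j (e^-1 *: (x - ray t)) ord0 jk; rewrite expr0 mul1r.
rewrite (regularized_partials _ _ T0 ca sf e01) normrM ger0_norm ?invr_ge0 ?exprn_ge0 ?(ltW e0)//.
have eD : 0 <= e ^- d.+1 by rewrite invr_ge0 exprn_ge0// ltW.
apply: (le_trans (ler_wpM2l eD (est _ x _ B))).
rewrite [leLHS]mulrA [leRHS]mulrAC ler_wpM2r ?mulr_ge0//; exact: HC.
Unshelve. all: by end_near. Qed.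

(** When x and the point of the ray are r apart in some coordinate, the argument of f has a
    coordinate of size at least r / e, so decay of order q gives e^q. *)
Lemma far_decay f beta q (r : R) : 0 < r -> real_decay f -> exists2 M, 0 <= M &
  forall e x t j, 0 < e <= 1 -> (j <= k)%N -> (exists i, r <= `|coord i x - coord i (ray t)|) ->
  `|partials (nseq j ord0 ++ mi_word beta) f (e^-1 *: (x - ray t))| <= M * e ^+ q.
Proof.
move=> r0 df; have [M M0 HM] := decay_uniform beta q df.
exists (M / r ^+ q); first by rewrite divr_ge0// exprn_ge0// ltW.
move=> e x t j /andP[e0 e1] jk [i ri].
have := HM j (e^-1 *: (x - ray t)) i jk.
have -> : coord i (e^-1 *: (x - ray t)) = e^-1 * (coord i x - coord i (ray t)).
  by rewrite /coord !mxE.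
set z := `|partials _ _ _| => H; rewrite mulrAC ler_pdivlMr ?exprn_gt0// mulrC.
rewrite -ler_pdivrMr ?exprn_gt0//; apply: le_trans H.
have -> : r ^+ q * z / e ^+ q = (r / e) ^+ q * z by rewrite expr_div_n mulrAC.
rewrite ler_wpM2r ?normr_ge0// lerXn2r ?nnegrE ?normr_ge0// ?divr_ge0 ?(ltW r0) ?(ltW e0)//.
by rewrite normrM gtr0_norm ?invr_gt0// mulrC ler_wpM2l// invr_ge0 ltW.
Qed.

(** Locality of the regularization. For x in K, a point of the ray is either at distance at least r
    from x, where f is smaller than any power of e, or in V, where all derivatives of the cutoff
    vanish. The additional order N compensates for [prefactor_bound]. *)
Lemma regularized_negligible T a f (V : set E) : 0 <= T -> cutoff_family T a -> real_decay f ->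
  open V -> (\forall e \near (0 : R)^'+, forall y, V y -> a e y = 0) ->
  negligible_part V (regularized a f).
Proof.
move=> T0 ca df oV aV; have [sf _] := df; split=> [e e01|K cK KV beta m].
  by have [_] := regularized_smooth T0 ca sf e01; exact: sub_smooth (@subsetT _ _).
have [r r0 Hr] := compact_open_margin cK oV KV.
have [N [C C0 HC]] := prefactor_bound (size (mi_word beta)) T0.
have [M1 M10 H1] := cutoff_uniform ca.
have [M2 M20 H2] := far_decay beta (m + N) r0 df.
exists (C * (M1 * M2)); near=> e => x Kx.
have e01 : 0 < e <= 1 by near: e; exact: near01.
have e0 : 0 < e by case/andP: e01.
have Te : 0 <= T / e by rewrite divr_ge0// ltW.
have aVe : forall y, V y -> a e y = 0 by near: e.
have [sa aT _] := ca; have [_ est] := raylocal_estimate s0 e^-1 k Te (sa e e01) sf (aT e e01).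
have B : forall i j t, (i <= k)%N -> (j <= k)%N -> 0 <= t <= T / e ->
      `|partials (nseq i ord0) (a e) (ray t)| *
      `|partials (nseq j ord0 ++ mi_word beta) f (e^-1 *: (x - ray t))| <= M1 * (M2 * e ^+ (m + N)).
  move=> i j t ik jk _; have [far|near_] := pselect (exists i, r <= `|coord i x - coord i (ray t)|).
    by rewrite ler_pM ?H1// H2.
  have Vt : V (ray t).
    apply: (Hr x) => // l; rewrite ltNge; apply/negP => rl; apply: near_.
    by exists l.
  rewrite (partials_ext (g := fun=> 0) (nseq i ord0) oV aVe Vt).
  rewrite (_ : partials _ (fun=> 0) (ray t) = 0) ?normr0 ?mul0r.
    by rewrite !mulr_ge0// exprn_ge0// ltW.
  elim: {ik} i => //= i IH; rewrite (_ : partial ord0 (fun=> 0) = fun=> 0)//.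
  by apply/funext => y; rewrite /partial (@derive_cst R _ _ (0 : R)).
rewrite (regularized_partials _ _ T0 ca sf e01) normrM ger0_norm ?invr_ge0 ?exprn_ge0 ?(ltW e0)//.
have eD : 0 <= e ^- d.+1 by rewrite invr_ge0 exprn_ge0// ltW.
apply: (le_trans (ler_wpM2l eD (est _ x _ B))).
have e2 : 0 <= M1 * (M2 * e ^+ (m + N)) by rewrite !mulr_ge0// exprn_ge0// ltW.
rewrite [leLHS]mulrA; apply: (le_trans (ler_wpM2r e2 (HC e e01))).
have eN : e ^+ N != 0 by rewrite expf_neq0// gt_eqF.
rewrite exprD le_eqVlt; apply/orP; left; apply/eqP; field; exact: eN.
Unshelve. all: by end_near. Qed.
End regularization.

Section cutoffs.
Context {R : realType} {d : nat}.
Local Notation E := 'rV[R]_d.+1.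
Implicit Types (a b : R -> E -> R) (f g : E -> R).

Lemma cutoff_family_bump : cutoff_family 2 (fun (e : R) (x : E) => cube_bump (e *: x)).
Proof.
have oT := @openT E; have sb := @smooth_cube_bump R d.+1.
have E0 e : (fun x : E => cube_bump (e *: x)) = (fun x => cube_bump (e *: x + 0)).
  by apply/funext => x; rewrite addr0.
split=> [e e01|e /andP[e0 _] x xe|j].
- by rewrite E0; exact: smooth_affine.
- apply: (@cube_bump0 _ _ _ ord0); rewrite /coord mxE normrM gtr0_norm//.
  by rewrite mulrC -ler_pdivrMr// ltW.
- have [M M0 HM] := compact_supp_bounded
    (smooth_continuous (smooth_partials (nseq j ord0) sb))
    (let: ex_intro2 K cK H := @cube_bump_supp R d in
     ex_intro2 _ _ K cK (partials_outside (nseq j ord0) cK H)).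
  exists M; first exact: M0.
  move=> e t /andP[e0 e1]; rewrite E0.
  have /smoothP k1 := sb.
  rewrite (partials_affine e 0 (k1 (size (nseq j ord0)))) normrM -[leRHS]mul1r.
  by rewrite ler_pM// normrX gtr0_norm// exprn_ile1// ltW.
Qed.

Lemma cutoff_family_cst T g : smooth_on setT g -> 0 <= T ->
  (exists2 K : set E, compact K & (forall x, ~ K x -> g x = 0) /\
    forall x, K x -> `|coord ord0 x| <= T) -> cutoff_family T (fun=> g).
Proof.
move=> sg T0 [K cK [g0 KT]]; split=> // [e /andP[e0 e1] x xT|j].
  apply: g0 => Kx; have := KT x Kx; rewrite leNgt => /negP; apply.
  by apply: le_lt_trans xT; rewrite ler_peMr// invf_ge1.
have [M M0 HM] := compact_supp_bounded (smooth_continuous (smooth_partials (nseq j ord0) sg))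
  (ex_intro2 _ _ K cK (partials_outside (nseq j ord0) cK g0)).
by exists M.
Qed.

Lemma cutoff_family_lin T (p q : R) a b : cutoff_family T a -> cutoff_family T b ->
  cutoff_family T (fun e x => p * a e x + q * b e x).
Proof.
move=> [sa za ma] [sb zb mb]; split=> [e e01|e e01 x xT|j].
- by apply: smooth_lin; [exact: openT|exact: sa|exact: sb].
- by rewrite (za e e01 x xT) (zb e e01 x xT) !mulr0 addr0.
- have [M M0 HM] := ma j; have [N N0 HN] := mb j.
  exists (`|p| * M + `|q| * N); first by rewrite addr_ge0// mulr_ge0.
  move=> e t e01; have [/smoothP s1 /smoothP s2] := (sa e e01, sb e e01).
  have [_ ->] := partials_lin p q (@openT E) (s1 (size (nseq j ord0))) (s2 _) (I : setT (ray t)).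
  rewrite (le_trans (ler_normD _ _))// !normrM lerD// ler_wpM2l//; [exact: HM|exact: HN].
Qed.

Lemma cutoff_family_le T T' a : T <= T' -> cutoff_family T a -> cutoff_family T' a.
Proof.
move=> TT' [sa za ma]; split=> // e e01 x xT; apply: (za e e01).
by apply: le_lt_trans xT; rewrite ler_wpM2r// invr_ge0; case/andP: e01 => /ltW.
Qed.

Variables (s : R) (k : nat) (s0 : 0 < s).

Lemma regularized_lin T (p q : R) a b f e x : 0 <= T -> cutoff_family T a -> cutoff_family T b ->
  smooth_on setT f -> 0 < e <= 1 ->
  regularized s k (fun e x => p * a e x + q * b e x) f e x =
  p * regularized s k a f e x + q * regularized s k b f e x.
Proof.
move=> T0 [sa za _] [sb zb _] sf e01; rewrite /regularized /raylocal.
have Te : 0 <= T / e by case/andP: e01 => /ltW e0 _; rewrite divr_ge0.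
have oT := @openT E; have sr := reflect_smooth_real e^-1 x sf.
transitivity (e ^- d.+1 * (rayd s k (fun y => p * (a e y * f (e^-1 *: (x - y))) +
    q * (b e y * f (e^-1 *: (x - y)))))).
  by congr (_ * _); apply: eq_rayd => y; ring.
have z1 : supp0 (T / e) (fun y => a e y * f (e^-1 *: (x - y))).
  by move=> y yT; rewrite (za e e01 y yT) mul0r.
have z2 : supp0 (T / e) (fun y => b e y * f (e^-1 *: (x - y))).
  by move=> y yT; rewrite (zb e e01 y yT) mul0r.
rewrite (@rayd_lin _ _ _ s0 k (T / e) _ _ _ _ Te (smooth_mul oT (sa e e01) sr)
  (smooth_mul oT (sb e e01) sr) z1 z2); ring.
Qed.
End cutoffs.

Section ray_distribution.
Context {R : realType} {d : nat}.
Local Notation E := 'rV[R]_d.+1.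
Local Notation Rd := (Rd R d.+1).
Local Notation test := (@test_function R d.+1).
Variables (s : R) (k : nat) (s0 : 0 < s).

Lemma test_bounded_support (phi : test) : exists2 T, 0 < T & exists2 K : set E, compact K &
  (forall x, ~ K x -> phi x = 0) /\ forall x, K x -> `|coord ord0 x| <= T.
Proof.
have [K cK phi0] := test_supp phi; have [r r0 Hr] := compact_coord_bounded cK.
by exists r => //; exists K => //; split => // x; exact: Hr.
Qed.

Lemma test_supp0 (phi : test) T (K : set E) : (forall x, ~ K x -> phi x = 0) ->
  (forall x, K x -> `|coord ord0 x| <= T) ->
  supp0 T (fun x => complex.Re (phi x)) /\ supp0 T (fun x => complex.Im (phi x)).
Proof.
move=> phi0 KT; have H x : T < `|coord ord0 x| -> phi x = 0.
  by move=> xT; apply: phi0 => Kx; have := KT x Kx; rewrite leNgt xT.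
by split=> x xT; rewrite H.
Qed.

Definition ray_pairing (phi : test) : R[i] :=
  rayd s k (fun x => complex.Re (phi x)) +i* rayd s k (fun x => complex.Im (phi x)).

Lemma ray_pairing_linear (c : R[i]) (phi psi chi : test) :
  (forall x, chi x = c * phi x + psi x) -> ray_pairing chi = c * ray_pairing phi + ray_pairing psi.
Proof.
move=> H; have [T1 T10 [K1 cK1 [z1 b1]]] := test_bounded_support phi.
have [T2 T20 [K2 cK2 [z2 b2]]] := test_bounded_support psi.
pose T := T1 + T2; have TT : 0 <= T by rewrite addr_ge0// ltW.
have l1 x : K1 x -> `|coord ord0 x| <= T.
  by move=> /b1/le_trans; apply; rewrite lerDl ltW.
have l2 x : K2 x -> `|coord ord0 x| <= T.
  by move=> /b2/le_trans; apply; rewrite lerDr ltW.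
have [p1 p2] := test_supp0 z1 l1; have [p3 p4] := test_supp0 z2 l2.
have [r1 r2] := test_smooth phi; have [r3 r4] := test_smooth psi.
have oT := @openT E.
have key (u v : R) (f g h : E -> R) : smooth_on setT f -> smooth_on setT g -> smooth_on setT h ->
    supp0 T f -> supp0 T g -> supp0 T h ->
    rayd s k (fun x => u * f x + v * g x + h x) = u * rayd s k f + v * rayd s k g + rayd s k h.
  move=> sf sg sh zf zg zh.
  transitivity (rayd s k (fun x => 1 * (u * f x + v * g x) + 1 * h x)).
    by apply: eq_rayd => x; rewrite !mul1r.
  have zfg : supp0 T (fun x => u * f x + v * g x).
    by move=> x xT; rewrite zf// zg// !mulr0 addr0.
  rewrite (@rayd_lin _ _ _ s0 k T _ _ _ _ TT (smooth_lin u v oT sf sg) sh zfg zh).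
  by rewrite (@rayd_lin _ _ _ s0 k T _ _ _ _ TT sf sg zf zg) !mul1r.
rewrite /ray_pairing; case: c H => c1 c2 H.
apply/eqP; rewrite eq_complex /=; apply/andP; split; apply/eqP.
  rewrite -[RHS]/(c1 * _ - c2 * _ + _) -mulNr -key//; apply: eq_rayd => x.
  by rewrite H; case: (phi x) (psi x) => [x1 x2] [y1 y2] /=; rewrite mulNr.
rewrite -key//; apply: eq_rayd => x.
by rewrite H; case: (phi x) (psi x) => [x1 x2] [y1 y2] /=.
Qed.

Lemma ray_pairing_continuous (K : set E) : compact K -> exists (m : nat) (C : R),
  forall phi : test, (forall x, ~ K x -> phi x = 0) -> forall M : R,
    (forall beta, (mdeg beta <= m)%N -> forall x, modc (mderiv beta phi x) <= M) ->
    modc (ray_pairing phi) <= C * M.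
Proof.
move=> cK; have [T T0 HT] := compact_coord_bounded cK.
exists k, (2 * (tpow s T * T)) => phi phi0 M HM.
have KT x : K x -> `|coord ord0 x| <= T by exact: HT.
have [z1 z2] := test_supp0 phi0 KT; have [r1 r2] := test_smooth phi.
pose beta : mindex d.+1 := [ffun i => if i == ord0 then k else 0%N].
have bw : mi_word beta = nseq k ord0 by exact: mi_word_nseq.
have bk : (mdeg beta <= k)%N.
  rewrite /mdeg (bigD1 ord0)//= big1 ?addn0 ?ffunE ?eqxx//.
  by move=> i /negbTE i0; rewrite ffunE i0.
have HMb := HM beta bk.
rewrite (le_trans (modc_le _))// -mulrA mulr2n mulrDl mul1r.
have -> : tpow s T * T * M = tpow s T * M * T by ring.
have aux (f : E -> R) : smooth_on setT f -> supp0 T f -> (forall x, `|partials (nseq k ord0) f x| <= M) ->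
    `|rayd s k f| <= tpow s T * M * T.
  move=> sf zf fM; apply: ray_integral_bound => //; first exact: ltW.
    by apply: smooth_continuous; exact: smooth_partials.
  exact: supp0_partials.
rewrite lerD//; apply: aux => // x; apply: le_trans (HMb x); rewrite /mderiv bw.
  exact: (Re_le_modc (cpartials (nseq k ord0) phi x)).
exact: (Im_le_modc (cpartials (nseq k ord0) phi x)).
Qed.

Definition ray_distribution : schwartz_distribution R d.+1 :=
  SchwartzDistribution ray_pairing_linear ray_pairing_continuous.

(** In dimension d + 1, the dilation contributes l^(-d-1), the k derivatives l^(-k) and the ray
    integral l^(s+1); the exponents add up to alpha. *)
Lemma ray_distribution_homogeneous alpha : s = alpha + d%:R + k%:R ->
  distr_homogeneous alpha ray_distribution.
Proof.
move=> sE l l0 phi; have ln : l != 0 by rewrite gt_eqF.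
have [T T0 [K cK [z b]]] := test_bounded_support phi.
have [z1 z2] := test_supp0 z b; have [r1 r2] := test_smooth phi.
have key (f : E -> R) : smooth_on setT f -> supp0 T f ->
    rayd s k (fun x => l ^- d.+1 * f (l^-1 *: x)) = l `^ alpha * rayd s k f.
  move=> sf zf.
  have spf := smooth_partials (nseq k ord0) sf.
  have zpf := supp0_partials (nseq k ord0) zf.
  have -> : rayd s k (fun x => l ^- d.+1 * f (l^-1 *: x)) =
      ray_integral s (fun x => (l ^- d.+1 * l^-1 ^+ k) * partials (nseq k ord0) f (l^-1 *: x) + 0 * 0).
    rewrite /rayd; congr ray_integral; apply/funext => x.
    have /smoothP kf := sf.
    have /smoothP kl : smooth_on setT (fun x => f (l^-1 *: x + 0)) by exact: smooth_affine.
    have /smoothP k0 := @smooth_cst R d.+1 setT 0.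
    have [_] := partials_lin (l ^- d.+1) 0 (@openT E) (kl (size (nseq k ord0))) (k0 _) (I : setT x).
    rewrite mul0r addr0 (partials_affine l^-1 0 (kf _)) addr0 size_nseq => H.
    rewrite mul0r addr0 in H; rewrite -mulrA -H; congr (partials _ _ x).
    by apply/funext => y; rewrite !addr0.
  have Tl : 0 <= l * T by rewrite mulr_ge0// ltW.
  have cg : continuous (fun x : E => partials (nseq k ord0) f (l^-1 *: x)).
    apply: (@continuous_compf _ _ _ (partials (nseq k ord0) f)); first exact: smooth_continuous.
    exact: scaler_continuous.
  have zg : supp0 (l * T) (fun x => partials (nseq k ord0) f (l^-1 *: x)).
    move=> x xT; apply: zpf; rewrite /coord mxE normrM gtr0_norm ?invr_gt0//.
    by rewrite ltr_pdivlMl.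
  rewrite (@ray_integral_lin _ _ _ s0 (l * T) _ 0 _ (fun=> 0))//; last exact: cst_continuous.
  rewrite mul0r addr0 (ray_integral_scale s0 (ltW T0) l0 (smooth_continuous spf) zpf).
  rewrite /rayd mulrA; congr (_ * _).
  have -> : s + 1 = alpha + (d.+1 + k)%:R by rewrite sE natrD -natr1; ring.
  rewrite powRD ?ln ?implybT// powR_mulrn ?(ltW l0)// exprD exprVn.
  have l1 : l ^+ d.+1 != 0 by rewrite expf_neq0.
  have l2 : l ^+ k != 0 by rewrite expf_neq0.
  by field; exact/andP.
rewrite /= /ray_pairing /=.
have -> : (fun x => complex.Re ((l ^- d.+1)%:C * phi (l^-1 *: x))) =
    (fun x => l ^- d.+1 * complex.Re (phi (l^-1 *: x))).
  by apply/funext => x; rewrite ReMc /= oppr0 mul0r addr0.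
have -> : (fun x => complex.Im ((l ^- d.+1)%:C * phi (l^-1 *: x))) =
    (fun x => l ^- d.+1 * complex.Im (phi (l^-1 *: x))).
  by apply/funext => x; rewrite ImMc /= mul0r addr0.
rewrite (key _ r1 z1) (key _ r2 z2).
by apply/eqP; rewrite eq_complex /= !mul0r subr0 addr0 !eqxx.
Qed.

Section embedding.
Variable rho : mollifier R d.+1.

Let rhor (x : E) := complex.Re (rho x).
Let rhoi (x : E) := complex.Im (rho x).

Let dr : real_decay rhor. Proof. by have [] := schwartz_real_decay (moll_schwartz rho). Qed.
Let di : real_decay rhoi. Proof. by have [] := schwartz_real_decay (moll_schwartz rho). Qed.

Lemma mollify_parts (psi : test) (e : R) (x : E) :
  mollify rho psi ray_distribution e x =
  (1 * regularized s k (fun=> fun y => complex.Re (psi y)) rhor e x +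
    (-1) * regularized s k (fun=> fun y => complex.Im (psi y)) rhoi e x) +i*
  (1 * regularized s k (fun=> fun y => complex.Re (psi y)) rhoi e x +
    1 * regularized s k (fun=> fun y => complex.Im (psi y)) rhor e x).
Proof.
have [T T0 [K cK [z b]]] := test_bounded_support psi.
have [z1 z2] := test_supp0 z b; have [r1 r2] := test_smooth psi.
have [sr _] := dr; have [si _] := di; have oT := @openT E.
have s1 (f : E -> R) : smooth_on setT f -> smooth_on setT (fun y => f (e^-1 *: (x - y))).
  exact: reflect_smooth_real.
have zM (f g : E -> R) : supp0 T f -> supp0 T (fun y => f y * g y).
  by move=> zf y yT; rewrite zf// mul0r.
have key (u : R) (f1 f2 g1 g2 : E -> R) : smooth_on setT f1 -> smooth_on setT f2 ->
    smooth_on setT g1 -> smooth_on setT g2 -> supp0 T f1 -> supp0 T f2 ->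
    rayd s k (fun y => e ^- d.+1 * (f1 y * g1 (e^-1 *: (x - y))) +
      (u * e ^- d.+1) * (f2 y * g2 (e^-1 *: (x - y)))) =
    1 * regularized s k (fun=> f1) g1 e x + u * regularized s k (fun=> f2) g2 e x.
  move=> sf1 sf2 sg1 sg2 zf1 zf2.
  rewrite (@rayd_lin _ _ _ s0 k T _ _ _ _ (ltW T0) (smooth_mul oT sf1 (s1 _ sg1))
    (smooth_mul oT sf2 (s1 _ sg2)) (zM _ _ zf1) (zM _ _ zf2)).
  by rewrite /regularized /raylocal; ring.
rewrite -!key//= /mollify /convolve /= /ray_pairing /=.
apply: f_equal2; apply: eq_rayd => y.
  rewrite /rhor /rhoi; case: (psi y) => [p1 p2]; case: (rho _) => [q1 q2] /=; ring.
rewrite /rhor /rhoi; case: (psi y) => [p1 p2]; case: (rho _) => [q1 q2] /=; ring.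
Qed.

Lemma test_cutoffs (psi : test) : exists2 T, 2 <= T &
  cutoff_family T (fun=> fun y => complex.Re (psi y)) /\
  cutoff_family T (fun=> fun y => complex.Im (psi y)).
Proof.
have [T T0 [K cK [z b]]] := test_bounded_support psi; have [r1 r2] := test_smooth psi.
have T2 : 0 <= T + 2 by rewrite addr_ge0// ltW.
have KT x : K x -> `|coord ord0 x| <= T + 2 by move=> /b/le_trans; apply; rewrite lerDl.
exists (T + 2); first by rewrite lerDr ltW.
split; apply: cutoff_family_cst => //; exists K => //; split=> // x /z -> //.
Qed.

(** The distribution has no compact support, and a representative of iota(w) must be defined on the
    whole space. The cutoff [cube_bump (e *: y)] is 1 on any given bounded set once e is small, and
    its growth in width costs only a power of 1/e. *)
Definition global_net : @net R d.+1 := fun e x =>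
  regularized s k (fun e y => cube_bump (e *: y)) rhor e x +i*
  regularized s k (fun e y => cube_bump (e *: y)) rhoi e x.

Lemma global_net_moderate : moderate setT global_net.
Proof.
have cb := @cutoff_family_bump R d.
by apply: moderate_parts; apply: (regularized_moderate k s0 _ cb).
Qed.

Lemma mollify_moderate (V : openset R d.+1) (psi : test) :
  moderate V (mollify rho psi ray_distribution).
Proof.
have [T T2 [c1 c2]] := test_cutoffs psi; have T0 : 0 <= T by exact: le_trans T2.
apply: (restrict_moderate (U := setT)); first exact: subsetT.
have E1 : mollify rho psi ray_distribution = fun e x =>
  (1 * regularized s k (fun=> fun y => complex.Re (psi y)) rhor e x +
    (-1) * regularized s k (fun=> fun y => complex.Im (psi y)) rhoi e x) +i*
  (1 * regularized s k (fun=> fun y => complex.Re (psi y)) rhoi e x +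
    1 * regularized s k (fun=> fun y => complex.Im (psi y)) rhor e x).
  by apply/funext => e; apply/funext => x; exact: mollify_parts.
rewrite E1; apply: moderate_parts; apply: moderate_part_lin; try exact: openT;
  by apply: (regularized_moderate k s0 T0).
Qed.

Lemma negligible_part_ext (U : set E) (v w : R -> E -> R) :
  (forall e x, 0 < e <= 1 -> v e x = w e x) -> negligible_part U v -> negligible_part U w.
Proof.
move=> vw [sv mv]; split=> [e e01|K cK KU beta m].
  by rewrite -(_ : v e = w e); [exact: sv|apply/funext => x; exact: vw].
have [M HM] := mv K cK KU beta m; exists M; near=> e => x Kx.
have e01 : 0 < e <= 1 by near: e; exact: near01.
have <- : v e = w e by apply/funext => y; exact: vw.
by move: x Kx; near: e.
Unshelve. all: by end_near. Qed.

(** For small e both the bump and psi equal 1 on V. The difference of the nets is thus a combination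
    of regularizations whose cutoffs, the bump minus Re psi and Im psi, vanish on V, and
    [regularized_negligible] applies to each. *)
Lemma global_net_local (V : openset R d.+1) (psi : test) : compact (closure V) ->
  set_nbhs (closure V) [set x | psi x = 1] ->
  negligible_net V (global_net - mollify rho psi ray_distribution).
Proof.
move=> cV nV; have [T T2 [c1 c2]] := test_cutoffs psi; have T0 : 0 <= T by exact: le_trans T2.
have cb := cutoff_family_le T2 (@cutoff_family_bump R d).
have psi1 x : oset V x -> psi x = 1.
  move=> Vx; have /set_nbhsP[U [_ VU UP]] := nV.
  by apply: UP; apply: VU; exact: subset_closure.
have [r r0 Hr] := compact_coord_bounded cV.
have near_bump : \forall e \near (0 : R)^'+, forall y, oset V y -> cube_bump (e *: y) = 1.
  near=> e => y Vy; apply: cube_bump1 => i; rewrite /coord mxE normrM.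
  have e0 : 0 < e by near: e; exact: nbhs_right_gt.
  have er : e < r^-1 by near: e; apply: nbhs_right_lt; rewrite invr_gt0.
  rewrite gtr0_norm// -(mulVf (lt0r_neq0 r0)); apply: ler_pM => //; try exact: ltW.
  by apply: Hr; exact: subset_closure.
have cd := cutoff_family_lin 1 (-1) cb c1.
have d0 : \forall e \near (0 : R)^'+, forall y, oset V y ->
    1 * cube_bump (e *: y) + (-1) * complex.Re (psi y) = 0.
  near=> e => y Vy; rewrite psi1//=.
  have -> : cube_bump (e *: y) = 1 by move: y Vy; near: e.
  by rewrite mulr1 mulN1r subrr.
have i0 : \forall e \near (0 : R)^'+, forall y, oset V y -> complex.Im (psi y) = 0.
  by near=> e => y Vy; rewrite psi1.
have oV := oset_open V.
have n1 := regularized_negligible k s0 T0 cd dr oV d0.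
have n2 := regularized_negligible k s0 T0 cd di oV d0.
have n3 := regularized_negligible k s0 T0 c2 di oV i0.
have n4 := regularized_negligible k s0 T0 c2 dr oV i0.
have [sr _] := dr; have [si _] := di.
apply: negligible_parts.
  apply: negligible_part_ext (negligible_part_lin 1 1 oV n1 n3) => e x e01.
  rewrite (regularized_lin k s0 1 (-1) x T0 cb c1 sr e01).
  rewrite -[(global_net - _) e x]/(global_net e x - mollify rho psi ray_distribution e x).
  by rewrite mollify_parts /=; ring.
apply: negligible_part_ext (negligible_part_lin 1 (-1) oV n2 n4) => e x e01.
rewrite (regularized_lin k s0 1 (-1) x T0 cb c1 si e01).
rewrite -[(global_net - _) e x]/(global_net e x - mollify rho psi ray_distribution e x).
by rewrite mollify_parts /=; ring.
Unshelve. all: by end_near. Qed.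

Lemma ray_distribution_embedding :
  is_embedding rho ray_distribution (colombeau_class (to_moderate (U := Rd) global_net_moderate)).
Proof.
move=> V cV psi nV; exists (to_moderate (mollify_moderate V psi)) => //.
rewrite grestrict_class; apply/colombeau_eqP; exact: global_net_local.
Qed.
End embedding.
End ray_distribution.

(** * Half-line convolutions *)

Section arctan_kernel.
Context {R : realType}.
Implicit Types (f : R -> R).

(** The primitive atan of 1/(1 + t^2) stays below pi/2 < 2: this majorant gives bounds on half-line
    integrals that do not depend on the truncation. *)
Lemma iint_oneDsqr_bound a b f (B : R) : 0 <= B -> 0 <= a <= b -> continuous f ->
  (forall t, a <= t <= b -> `|f t| <= B / (1 + t ^+ 2)) -> `|iint a b f| <= 2 * B.
Proof.
move=> B0 /andP[a0 ab] cf fB; have b0 := le_trans a0 ab.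
have ck : continuous (fun t : R => (1 + t ^+ 2)^-1) by exact: continuous_oneDsqrV.
have cBk : continuous (fun t : R => B * (1 + t ^+ 2)^-1).
  by apply: continuousMf => //; exact: cst_continuous.
have kE c : 0 <= c -> iint 0 c (fun t => (1 + t ^+ 2)^-1) = atan c by exact: integral0_oneDsqr.
have kab : iint a b (fun t => (1 + t ^+ 2)^-1) <= 2.
  have := iint_chasles ck a0 ab; rewrite !kE// => E.
  have a1 : 0 <= atan a by rewrite -atan0 le_atan.
  have := atan_ltpi2 b; have := @pihalf_lt2 R; lra.
have up : iint a b (fun t => B * (1 + t ^+ 2)^-1) <= 2 * B.
  by rewrite iintZ// mulrC ler_wpM2r.
rewrite ler_norml; apply/andP; split.
  rewrite lerNl -iintN//; apply: le_trans up; apply: ler_iint => //.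
    by move=> t; apply: continuousN; exact: cf.
  by move=> t tab; rewrite (le_trans _ (fB t tab))// -normrN ler_norm.
apply: le_trans up; apply: ler_iint => // t tab.
by rewrite (le_trans _ (fB t tab))// ler_norm.
Qed.

Lemma integrable_oneDsqr (B : R) : 0 <= B ->
  (@lebesgue_measure R).-integrable setT (fun z => (B / (1 + z ^+ 2))%:E).
Proof.
move=> B0; have ck : continuous (fun t : R => (1 + t ^+ 2)^-1) by exact: continuous_oneDsqrV.
have k0 (t : R) : 0 <= (1 + t ^+ 2)^-1 by rewrite invr_ge0 addr_ge0 ?sqr_ge0.
have mk : measurable_fun setT (fun t : R => (1 + t ^+ 2)^-1) by exact: continuous_measurable_fun.
suff : (@lebesgue_measure R).-integrable setT (fun z : R => ((1 + z ^+ 2)^-1)%:E).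
  move=> H; have := integrableZl measurableT B H.
  by apply: eq_integrable => // z _; rewrite EFinM.
apply/integrableP; split; first exact/measurable_EFinP.
have -> : (\int[@lebesgue_measure R]_x `|((1 + x ^+ 2)^-1)%:E| =
    \int[@lebesgue_measure R]_x ((1 + x ^+ 2)^-1)%:E)%E.
  by apply: eq_integral => x _; rewrite gee0_abs// lee_fin.
rewrite ge0_symfun_integralT//; last by move=> x /=; rewrite sqrrN.
by rewrite -set_itvcy (@integral0y_oneDsqr R) -EFinM ltry.
Qed.
End arctan_kernel.

Section ray_kernel.
Context {R : realType} {d : nat}.
Local Notation E := 'rV[R]_d.+1.
Variables (s : R) (s0 : 0 < s).
Implicit Types (f : E -> R).

Lemma decay_weight f N : real_decay f -> exists2 C, 0 <= C & forall z,
  (1 + `|coord ord0 z|) ^+ N * `|f z| <= C.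
Proof.
move=> [_ H]; have w0 := @mi_word_nseq d 0.
have [M M0 HM] := H [ffun i => if i == ord0 then 0%N else 0%N] 0%N.
have [M' M'0 HM'] := H [ffun i => if i == ord0 then 0%N else 0%N] N.
exists (2 ^+ N * (M + M')); first by rewrite mulr_ge0 ?exprn_ge0// addr_ge0.
move=> z; have := HM z ord0; have := HM' z ord0; rewrite w0 expr0 mul1r => h2 h1.
set t := `|coord ord0 z| in h2 *; have t0 : 0 <= t by exact: normr_ge0.
have [t1|t1] := leP t 1.
  apply: ler_pM => //; first by rewrite exprn_ge0// addr_ge0.
    by rewrite lerXn2r// ?nnegrE ?addr_ge0//; lra.
  by rewrite (le_trans h1)// lerDl.
apply: (@le_trans _ _ ((2 * t) ^+ N * `|f z|)).
  by rewrite ler_wpM2r// lerXn2r// ?nnegrE ?addr_ge0 ?mulr_ge0//; lra.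
rewrite exprMn -mulrA ler_wpM2l ?exprn_ge0// (le_trans h2)//.
by rewrite lerDr.
Qed.

(** The factors A, 1 + t^2 and t^s are at most the powers 1, 2 and N of L (1 + |z_0|), which the
    decay of f absorbs. The free factor A serves three purposes: A = 1 + t gives a rate in the
    truncation, A = 1 + a/2 smallness far to the left of the ray, and A = 1 plain domination. *)
Lemma decay_kernel f : real_decay f -> exists P, exists2 C, 0 <= C &
  forall (L A t : R) z, 0 <= L -> 0 <= A -> 0 <= t ->
    1 + t <= L * (1 + `|coord ord0 z|) -> A <= L * (1 + `|coord ord0 z|) ->
    A * ((1 + t ^+ 2) * `|tpow s t * f z|) <= L ^+ P * C.
Proof.
move=> df; have [N HN] := tpow_leX s.
have [C C0 HC] := decay_weight (1 + 2 + N) df.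
exists (1 + 2 + N)%N, C => // L A t z L0 A0 t0 h1 h2.
set W := 1 + `|coord ord0 z| in h1 h2 *; have LW0 : 0 <= L * W by rewrite (le_trans A0).
have t1 : 0 <= 1 + t by rewrite addr_ge0.
have k1 : tpow s t <= (L * W) ^+ N.
  have : tpow s (1 + t) <= (1 + t) ^+ N by apply: HN; rewrite lerDl.
  move=> H; apply: (le_trans (tpow_le (ltW s0) (_ : t <= 1 + t))); first by rewrite lerDr.
  by apply: (le_trans H); rewrite lerXn2r// nnegrE.
have k2 : 1 + t ^+ 2 <= (L * W) ^+ 2.
  apply: (@le_trans _ _ ((1 + t) ^+ 2)); last by rewrite lerXn2r// nnegrE.
  by rewrite sqrrD expr1n -addrA lerD2l mul1r lerDr mulrn_wge0.
rewrite normrM ger0_norm ?tpow_ge0// !mulrA.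
apply: (@le_trans _ _ ((L * W) * (L * W) ^+ 2 * (L * W) ^+ N * `|f z|)).
  rewrite ler_wpM2r//; apply: ler_pM => //.
  - by rewrite mulr_ge0// addr_ge0// sqr_ge0.
  - exact: tpow_ge0.
  - by apply: ler_pM => //; rewrite addr_ge0// sqr_ge0.
rewrite -exprS -exprD -[(3 + N)%N]/(1 + 2 + N)%N exprMn -mulrA ler_wpM2l ?exprn_ge0//.
exact: HC.
Qed.

Definition half_conv T f y := rayconv 1 (tpow s) T f y.

Lemma half_conv_integrand f y : continuous f ->
  continuous (fun t => tpow s t * f (1 *: (y - ray t))).
Proof. by move=> cf; apply: rayconv_integrand => //; exact: tpow_continuous. Qed.

Lemma half_conv_kernel f (Y : R) : real_decay f -> 0 <= Y -> exists2 C, 0 <= C &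
  forall y t, `|coord ord0 y| <= Y -> 0 <= t ->
    `|tpow s t * f (1 *: (y - ray t))| <= C / (1 + t) / (1 + t ^+ 2).
Proof.
move=> df Y0; have [P [C C0 HC]] := decay_kernel df.
exists ((1 + Y) ^+ P * C); first by rewrite mulr_ge0// exprn_ge0// addr_ge0.
move=> y t yY t0; have t1 : 0 < 1 + t by rewrite ltr_wpDr.
have t2 : 0 < 1 + t ^+ 2 by rewrite ltr_wpDr// sqr_ge0.
rewrite ler_pdivlMr// ler_pdivlMr// mulrC [_ * (1 + t ^+ 2)]mulrC.
have z0 : coord ord0 (1 *: (y - ray t)) = coord ord0 y - t.
  by rewrite scale1r /coord !mxE eqxx mulr1.
have H : 1 + t <= (1 + Y) * (1 + `|coord ord0 (1 *: (y - ray t))|).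
  rewrite z0; set q := `|_ - _|; have q0 : 0 <= q by exact: normr_ge0.
  have : t <= q + `|coord ord0 y|.
    have -> : t = - (coord ord0 y - t) + coord ord0 y by ring.
    apply: (le_trans (ler_norm _)); apply: (le_trans (ler_normD _ _)).
    by rewrite normrN.
  have := mulr_ge0 Y0 q0; lra.
by apply: HC => //; [rewrite addr_ge0|exact: ltW].
Qed.

(* As [half_conv T f y] converges when [T] tends to infinity, its limit is 0. *)
Definition vanishing f := forall y (eps T0 : R), 0 < eps ->
  exists2 T, T0 <= T & `|half_conv T f y| <= eps.

(** Some truncation beyond T is as small as desired, so the one at T is, up to eps, the opposite of
    a tail, where the factor 1/(1 + t) of the kernel gives the rate. The bound is uniform in y_0, as
    needed to integrate in that variable. *)
Lemma vanishing_bound f (Y : R) : real_decay f -> vanishing f -> 0 <= Y ->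
  exists2 C, 0 <= C & forall y T, `|coord ord0 y| <= Y -> 0 <= T ->
    `|half_conv T f y| <= C / (1 + T).
Proof.
move=> df vf Y0; have [C C0 HC] := half_conv_kernel df Y0.
have cf : continuous f by apply: smooth_continuous; case: df.
exists (2 * C); first by rewrite mulr_ge0.
move=> y T yY T0; apply/ler_addgt0Pr => eps eps0.
have [T' TT' HT'] := vf y eps T eps0.
have ci := @half_conv_integrand f y cf.
have E1 : half_conv T f y = half_conv T' f y - iint T T' (fun t => tpow s t * f (1 *: (y - ray t))).
  by rewrite /half_conv /rayconv (iint_chasles ci T0 TT') addrK.
rewrite E1 (le_trans (ler_normB _ _))// addrC lerD// -mulrA.
apply: iint_oneDsqr_bound => //.
- by rewrite divr_ge0// addr_ge0.
- by rewrite T0.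
move=> t /andP[Tt tT']; have t0 := le_trans T0 Tt; apply: (le_trans (HC y t yY t0)).
rewrite ler_wpM2r ?invr_ge0 ?addr_ge0 ?sqr_ge0// ler_wpM2l// lef_pV2 ?posrE ?ltr_wpDr//.
by rewrite lerD2l.
Qed.

Lemma real_decay_partial f : real_decay f -> real_decay (partial ord0 f).
Proof.
move=> [sf H]; split=> [|beta q]; first exact: smooth_partial.
have [M M0 HM] := H [ffun i => ((if i == ord0 then 1 else 0) + beta i)%N] q.
by exists M => // z i; have := HM z i; rewrite -mi_word_cons.
Qed.

(** The truncation of f at y is its value at y - a e_0 plus the integral in between of the
    truncation of [partial ord0 f]. The value at y - a e_0 is small for large a, uniformly in T,
    because the arguments of f there are at distance at least a/2 + t from 0. Once a is fixed, T
    makes the integral small. *)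
Lemma vanishing_partial f : real_decay f -> vanishing (partial ord0 f) -> vanishing f.
Proof.
move=> df vpf y eps T0 eps0; have [P [C C0 HC]] := decay_kernel df.
have sf : smooth_on setT f by case: df.
have cf := smooth_continuous sf.
set Y := `|coord ord0 y|; have Y0 : 0 <= Y by exact: normr_ge0.
(* The term 2 Y ensures Y <= a/2, and 8 C / eps ensures 2 C / (1 + a/2) <= eps/2. *)
pose a := 2 * Y + 8 * C / eps; have a0 : 0 <= a by rewrite addr_ge0 ?divr_ge0 ?mulr_ge0// ltW.
have [C' C'0 HC'] := vanishing_bound (real_decay_partial df) vpf (addr_ge0 a0 Y0).
have q0 : 0 <= 2 * a * C' / eps by rewrite divr_ge0 ?mulr_ge0// ltW.
(* The second term ensures C' a / (1 + T) <= eps/2. *)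
pose T := `|T0| + 2 * a * C' / eps; have TT : 0 <= T by rewrite addr_ge0.
exists T; first by rewrite (le_trans (ler_norm T0))// lerDl.
have T1 : 0 < 1 + T by rewrite ltr_wpDr.
pose g (h : R) := half_conv T f (h *: delta_mx 0 ord0 + y).
pose g' (h : R) := half_conv T (partial ord0 f) (h *: delta_mx 0 ord0 + y).
have dg (x : R) : is_derive x 1 g (g' x).
  have [C1 D] := rayconv_C1 1 T (x *: delta_mx 0 ord0 + y) (tpow_continuous s0) sf.
  apply: (is_derive_ext (line_is_derive C1)) => //.
  by rewrite D mul1r.
have cg' : continuous g'.
  apply: continuous_compf.
    exact: (smooth_continuous (rayconv_smooth 1 T (tpow_continuous s0) (smooth_partial ord0 sf))).
  apply: continuousDv; last exact: cst_continuous.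
  by apply: continuousZv => [x|]; [exact: cvg_id|exact: cst_continuous].
have Na : - a <= 0 by rewrite oppr_le0.
have F : iint (- a) 0 g' = g 0 - g (- a).
  apply: iint_FTC2 => // x _; exact: derive_continuous (dg x).
have b1 : `|iint (- a) 0 g'| <= C' / (1 + T) * (0 - - a).
  apply: iint_bound => // x /andP[xa x0]; apply: HC' => //.
  rewrite (_ : coord _ _ = x + coord ord0 y); last by rewrite /coord !mxE !eqxx mulr1.
  rewrite (le_trans (ler_normD _ _))// lerD2r// ler_norml xa (le_trans x0)//.
have b2 : `|g (- a)| <= eps / 2.
  have a1 : 0 < 1 + a / 2 by rewrite ltr_wpDr// divr_ge0.
  apply: (@le_trans _ _ (2 * (C / (1 + a / 2)))).
    apply: iint_oneDsqr_bound => //; [by rewrite divr_ge0// ltW|by rewrite lexx|exact: half_conv_integrand|].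
    move=> t /andP[t0 tT]; have t2 : 0 < 1 + t ^+ 2 by rewrite ltr_wpDr// sqr_ge0.
    rewrite ler_pdivlMr// ler_pdivlMr// mulrC [_ * (1 + t ^+ 2)]mulrC.
    have z0 : coord ord0 (1 *: (- a *: delta_mx 0 ord0 + y - ray t)) = - (a - coord ord0 y + t).
      by rewrite scale1r /coord !mxE !eqxx !mulr1; ring.
    have z1 : a / 2 + t <= `|coord ord0 (1 *: (- a *: delta_mx 0 ord0 + y - ray t))|.
      rewrite z0 normrN (le_trans _ (ler_norm _))// lerD2r.
      have aY : Y <= a / 2.
        by rewrite ler_pdivlMr// mulrC /a lerDl divr_ge0 ?mulr_ge0// ltW.
      by rewrite [leRHS](_ : _ = a / 2 + (a / 2 - coord ord0 y)) ?lerDl ?subr_ge0 ?(le_trans (ler_norm _) aY)//; field.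
    set z := 1 *: _ in z0 z1 *.
    have := HC 1 (1 + a / 2) t z; rewrite expr1n !mul1r; apply => //; first exact: ltW.
      by rewrite lerD2l (le_trans _ z1)// lerDr divr_ge0.
    by rewrite lerD2l (le_trans _ z1)// lerDl.
  rewrite mulrA ler_pdivrMr// (_ : eps / 2 * (1 + a / 2) = eps / 2 + eps * Y / 2 + 2 * C).
    by rewrite lerDr addr_ge0 ?divr_ge0 ?mulr_ge0// ltW.
  by rewrite /a; field; rewrite gt_eqF.
have b3 : C' / (1 + T) * (0 - - a) <= eps / 2.
  rewrite sub0r opprK mulrAC ler_pdivrMr// (_ : eps / 2 * (1 + T) = eps / 2 + eps * `|T0| / 2 + C' * a).
    by rewrite lerDr addr_ge0 ?divr_ge0 ?mulr_ge0// ltW.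
  by rewrite /T; field; rewrite gt_eqF.
have -> : half_conv T f y = iint (- a) 0 g' + g (- a) by rewrite F subrK /g scale0r add0r.
by rewrite [eps]splitr (le_trans (ler_normD _ _))// lerD// (le_trans b1).
Qed.

Lemma vanishing_partials j f : real_decay f -> vanishing (partials (nseq j ord0) f) -> vanishing f.
Proof.
elim: j f => //= j IH f df vf; apply: vanishing_partial => //.
by apply: IH => //; exact: real_decay_partial.
Qed.
End ray_kernel.

(** * Integrals over lines and the mass of the mollifier *)

Section line_integrals.
Context {R : realType} {d : nat}.
Local Notation E := 'rV[R]_d.+1.
Variables (s : R) (s0 : 0 < s).
Implicit Types (f : E -> R).

Lemma iint_indic (a b : R) (h : R -> R) : continuous h ->
  (\int[@lebesgue_measure R]_z ((\1_(`[a, b]%classic : set R) z * h z)%:E) = (iint a b h)%:E)%E.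
Proof.
move=> ch; rewrite /iint /Rintegral fineK; last first.
  by apply: integrable_fin_num => //; exact: continuous_integrable.
rewrite [RHS]integral_mkcond; apply: eq_integral => z _; rewrite patchE indicE.
by case: ifP => _ /=; rewrite ?mul1r ?mul0r.
Qed.

(* With y = n e_0 + x, the substitution z = n - t turns n^(-s) half_conv T f y into the integral
   of max(0, 1 - z/n)^s f(z e_0 + x) over [n - T, n], which tends to the integral of f(z e_0 + x). *)
Lemma vanishing_line f x : real_decay f -> vanishing s f -> coord ord0 x = 0 ->
  (\int[@lebesgue_measure R]_z (f (ray z + x))%:E = 0)%E.
Proof.
move=> df vf x0; have cf : continuous f by apply: smooth_continuous; case: df.
have [P [C C0 HC]] := decay_kernel s0 df.
(* With T at least 2 (n + 1), the segment [n + 1 - T, n + 1] contains [-(n + 1), n + 1], so that its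
   indicator tends to 1 everywhere. *)
have /choice[T HT] : forall n : nat, exists T : R, 2 * n.+1%:R <= T /\
    `|half_conv s T f (ray n.+1%:R + x)| <= n.+1%:R^-1.
  by move=> n; have [T h1 h2] := vf (ray n.+1%:R + x) n.+1%:R^-1 (2 * n.+1%:R) ltac:(by []); exists T.
pose h (n : nat) (z : R) := tpow s (1 - n.+1%:R^-1 * z) * f (ray z + x).
have cfx : continuous (fun z : R => f (ray z + x)).
  apply: continuous_compf => //; apply: continuousDv; last exact: cst_continuous.
  exact: ray_continuous.
have cw n : continuous (fun z : R => 1 - n.+1%:R^-1 * z).
  have -> : (fun z : R => 1 - n.+1%:R^-1 * z) = (fun z => 1 + (- n.+1%:R^-1) * z).
    by apply/funext => z; rewrite mulNr.
  apply: continuousDf; first exact: cst_continuous.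
  by apply: continuousMf; [exact: cst_continuous|move=> z; exact: cvg_id].
have ch n : continuous (h n).
  apply: continuousMf => //; apply: continuous_compf; last exact: cw.
  exact: tpow_continuous.
pose I n : set R := `[n.+1%:R - T n, n.+1%:R]%classic.
pose F (n : nat) (z : R) : \bar R := (\1_(I n) z * h n z)%:E.
have bF n : `|iint (n.+1%:R - T n) n.+1%:R (h n)| <= n.+1%:R^-1.
  have [h1 h2] := HT n; have m0 : 0 < n.+1%:R :> R by [].
  have T0 : 0 <= T n by rewrite (le_trans _ h1)// mulr_ge0.
  have := iint_reflect n.+1%:R T0 (ch n); rewrite subr0 => <-.
  have -> : iint 0 (T n) (fun t => h n (n.+1%:R - t)) =
      tpow s n.+1%:R^-1 * half_conv s (T n) f (ray n.+1%:R + x).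
    rewrite -iintZ; last exact: half_conv_integrand.
    apply: eq_iint => t _; rewrite /h.
    have -> : 1 - n.+1%:R^-1 * (n.+1%:R - t) = n.+1%:R^-1 * t by rewrite mulrBr mulVf ?gt_eqF// opprB addrC subrK.
    have E2 : tpow s n.+1%:R^-1 = n.+1%:R^-1 `^ s by rewrite tpowE ?invr_ge0.
    rewrite tpowM ?invr_ge0// E2 mulrA; congr (_ * f _).
    by rewrite scale1r /ray scalerBl addrAC.
  rewrite normrM ger0_norm ?tpow_ge0// -[leRHS]mul1r ler_pM ?tpow_ge0//.
  apply: (@le_trans _ _ (tpow s 1)); last by rewrite tpowE// powR1.
  by apply: tpow_le; [exact: ltW|rewrite invf_le1// ler1n].
have mF n : measurable_fun setT (F n).
  apply/measurable_EFinP; apply: measurable_funM; first by apply: measurable_indic; exact: measurable_itv.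
  exact: continuous_measurable_fun.
have mf : measurable_fun setT (fun z : R => (f (ray z + x))%:E).
  by apply/measurable_EFinP; exact: continuous_measurable_fun.
have lim z : F n z @[n --> \oo] --> (f (ray z + x))%:E.
  apply: cvg_EFin; first by near=> n.
  have cvh : h n z @[n --> \oo] --> f (ray z + x).
    rewrite -[X in _ --> X]mul1r; apply: cvgM; last exact: cvg_cst.
    have t1 : tpow s 1 = 1 :> R by rewrite tpowE// powR1.
    rewrite -[X in _ --> X]t1; apply: continuous_cvg; first exact: tpow_continuous.
    have c0 : n.+1%:R^-1 * z @[n --> \oo] --> 0 * z.
      by apply: cvgM; [exact: cvg_harmonic|exact: cvg_cst].
    have c1 : (fun=> 1 : R) @ \oo --> (1 : R) by exact: cvg_cst.
    have := @cvgB R R nat \oo _ (fun=> 1) (fun n => n.+1%:R^-1 * z) 1 (0 * z) c1 c0.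
    by rewrite (_ : 1 - 0 * z = 1); [apply; exact: eventually_filter|ring].
  apply: cvg_trans cvh; apply: near_eq_cvg; near=> n.
  rewrite /= indicE mem_set ?mul1r// /I /= in_itv /=.
  have zn : `|z| <= n.+1%:R.
    apply: (@le_trans _ _ n%:R); last by rewrite ler_nat.
    by near: n; exact: nbhs_infty_ger.
  have [h1 _] := HT n; move: zn; rewrite ler_norml => /andP[zn ->]; rewrite andbT; lra.
have dom n z : (`|F n z| <= ((2 ^+ P * C) / (1 + z ^+ 2))%:E)%E.
  rewrite abse_EFin lee_fin normrM.
  have t2 : 0 < 1 + z ^+ 2 by rewrite ltr_wpDr// sqr_ge0.
  apply: (@le_trans _ _ `|h n z|).
    by rewrite ler_piMl// indicE; case: (_ \in _); rewrite ?normr0 ?normr1.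
  rewrite ler_pdivlMr// mulrC.
  have z0 : coord ord0 (ray z + x) = z.
    by have := coord_ray ord0 z; rewrite /coord => E1; rewrite mxE E1 -/(coord _ _) x0 eqxx mul1r addr0.
  (* The exponent base 1 - z/(n + 1) is at most 1 + |z|, which is taken as t in [decay_kernel] and
     does not depend on n. *)
  have := HC 2 1 (1 + `|z|) (ray z + x); rewrite mul1r z0 => H.
  apply: le_trans (H _ _ _ _ _); try lra; try by rewrite ?addr_ge0//.
  - apply: ler_pM; [exact: ltW|exact: normr_ge0| |].
      rewrite lerD2l -real_normK ?num_real// lerXn2r ?nnegrE ?addr_ge0//; lra.
    rewrite /h !normrM ler_wpM2r// ![`|tpow _ _|]ger0_norm ?tpow_ge0// tpow_le ?(ltW s0)// lerD2l.
    rewrite -mulrN (le_trans (ler_norm _))// normrM normrN ger0_norm ?invr_ge0//.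
    by rewrite ler_piMl// invf_le1// ler1n.
  - by have := normr_ge0 z; lra.
  - by have := normr_ge0 z; lra.
have [_ _ D] := @dominated_convergence _ _ R (@lebesgue_measure R) setT measurableT F
  (fun z => (f (ray z + x))%:E) (fun z => ((2 ^+ P * C) / (1 + z ^+ 2))%:E) mF mf
  (ltac:(by apply: aeW => z _; exact: lim))
  (integrable_oneDsqr (mulr_ge0 (exprn_ge0 P (ler0n R 2)) C0))
  (ltac:(by apply: aeW => z n _; exact: dom)).
apply: (cvg_unique _ D) => //.
have E1 : (fun n => \int[@lebesgue_measure R]_z F n z)%E =
    (fun n => (iint (n.+1%:R - T n) n.+1%:R (h n))%:E).
  by apply/funext => n; exact: iint_indic.
rewrite E1; apply: cvg_EFin; first by near=> n.
apply/norm_cvg0P; apply: (@squeeze_cvgr _ _ _ _ (fun=> 0) harmonic); last exact: cvg_harmonic.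
  by near=> n; rewrite normr_ge0 /=; exact: bF.
exact: cvg_cst.
Unshelve. all: by end_near. Qed.
End line_integrals.

Section mollifier_mass.
Context {R : realType} {d : nat}.
Local Notation E := 'rV[R]_d.+1.

(** The real-valued integral is 0 by default when the positive or negative part has an infinite
    integral, so a nonzero value excludes both. For Re rho, of integral 1, this gives integrability
    without any estimate in several variables. *)
Lemma integrable_of_integral dsp (T : measurableType dsp) (mu : {measure set T -> \bar R}) (f : T -> R) :
  measurable_fun setT f -> \int[mu]_t f t != 0 -> mu.-integrable setT (EFin \o f).
Proof.
move=> mf; rewrite /Rintegral integralE => H.
have me : measurable_fun setT (EFin \o f) by exact/measurable_EFinP.
have p0 : (0 <= \int[mu]_t (EFin \o f)^\+ t)%E by apply: integral_ge0 => t _; exact: funepos_ge0.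
have n0 : (0 <= \int[mu]_t (EFin \o f)^\- t)%E by apply: integral_ge0 => t _; exact: funeneg_ge0.
have [p n] : (\int[mu]_t (EFin \o f)^\+ t < +oo /\ \int[mu]_t (EFin \o f)^\- t < +oo)%E.
  move: H p0 n0; case: (\int[mu]_t (EFin \o f)^\+ t)%E => [p| |]//;
    case: (\int[mu]_t (EFin \o f)^\- t)%E => [n| |]//=; rewrite ?eqxx//.
  by move=> _ _ _; rewrite !ltry.
rewrite (funeposneg (EFin \o f)); apply: integrableB => //.
  apply/integrableP; split; first exact: measurable_funepos.
  by under eq_integral do rewrite gee0_abs ?funepos_ge0//.
apply/integrableP; split; first exact: measurable_funeneg.
by under eq_integral do rewrite gee0_abs ?funeneg_ge0//.
Qed.

Lemma mollifier_not_vanishing (rho : mollifier R d.+1) (s : R) : 0 < s ->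
  ~ vanishing s (fun x => complex.Re (rho x)).
Proof.
move=> s0 v; have [dr _] := schwartz_real_decay (moll_schwartz rho).
have cr : continuous (fun x => complex.Re (rho x)) by apply: smooth_continuous; case: dr.
have [I1 _] : rint (fun x => complex.Re (rho x)) = 1 /\ rint (fun x => complex.Im (rho x)) = 0.
  by have := moll_int1 rho; rewrite cintegralE => -[].
have mr := measurable_row cr.
have ir : (lebesgueN d.+1).-integrable setT
    (fun t : d.+1.-tuple (measurableTypeR R) => (complex.Re (rho (row_of t)))%:E).
  by apply: (integrable_of_integral mr); rewrite /rint in I1; rewrite I1 oner_neq0.
have := lebesgueN_fubini (measurable_int _ ir) ir.
have -> : (\int[lebesgueN d.+1]_t (complex.Re (rho (row_of t)))%:E = 1%:E)%E.
  by rewrite -(fineK (integrable_fin_num measurableT ir)); congr EFin; exact: I1.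
under eq_integral => t _.
  rewrite (_ : (\int[_]_x _)%E = 0%E); first over.
  rewrite -[RHS](vanishing_line s0 (x := rowcons 0 (row_of t)) dr v).
    by apply: eq_integral => z _; rewrite row_of_cons rowconsE.
  by rewrite /coord mxE unlift_none.
by rewrite integral0 => /eqP; rewrite eqe oner_eq0.
Qed.
End mollifier_mass.

(** * Blow-up at the origin *)

Lemma powR_le1 (R : realType) (l p q : R) : 0 < l <= 1 -> p <= q -> l `^ q <= l `^ p.
Proof.
move=> /andP[l0 l1] pq; rewrite -(subrK p q) addrC powRD ?(gt_eqF l0) ?implybT//.
rewrite ler_piMr ?powR_ge0//; have <- : (1 : R) `^ (q - p) = 1 by rewrite powR1.
by apply: ge0_ler_powR; rewrite ?nnegrE ?subr_ge0// ltW.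
Qed.

Section row_norm.
Context {R : realType} {d : nat}.
Local Notation E := 'rV[R]_d.

Lemma compact_norm_le (r : R) : compact [set x : E | `|x| <= r].
Proof.
apply: bounded_closed_compact.
  by exists r; split; [exact: num_real|move=> M rM x /= /le_trans; apply; exact: ltW].
have -> : [set x : E | `|x| <= r] = (fun x : E => `|x|) @^-1` `]-oo, r]%classic.
  by apply/seteqP; split=> x /=; rewrite in_itv.
by apply: preimage_closed => [x _|]; [exact: norm_continuous|exact: interval_closed].
Qed.
End row_norm.

Section ray_asymptotics.
Context {R : realType} {d : nat}.
Local Notation E := 'rV[R]_d.+1.
Variables (s : R) (k : nat) (s0 : 0 < s) (T : R) (T0 : 0 < T) (a f : E -> R).
Hypotheses (ca : cutoff_family T (fun=> a)) (df : real_decay f).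
Hypothesis a1 : forall x : E, `|x| <= 2 -> a x = 1.

Let sa : smooth_on setT a.
Proof. by have [H _ _] := ca; apply: (H 1); rewrite ltr01 lexx. Qed.

Let sf : smooth_on setT f. Proof. by case: df. Qed.

Let aM : exists2 M, 0 <= M & forall t, `|a (ray t)| <= M.
Proof.
have [M M0 HM] := cutoff_uniform 0 ca; exists M => // t.
by apply: (HM 0%N 1) => //; rewrite ltr01 lexx.
Qed.

Lemma norm_ray (t : R) : `|ray t : E| <= `|t|.
Proof.
rewrite normrZ ler_piMr//.
have -> : `|delta_mx 0 ord0 : E| = mx_norm (delta_mx 0 ord0 : E) by [].
rewrite mx_normrE; apply: bigmax_le => // i _; rewrite mxE.
by case: (_ && _); rewrite ?normr1 ?normr0.
Qed.

(** The profile at scale e, after the substitution of e t for t, which takes the upper limit T / e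
    to T / e / e. The cutoff a(e t e_0) tends to 1, and the profile to a half-line convolution. *)
Definition inner n e y := rayconv 1 (fun t => tpow s t * a (ray (e * t))) (T / e / e)
  (partials (nseq (k + n) ord0) f) y.

(** The discarded terms contain a derivative of a. It vanishes for t < 2, where a is constant; for t
    >= 2 the point e y, whose first coordinate is at most 1 in absolute value, is at distance at
    least 1 from the ray point, and f is smaller than any power of e. *)
Lemma regularized_inner n m (Y : R) : 0 <= Y -> exists2 C, 0 <= C & forall e y, 0 < e <= 1 -> e * Y <= 1 ->
  `|coord ord0 y| <= Y ->
  `|partials (nseq n ord0) (regularized s k (fun=> a) f e) (e *: y) -
    (-1) ^+ k * (e ^- (d.+1 + k + n) * (e `^ s * e)) * inner n e y| <= C * e ^+ m.
Proof.
move=> Y0; have [N [C C0 HC]] := @prefactor_bound R d s k T n (ltW T0).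
have [M1 M10 H1] := cutoff_uniform k ca.
have [M2 M20 H2] := far_decay k [ffun i => if i == ord0 then n else 0%N] (m + N) ltr01 df.
exists (C * (M1 * M2)); first by rewrite !mulr_ge0.
move=> e y e01 eY yY; have /andP[e0 e1] := e01; have en : e != 0 by rewrite gt_eqF.
have Te : 0 <= T / e by rewrite divr_ge0// ltW.
have Tee : 0 <= T / e / e by rewrite divr_ge0// ltW.
have [_ aT _] := ca.
have B : forall i j t, (0 < i <= k)%N -> (j <= k)%N -> 0 <= t <= T / e ->
      `|partials (nseq i ord0) a (ray t)| *
      `|partials (nseq j ord0 ++ nseq n ord0) f (e^-1 *: (e *: y - ray t))| <= M1 * (M2 * e ^+ (m + N)).
  move=> i j t /andP[i0 ik] jk /andP[t0 _].
  have [t2|t2] := leP 2 t.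
    rewrite ler_pM ?(H1 i e)// -(@mi_word_nseq d n) H2//; exists ord0.
    have -> : coord ord0 (e *: y) = e * coord ord0 y by rewrite /coord mxE.
    rewrite coord_ray eqxx mul1r.
    have : `|e * coord ord0 y| <= 1.
      by rewrite normrM gtr0_norm// (le_trans _ eY)// ler_wpM2l// ltW.
    by rewrite ler_norml distrC => /andP[h1 h2]; rewrite (le_trans _ (ler_norm _))//; lra.
  have oB : open (ball (0 : E) 2) by apply: ball_open.
  have aB (x : E) : ball (0 : E) 2 x -> a x = 1.
    by rewrite -ball_normE /= sub0r normrN => x2; apply: a1; exact: ltW.
  have rB : ball (0 : E) 2 (ray t).
    by rewrite -ball_normE /= sub0r normrN (le_lt_trans (norm_ray t))// ger0_norm.
  rewrite (partials_ext (g := fun=> 1) (nseq i ord0) oB aB rB).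
  rewrite (_ : partials _ (fun=> 1) (ray t) = 0) ?normr0 ?mul0r.
    by rewrite !mulr_ge0// exprn_ge0// ltW.
  case: i i0 {ik} => // i _ /=.
  have -> : partial ord0 (fun=> 1 : R) = (fun=> 0) :> (E -> R).
    by apply/funext => x; rewrite /partial (@derive_cst R _ _ (1 : R)).
  elim: i => //= i; rewrite (_ : partial ord0 (fun=> 0) = fun=> 0)//.
  by apply/funext => x; rewrite /partial (@derive_cst R _ _ (0 : R)).
have B0 : 0 <= M1 * (M2 * e ^+ (m + N)) by rewrite !mulr_ge0// exprn_ge0// ltW.
have main := raylocal_main_term s0 Te sa sf (aT e e01) B0 B.
have cka : continuous (fun t => tpow s t * a (ray t)).
  by apply: ray_integrand_continuous => //; exact: smooth_continuous.
have cF : continuous (partials (nseq (k + n) ord0) f).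
  by apply: smooth_continuous; exact: smooth_partials.
have E1 : rayconv e^-1 (fun t => tpow s t * a (ray t)) (T / e)
    (partials (nseq k ord0 ++ nseq n ord0) f) (e *: y) = e `^ s * e * inner n e y.
  rewrite -nseqD [_ * e]mulrC -mulrA /inner /rayconv.
  have := @iint_scale R 0 (T / e / e) e 0 _ e0 Tee
    (@rayconv_integrand R d e^-1 (partials (nseq (k + n) ord0) f) _ (e *: y) cF cka).
  rewrite mulr0 !addr0 (_ : e * (T / e / e) = T / e); last by field.
  move=> /(congr1 (fun q => e * q)); rewrite mulVKf// => <-; congr (e * _).
  rewrite -iintZ; last first.
    apply: rayconv_integrand => //; apply: continuousMf; first exact: tpow_continuous.
    apply: continuous_compf; first exact: smooth_continuous sa.
    apply: continuous_compf; first exact: ray_continuous.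
    by apply: continuousMf => [t|t]; [exact: cst_continuous|exact: cvg_id].
  apply: eq_iint => t _; rewrite addr0 tpowM ?(ltW e0)//.
  have -> : e^-1 *: (e *: y - ray (e * t)) = 1 *: (y - ray t).
    by rewrite scale1r scalerBr /ray !scalerA mulVf// mulKf// scale1r.
  by rewrite !mulrA.
rewrite (regularized_partials k s0 _ _ (ltW T0) ca sf e01).
move: main; rewrite E1 size_nseq => main.
have -> : (-1) ^+ k * (e ^- (d.+1 + k + n) * (e `^ s * e)) * inner n e y =
    e ^- d.+1 * ((- e^-1) ^+ k * e^-1 ^+ n * (e `^ s * e * inner n e y)).
  by rewrite -[- e^-1]mulN1r exprMn -!exprVn !exprD; ring.
rewrite -mulrBr normrM ger0_norm ?invr_ge0 ?exprn_ge0 ?(ltW e0)//.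
have eD : 0 <= e ^- d.+1 by rewrite invr_ge0 exprn_ge0// ltW.
apply: (le_trans (ler_wpM2l eD main)); rewrite [leLHS]mulrA.
apply: (le_trans (ler_wpM2r B0 (HC e e01))).
have eN : e ^+ N != 0 by rewrite expf_neq0.
rewrite exprD le_eqVlt; apply/orP; left; apply/eqP; field; exact: eN.
Qed.

Lemma real_decay_partials j (g : E -> R) : real_decay g -> real_decay (partials (nseq j ord0) g).
Proof. by elim: j g => [|j IH] g dg; [exact: dg|exact: (IH _ (real_decay_partial dg))]. Qed.

(** The two integrands differ only for t > 2 / e, where the factor 1/(1 + t) of [half_conv_kernel]
    is at most e. *)
Lemma inner_half_conv n (Y : R) : 0 <= Y -> exists2 C, 0 <= C & forall e y, 0 < e <= 1 ->
  `|coord ord0 y| <= Y -> `|inner n e y| <= C /\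
  `|half_conv s (T / e / e) (partials (nseq (k + n) ord0) f) y - inner n e y| <= C * e.
Proof.
move=> Y0; have dF := real_decay_partials (k + n) df.
set F := partials (nseq (k + n) ord0) f in dF *.
have [sF _] := dF; have cF := smooth_continuous sF.
have [C C0 HC] := half_conv_kernel s0 dF Y0; have [M M0 HM] := aM.
exists (2 * ((M + 1) * C)); first by rewrite !mulr_ge0// addr_ge0.
move=> e y /andP[e0 e1] yY; have en : e != 0 by rewrite gt_eqF.
have Tee : 0 <= T / e / e by rewrite !divr_ge0// ltW.
have cka : continuous (fun t => tpow s t * a (ray (e * t))).
  apply: continuousMf; first exact: tpow_continuous.
  apply: continuous_compf; first exact: smooth_continuous sa.
  apply: continuous_compf; first exact: ray_continuous.
  by apply: continuousMf => [t|t]; [exact: cst_continuous|exact: cvg_id].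
have ci1 := @rayconv_integrand R d 1 F _ y cF cka.
have ci2 := @half_conv_integrand R d s s0 F y cF.
have k0 (t : R) : 0 < 1 + t ^+ 2 by rewrite ltr_wpDr// sqr_ge0.
have MC0 : 0 <= (M + 1) * C by rewrite mulr_ge0// addr_ge0.
split.
  apply: iint_oneDsqr_bound => //; first by rewrite lexx.
  move=> t /andP[t0 tT]; have := HC y t yY t0; set q := tpow s t * _ => Hq.
  have -> : tpow s t * a (ray (e * t)) * F (1 *: (y - ray t)) = a (ray (e * t)) * q.
    by rewrite /q; ring.
  rewrite normrM -!mulrA; apply: ler_pM => //; first by rewrite (le_trans (HM _))// lerDl.
  apply: (le_trans Hq); rewrite -mulrA ler_wpM2l// ler_piMl ?invr_ge0 ?(ltW (k0 t))//.
  by rewrite invf_le1 ?lerDl// ltr_wpDr.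
rewrite /half_conv /inner /rayconv -iintB// -[leRHS]mulrA.
apply: iint_oneDsqr_bound => //.
- by rewrite mulr_ge0// ltW.
- by rewrite lexx.
- by apply: continuousBv.
move=> t /andP[t0 tT]; have := HC y t yY t0; set q := tpow s t * F _ => Hq.
have -> : q - tpow s t * a (ray (e * t)) * F (1 *: (y - ray t)) = (1 - a (ray (e * t))) * q.
  by rewrite /q; ring.
have [et|et] := leP (e * t) 2.
  rewrite a1 ?subrr ?mul0r ?normr0; last first.
    by rewrite (le_trans (norm_ray _))// ger0_norm// mulr_ge0// ltW.
  by rewrite divr_ge0 ?(ltW (k0 t))// mulr_ge0// ltW.
rewrite normrM -!mulrA; apply: ler_pM => //.
  by rewrite (le_trans (ler_normB _ _))// normr1 addrC lerD2r.
apply: (le_trans Hq); rewrite -mulrA ler_wpM2l// ler_wpM2r ?invr_ge0 ?(ltW (k0 t))//.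
rewrite -[leLHS]mul1r ler_pdivrMr ?ltr_wpDr//.
by rewrite mulrDr mulr1; have := ltW e0; lra.
Qed.

(** The prefactor is e^(alpha - n), since s + 1 - (d + 1 + k + n) = alpha - n. *)
Lemma prefactor_ge1 n e alpha : s = alpha + d%:R + k%:R -> alpha <= n%:R -> 0 < e <= 1 ->
  1 <= e ^- (d.+1 + k + n) * (e `^ s * e).
Proof.
move=> sE an e01; have /andP[e0 e1] := e01.
rewrite mulrC ler_pdivlMr ?exprn_gt0// mul1r -[(d.+1 + k + n)%N]/((d + k + n).+1) exprSr.
rewrite ler_wpM2r ?(ltW e0)// -powR_mulrn ?(ltW e0)//; apply: powR_le1 => //.
by rewrite sE !natrD; lra.
Qed.

(* Approximate homogeneity of the regularizations near the origin makes [inner n e y] of degree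
   [alpha - n] in [y] up to [O(e)]; as it is bounded near 0, it must tend to 0 when [alpha < n]. *)
Lemma homogeneous_vanishing alpha n : s = alpha + d%:R + k%:R -> alpha + 1 <= n%:R ->
  (forall (l : R) y, 0 < l -> exists C : R, \forall e \near 0^'+,
    `|l ^+ n * partials (nseq n ord0) (regularized s k (fun=> a) f e) (e *: (l *: y)) -
      l `^ alpha * partials (nseq n ord0) (regularized s k (fun=> a) f e) (e *: y)| <= C * e) ->
  vanishing s (partials (nseq (k + n) ord0) f).
Proof.
move=> sE an H y eps S0 eps0.
set Y := `|coord ord0 y|; have Y0 : 0 <= Y by exact: normr_ge0.
have [C1 C10 H1] := regularized_inner n 1 Y0.
have [B B0 H2] := inner_half_conv n Y0.
(* This l satisfies l <= 1 and l B <= eps/3. Since n >= alpha + 1, the term l^n |A1| is at most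
   l^alpha l B, hence at most l^alpha eps/3. *)
pose l := (1 + 3 * B / eps)^-1.
have l1 : 1 <= 1 + 3 * B / eps by rewrite lerDl divr_ge0 ?mulr_ge0// ltW.
have l0 : 0 < l by rewrite invr_gt0 (lt_le_trans _ l1).
have ll : l <= 1 by rewrite invf_le1// (lt_le_trans _ l1).
have lB : l * B <= eps / 3.
  rewrite mulrC ler_pdivrMr ?(lt_le_trans _ l1)//.
  have -> : eps / 3 * (1 + 3 * B / eps) = eps / 3 + B by field; rewrite gt_eqF.
  by rewrite lerDr divr_ge0// ltW.
have la : 0 < l `^ alpha by rewrite powR_gt0.
have ln : l ^+ n <= l `^ alpha * l.
  have -> : l `^ alpha * l = l `^ (alpha + 1) by rewrite powRD ?powRr1 ?(ltW l0)// (gt_eqF l0) implybT.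
  by rewrite -powR_mulrn ?(ltW l0)// powR_le1// l0.
have [C2 H3] := H l y l0.
pose C3 := `|C2| + l ^+ n * C1 + l `^ alpha * C1.
have C30 : 0 <= C3 by rewrite !addr_ge0// mulr_ge0// ?exprn_ge0// ltW.
have : \forall e \near (0 : R)^'+, [/\ 0 < e, e <= 1, e * Y <= 1, e * `|S0| <= T &
    [/\ e * C3 <= eps / 3 * l `^ alpha, e * B <= eps / 3 &
    `|l ^+ n * partials (nseq n ord0) (regularized s k (fun=> a) f e) (e *: (l *: y)) -
      l `^ alpha * partials (nseq n ord0) (regularized s k (fun=> a) f e) (e *: y)| <= C2 * e]].
  have small (P Q : R) : 0 <= P -> 0 < Q -> \forall e \near (0 : R)^'+, e * P <= Q.
    move=> P0 Q0; near=> e; have e0 : 0 < e by near: e; exact: nbhs_right_gt.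
    have : e <= Q / (P + 1).
      by near: e; apply: nbhs_right_le; rewrite divr_gt0// ltr_wpDl.
    rewrite ler_pdivlMr ?ltr_wpDl// => HQ; apply: le_trans HQ.
    by rewrite ler_wpM2l ?(ltW e0)// lerDl.
  near=> e; split; last split.
  - by near: e; exact: nbhs_right_gt.
  - by near: e; exact: nbhs_right_le.
  - by near: e; exact: small.
  - by near: e; exact: small.
  - by near: e; apply: small => //; rewrite mulr_gt0// divr_gt0.
  - by near: e; apply: small => //; rewrite divr_gt0.
  - by near: e.
move=> /filter_ex[e [e0 e1 eY eT [eC eB H4]]].
have e01 : 0 < e <= 1 by rewrite e0.
have lyY : `|coord ord0 (l *: y)| <= Y.
  by rewrite /coord mxE normrM gtr0_norm// ler_piMl.
have [i1 _] := H2 e (l *: y) e01 lyY; have [_ i2] := H2 e y e01 (lexx _).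
exists (T / e / e).
  rewrite ler_pdivlMr// ler_pdivlMr// (le_trans _ eT)//.
  apply: (@le_trans _ _ (`|S0| * e * e)).
    by rewrite !ler_wpM2r ?(ltW e0)// ler_norm.
  by rewrite [leRHS]mulrC -mulrA ler_wpM2l// ler_piMl// ltW.
have r1 := H1 e (l *: y) e01 eY lyY; have r2 := H1 e y e01 eY (lexx _).
rewrite expr1 in r1 r2.
set P := e ^- (d.+1 + k + n) * (e `^ s * e) in r1 r2.
have P1 : 1 <= P by apply: (prefactor_ge1 sE) => //; lra.
set D1 := partials _ _ _ in r1 H4; set D2 := partials _ _ (e *: y) in r2 H4.
set A1 := inner _ _ _ in r1 i1; set A2 := inner _ _ y in r2 i2.
have key : `|l ^+ n * A1 - l `^ alpha * A2| <= C3 * e.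
  (* Both main terms carry the same prefactor P >= 1, so an O(e) bound on the difference with the
     prefactor is one without it. *)
  apply: (@le_trans _ _ (P * `|l ^+ n * A1 - l `^ alpha * A2|)).
    by rewrite ler_peMl.
  have -> : P * `|l ^+ n * A1 - l `^ alpha * A2| =
      `|(l ^+ n * D1 - l `^ alpha * D2) - l ^+ n * (D1 - (-1) ^+ k * P * A1) +
        l `^ alpha * (D2 - (-1) ^+ k * P * A2)|.
    rewrite [X in _ = `|X|](_ : _ = (-1) ^+ k * (P * (l ^+ n * A1 - l `^ alpha * A2))); last by ring.
    by rewrite normrM normrX normrN1 expr1n mul1r normrM (ger0_norm (le_trans ler01 P1)).
  rewrite /C3 !mulrDl (le_trans (ler_normD _ _))// lerD//.
    rewrite (le_trans (ler_normB _ _))// lerD//.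
      by rewrite (le_trans H4)// ler_wpM2r ?ler_norm// ltW.
    by rewrite normrM ger0_norm ?exprn_ge0 ?(ltW l0)// -[leRHS]mulrA ler_wpM2l// exprn_ge0// ltW.
  by rewrite normrM (gtr0_norm la) -[leRHS]mulrA ler_wpM2l// ltW.
have A2s : `|A2| <= eps / 3 + eps / 3.
  rewrite -(ler_pM2l la) mulrDr.
  have -> : l `^ alpha * `|A2| = `|l ^+ n * A1 - (l ^+ n * A1 - l `^ alpha * A2)|.
    by rewrite opprB addrC subrK normrM (gtr0_norm la).
  rewrite (le_trans (ler_normB _ _))// lerD//; last first.
    by rewrite (le_trans key)// mulrC [leRHS]mulrC.
  rewrite normrM ger0_norm ?exprn_ge0 ?(ltW l0)//.
  apply: (@le_trans _ _ (l `^ alpha * l * B)); first by rewrite ler_pM// exprn_ge0// ltW.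
  by rewrite -mulrA ler_wpM2l// ltW.
rewrite -(subrK A2 (half_conv _ _ _ _)) (le_trans (ler_normD _ _))//.
rewrite mulrC in eB; have := le_trans i2 eB; lra.
Unshelve. all: by end_near. Qed.
End ray_asymptotics.

(** * From the homogeneity of iota(w) to its mollifications *)

Section homogeneous_embedding.
Context {R : realType} {d : nat}.
Local Notation E := 'rV[R]_d.+1.
Local Notation Rd := (Rd R d.+1).
Variables (rho : mollifier R d.+1) (w : schwartz_distribution R d.+1).

Lemma near_scale_le (y : E) (r : R) : 0 < r -> \forall e \near (0 : R)^'+, `|e *: y| <= r.
Proof.
move=> r0; near=> e; have e0 : 0 < e by near: e; exact: nbhs_right_gt.
have : e <= r / (`|y| + 1) by near: e; apply: nbhs_right_le; rewrite divr_gt0// ltr_wpDl.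
rewrite ler_pdivlMr ?ltr_wpDl// normrZ gtr0_norm// => H; apply: le_trans H.
by rewrite ler_wpM2l ?(ltW e0)// lerDl.
Unshelve. all: by end_near. Qed.

(** On the unit ball, around whose closure psi is 1, the representative of u and the mollified net
    differ by a negligible net. For small e the points e l y and e y lie in the ball of radius 1/2,
    a compact subset, where negligibility is used at order 1 for both the difference and the defect
    of homogeneity. *)
Lemma homogeneous_mollify (psi : test_function) (u : colombeau Rd) (alpha l : R) n y :
  (forall x : E, `|x| <= 2 -> psi x = 1) -> is_embedding rho w u -> homogeneous alpha u -> 0 < l ->
  exists C : R, \forall e \near 0^'+,
    `|l ^+ n * partials (nseq n ord0) (fun x => complex.Re (mollify rho psi w e x)) (e *: (l *: y)) -
      l `^ alpha * partials (nseq n ord0) (fun x => complex.Re (mollify rho psi w e x)) (e *: y)| <= C * e.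
Proof.
move=> psi1 emb hom l0.
pose V : openset R d.+1 := OpenSet (ball_open (0 : E) (1 : R)).
have VE x : oset V x <-> `|x| < 1 by rewrite /V /= -ball_normE /= sub0r normrN.
have clV : closure V `<=` [set x : E | `|x| <= 1].
  have c1 : closed [set x : E | `|x| <= 1].
    by apply: compact_closed; [exact: norm_hausdorff|exact: (@compact_norm_le R d.+1)].
  by rewrite [X in _ `<=` X]((closure_id _).1 c1); apply: closureS => x /VE/ltW.
have cV : compact (closure V).
  by apply: (subclosed_compact _ (@compact_norm_le R d.+1 1) clV); exact: closed_closure.
have nV : set_nbhs (closure V) [set x | psi x = 1].
  apply/set_nbhsP; exists (ball (0 : E) 2); split.
  - exact: ball_open.
  - by move=> x /clV /= x1; rewrite -ball_normE /= sub0r normrN (le_lt_trans x1)// ltr1n.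
  - by move=> x; rewrite -ball_normE /= sub0r normrN => /ltW; exact: psi1.
have [v vE gE] := emb V cV psi nV.
pose U (e : R) (x : E) := complex.Re (net_of (repr u) e x).
pose Mo (e : R) (x : E) := complex.Re (mollify rho psi w e x).
have negl : negligible_net V (net_of (repr u) - net_of v)   by have := gE; rewrite /grestrict => /colombeau_eqP.
have hom' : homogeneous alpha (colombeau_class (repr u)) by rewrite /colombeau_class reprK.
have [_ hneg] := (homogeneous_classP alpha (repr u)).1 hom' l l0.
have [sV nV'] := negl.
have [su _] := moderate_netP (repr u); have [sv _] := moderate_netP v.
pose K := [set x : E | `|x| <= 2^-1].
have cK : compact K by exact: compact_norm_le.
have KV : K `<=` V by move=> x /= x1; apply/VE; rewrite (le_lt_trans x1)// invf_lt1// ltr1n.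
pose beta : mindex d.+1 := [ffun i => if i == ord0 then n else 0%N].
have bE : mi_word beta = nseq n ord0 by exact: mi_word_nseq.
have [M1 H1] := nV' K cK KV beta 1%N.
have [M2 H2] := hneg K cK (@subsetT _ _) beta 1%N.
have Kl : \forall e \near (0 : R)^'+, K (e *: (l *: y)) by exact: near_scale_le.
have Ky : \forall e \near (0 : R)^'+, K (e *: y) by exact: near_scale_le.
exists (M2 + (l ^+ n + l `^ alpha) * M1); near=> e.
have e01 : 0 < e <= 1 by near: e; exact: near01.
have K1 : K (e *: (l *: y)) by near: e.
have K2 : K (e *: y) by near: e.
have sU : smooth_on setT (U e) := (su e e01).1.
have [sMo _] := sv e e01; rewrite vE -/(Mo e) in sMo.
have oV := oset_open V; have oT := @openT E.
have d1 x : K x -> `|partials (nseq n ord0) (U e) x - partials (nseq n ord0) (Mo e) x| <= M1 * e.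
  move=> Kx; have /smoothP k1 : smooth_on V (U e) by exact: sub_smooth (@subsetT _ _) sU.
  have /smoothP k2 := sMo.
  have [_] := partials_lin 1 (-1) oV (k1 (size (nseq n ord0))) (k2 _) (KV x Kx).
  rewrite mul1r mulN1r => <-; rewrite -[e in _ * e]expr1.
  have : modc (mderiv beta ((net_of (repr u) - net_of v) e) x) <= M1 * e ^+ 1.
    by move: x Kx; near: e.
  apply: le_trans; apply: le_trans (Re_le_modc _); rewrite /mderiv bE /=.
  rewrite le_eqVlt; apply/orP; left; apply/eqP; congr (`|partials _ _ x|).
  apply/funext => z; rewrite mul1r mulN1r /U /Mo -vE.
  rewrite -[(net_of (repr u) - net_of v) e z]/(net_of (repr u) e z - net_of v e z).
  by case: (net_of (repr u) e z) (net_of v e z) => [p1 p2] [q1 q2].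
have d2 : `|l ^+ n * partials (nseq n ord0) (U e) (e *: (l *: y)) -
    l `^ alpha * partials (nseq n ord0) (U e) (e *: y)| <= M2 * e.
  have /smoothP k1 : smooth_on setT (fun x => U e (l *: x + 0)) by exact: smooth_affine.
  have /smoothP k2 := sU.
  have [_] := partials_lin 1 (- l `^ alpha) oT (k1 (size (nseq n ord0))) (k2 _) (I : setT (e *: y)).
  rewrite (partials_affine l 0 (k2 _)) addr0 size_nseq mul1r mulNr.
  rewrite [l *: (e *: y)]scalerA [l * e]mulrC -scalerA => <-; rewrite -[e in _ * e]expr1.
  have : modc (mderiv beta (fun x => net_of (repr u) e (l *: x) -
      (l `^ alpha)%:C * net_of (repr u) e x) (e *: y)) <= M2 * e ^+ 1.
    have : forall x, K x -> modc (mderiv beta (fun x => net_of (repr u) e (l *: x) -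
      (l `^ alpha)%:C * net_of (repr u) e x) x) <= M2 * e ^+ 1 by near: e.
    exact.
  apply: le_trans; apply: le_trans (Re_le_modc _); rewrite /mderiv bE /=.
  rewrite le_eqVlt; apply/orP; left; apply/eqP; congr (`|partials _ _ (e *: y)|).
  apply/funext => z; rewrite addr0 mul1r mulNr /U.
  by case: (net_of (repr u) e (l *: z)) (net_of (repr u) e z) => [p1 p2] [q1 q2] /=; ring.
have h1 := d1 _ K1; have h2 := d1 _ K2.
rewrite -/(Mo e).
set u1 := partials _ (U e) _ in d2 h1; set u2 := partials _ (U e) _ in d2 h2.
set m1 := partials _ (Mo e) _ in h1 *; set m2 := partials _ (Mo e) _ in h2 *.
have -> : l ^+ n * m1 - l `^ alpha * m2 =
    (l ^+ n * u1 - l `^ alpha * u2) - (l ^+ n * (u1 - m1) - l `^ alpha * (u2 - m2)) by ring.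
rewrite (le_trans (ler_normB _ _))// mulrDl lerD// (le_trans (ler_normB _ _))// !mulrDl lerD//.
  by rewrite normrM ger0_norm ?exprn_ge0 ?(ltW l0)// -mulrA ler_wpM2l// exprn_ge0// ltW.
by rewrite normrM ger0_norm ?powR_ge0// -mulrA ler_wpM2l// powR_ge0.
Unshelve. all: by end_near. Qed.
End homogeneous_embedding.

Section nonhomogeneous_embedding.
Context {R : realType} {d : nat}.
Local Notation E := 'rV[R]_d.+1.
Local Notation Rd := (Rd R d.+1).

Definition wide_bump (x : E) : R := cube_bump (2^-1 *: x).

Lemma smooth_wide_bump : smooth_on setT wide_bump.
Proof.
rewrite (_ : wide_bump = fun x => cube_bump (2^-1 *: x + 0)).
  exact: (smooth_affine 2^-1 0 (@smooth_cube_bump R d.+1)).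
by apply/funext => x; rewrite addr0.
Qed.

Lemma wide_bump1 x : `|x| <= 2 -> wide_bump x = 1.
Proof.
move=> x2; apply: cube_bump1 => i; rewrite (le_trans (coord_le_norm i _))//.
by rewrite normrZ gtr0_norm ?invr_gt0// mulrC ler_pdivrMr// mul1r.
Qed.

Lemma wide_bump_supp : exists2 K : set E, compact K &
  (forall x, ~ K x -> wide_bump x = 0) /\ forall x, K x -> `|coord ord0 x| <= 4.
Proof.
exists [set x : E | `|x| <= 4]; first exact: compact_norm_le.
split=> [x /= /negP|x /=]; last exact: le_trans (coord_le_norm _ _).
rewrite -ltNge => x4.
have [i Hi] : exists i, 4 < `|coord i x|.
  apply: contrapT => H; move: x4; rewrite ltNge => /negP; apply.
  have -> : `|x| = mx_norm x by [].
  rewrite mx_normrE; apply: bigmax_le => // -[j i] _ /=; rewrite ord1 leNgt; apply/negP => Hi.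
  by apply: H; exists i.
apply: (@cube_bump0 _ _ _ i).
have -> : coord i (2^-1 *: x) = 2^-1 * coord i x by rewrite /coord mxE.
by rewrite normrM gtr0_norm ?invr_gt0//; lra.
Qed.

Lemma wide_test_smooth : csmooth_on setT (fun x => (wide_bump x)%:C).
Proof. by split; [exact: smooth_wide_bump|exact: smooth_cst]. Qed.

Lemma wide_test_supp : exists2 K : set E, compact K & forall x, ~ K x -> (wide_bump x)%:C = 0.
Proof. by have [K cK [H _]] := wide_bump_supp; exists K => // x /H ->. Qed.

Definition wide_test : @test_function R d.+1 := TestFunction wide_test_smooth wide_test_supp.

Variables (s : R) (k : nat) (s0 : 0 < s) (rho : mollifier R d.+1).

Lemma Re_mollify_wide e x : complex.Re (mollify rho wide_test (ray_distribution k s0) e x) =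
  regularized s k (fun=> wide_bump) (fun z => complex.Re (rho z)) e x.
Proof.
rewrite mollify_parts /= mul1r (_ : regularized _ _ (fun=> fun=> 0) _ e x = 0) ?mulr0 ?addr0//.
rewrite /regularized /raylocal /rayd.
have -> : partials (nseq k ord0) (fun y : E => 0 * complex.Im (rho (e^-1 *: (x - y)))) = fun=> 0.
  have -> : (fun y : E => 0 * complex.Im (rho (e^-1 *: (x - y)))) = fun=> 0.
    by apply/funext => y; rewrite mul0r.
  elim: k => //= j; rewrite (_ : partial ord0 (fun=> 0) = fun=> 0)//.
  by apply/funext => y; rewrite /partial (@derive_cst R _ _ (0 : R)).
by rewrite (ray_integralE s (lexx 0)) ?iint_point ?mulr0.
Qed.

Lemma ray_embedding_not_homogeneous alpha (u : colombeau Rd) : s = alpha + d%:R + k%:R ->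
  is_embedding rho (ray_distribution k s0) u -> ~ homogeneous alpha u.
Proof.
move=> sE emb hom.
have ca : cutoff_family 4 (fun=> wide_bump).
  apply: cutoff_family_cst => //; [exact: smooth_wide_bump|exact: wide_bump_supp].
have [dr _] := schwartz_real_decay (moll_schwartz rho).
pose n := (Num.truncn `|alpha|).+2.
have an : alpha + 1 <= n%:R.
  rewrite /n -natr1 lerD2r (le_trans (ler_norm _))// ltW//; exact: truncnS_gt.
apply: (@mollifier_not_vanishing R d rho s s0).
apply: (vanishing_partials s0 (j := k + n)) => //.
apply: (homogeneous_vanishing s0 (ltr0Sn R 3) ca dr wide_bump1 sE an) => l y l0.
have w1 x : `|x| <= 2 -> wide_test x = 1 by move=> x2; rewrite /= wide_bump1.
have [C HC] := homogeneous_mollify n y w1 emb hom l0; exists C; near=> e.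
have : `|l ^+ n * partials (nseq n ord0)
      (fun x => complex.Re (mollify rho wide_test (ray_distribution k s0) e x)) (e *: (l *: y)) -
    l `^ alpha * partials (nseq n ord0)
      (fun x => complex.Re (mollify rho wide_test (ray_distribution k s0) e x)) (e *: y)| <= C * e.
  by near: e.
by under [X in partials _ X]eq_fun do rewrite Re_mollify_wide.
Unshelve. all: by end_near. Qed.
End nonhomogeneous_embedding.

Theorem proposition4p23 (R : realType) (d : nat) (hd : (1 <= d)%N) (alpha : R)
    (rho : mollifier R d) :
  (~ (forall u : colombeau (Rd R d),
        weakly_homogeneous alpha u -> homogeneous alpha u) /\
   exists w : schwartz_distribution R d,
     distr_homogeneous alpha w /\ ~ homogeneous alpha (colombeau_iota rho w)) /\
  exists u : colombeau (Rd R d),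
    weakly_homogeneous alpha u /\
    forall w : schwartz_distribution R d, ~ associated u w.
Proof.
case: d hd rho => // d _ rho; split; first split.
- by move=> H; apply: (wave_not_homogeneous (H _ (wave_weakly_homogeneous alpha))).
(* As k > |alpha|, the exponent s is positive; [d] is now the dimension minus 1. *)
- pose k := (Num.truncn `|alpha|).+1; pose s := alpha + d%:R + k%:R.
  have s0 : 0 < s.
    have : `|alpha| < k%:R by exact: truncnS_gt.
    have := ler_norm (- alpha); rewrite normrN; have := ler0n R d; rewrite /s; lra.
  exists (ray_distribution k s0); split; first exact: ray_distribution_homogeneous.
  apply: (ray_embedding_not_homogeneous (erefl s)).
  (* An embedding exists, so [colombeau_iota] returns one and not its default value 0. Whichever
     class is returned, the preceding lemma applies to it. *)
  exact: (xgetPex 0 (ex_intro _ _ (ray_distribution_embedding k s0 rho))).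
- have [m [j [sigma [sg ->]]]] := degree_decomposition alpha.
  have s0 : 0 < sigma + j%:R by rewrite ltr_wpDr//; case/andP: sg.
  exists (colombeau_class (trunc_net m (j%:R * (pi / 2)) s0)); split.
    exact: trunc_weakly_homogeneous.
  exact: trunc_not_associated.
Qed.
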